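(* Consider the SDE $dx_t=\mu(t,x_t)\,dt+g(t)\,dW_t$ on $[0,T]$ in $\mathbb R^d$, under the standing assumptions of the context. With $t_k=kh$, $h=T/K$, $\Delta W_{t_k}=W_{t_{k+1}}-W_{t_k}$ and $\Delta Z_{t_k}=\int_{t_k}^{t_{k+1}}(W_t-W_{t_k})\,dt$, define $$Q_k(x_k)=x_k+\tfrac12h\,\mu(t_k,x_k),\qquad Q_k^*(x_k)=x_k+\tfrac12h\,\mu(t_k,x_k)+\tfrac32\,\frac{g(t_k)}{h}\,\Delta Z_{t_k},$$ $$P_k=g(t_k)\,\Delta W_{t_k}+\frac{g(t_{k+1})-g(t_k)}{h}\big(h\,\Delta W_{t_k}-\Delta Z_{t_k}\big).$$ Then the scheme $$x_{k+1}=x_k+\tfrac13h\Big[\mu\big(t_k+\tfrac12h,Q_k(x_k)\big)+2\,\mu\big(t_k+\tfrac12h,Q_k^*(x_k)\big)\Big]+P_k$$ is a general strong scheme of order $\gamma=1.5$.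
   Context: $W$ is a $d$-dimensional Wiener process; $(\mathcal F_t)$ is the filtration generated by the initial value and $W$; the scheme starts at the initial value of the SDE, which is Gaussian, $x_0\sim\mathcal N(0,\sigma_T^2I_d)$ for some $\sigma_T^2\geq 0$. Multi-indices $\alpha=(j_1,\dots,j_\ell)$, $j_i\in\{0,\dots,d\}$, together with the empty index $\nu$; $l(\alpha)=\ell$, $n(\alpha)$ = number of zero entries ($l(\nu)=n(\nu)=0$); $-\alpha$ (resp. $\alpha-$) deletes the first (resp. last) entry. $I_\nu[u]_{s,t}=u(t)$; for $\ell\ge1$, $I_\alpha[u]_{s,t}=\int_s^tI_{\alpha-}[u]_{s,r}\,dr$ if $j_\ell=0$ and $=\int_s^tI_{\alpha-}[u]_{s,r}\,dW^{(j_\ell)}_r$ if $j_\ell\ge1$, componentwise for vector-valued $u$; random vectors are regarded as time-constant integrands. With $L^0\varphi=\partial_t\varphi+\sum_i\mu_i\partial_{x_i}\varphi+\tfrac12g(t)^2\sum_i\partial_{x_i}^2\varphi$ and $L^r\varphi=g(t)\partial_{x_r}\varphi$ ($r=1,\dots,d$), the coefficient functions $f_\alpha$ ($\mathbb R^d$-valued) are $f_\nu(t,x)=x$, $f_\alpha=L^{j_1}f_{-\alpha}$ (componentwise). $\mathcal A_\gamma=\{\alpha:l(\alpha)+n(\alpha)\le2\gamma\text{ or }l(\alpha)=n(\alpha)=\gamma+\tfrac12\}$, $\mathcal B(\mathcal A)=\{\alpha\notin\mathcal A:-\alpha\in\mathcal A\}$. A general strong scheme of order $\gamma$ is an adapted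 scheme $x_{k+1}=x_k+\sum_{\alpha\in\mathcal A_\gamma\setminus\{\nu\}}I_\alpha[g_{\alpha,k}]_{t_k,t_{k+1}}+R_k$ with $\mathbb E[\max_{0\le k\le K-1}\|g_{\alpha,k}-f_\alpha(t_k,x_k)\|^2]\le Ch^{2\gamma-\phi(\alpha)}$, where $\phi(\alpha)=2(l(\alpha)-1)$ if $l(\alpha)=n(\alpha)$ and $\phi(\alpha)=l(\alpha)+n(\alpha)-1$ otherwise, and $R_k=R_k^M+R_k^D$ with $\mathbb E[R_k^M\mid\mathcal F_{t_k}]=0$ a.s., $\max_k\mathbb E\|R_k^M\|^2\le C_Rh^{2\gamma+1}$, $\max_k\mathbb E\|R_k^D\|^2\le C_Rh^{2\gamma+2}$, with constants $C,C_R$ independent of $h$. Standing assumptions: $g$ is deterministic and bounded by $M_g$; there is $C_{\mathcal A}>0$ with $\|f_\alpha(t,x)-f_\alpha(t,y)\|\le C_{\mathcal A}\|x-y\|$ and $\|f_\alpha(t,x)\|^2\le C_{\mathcal A}^2(1+\|x\|^2)$ for all $\alpha\in\mathcal A_{3/2}\cup\mathcal B(\mathcal A_{3/2})$, $t\in[0,T]$, $x,y\in\mathbb R^d$; as part of this regularity assumption, $g$ and $\mu$ are smooth, with $\mu(t,\cdot)\in C^3(\mathbb R^d,\mathbb R^d)$, and the derivatives of $g$ and $\mu$ (up to order three, including mixed time derivatives) are Lipschitz continuous and of linear growth in $x$, uniformly in $t\in[0,T]$. *)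

(* Defs.v *)
From HB Require Import structures.
From mathcomp Require Import all_boot all_order all_algebra.
From mathcomp Require Import all_classical all_reals all_analysis.

Set Implicit Arguments.
Unset Strict Implicit.
Unset Printing Implicit Defensive.

Import Order.TTheory GRing.Theory Num.Theory.
Import numFieldNormedType.Exports.

Local Open Scope classical_set_scope.
Local Open Scope ring_scope.

(* The library norm of ['rV_d] is the sup norm. *)
Definition enorm {R : realType} {d : nat} (x : 'rV[R]_d) : R :=
  Num.sqrt (\sum_(i < d) x 0 i ^+ 2).

(* [None] is the letter 0 (time); [Some r], with r < d, is the letter r + 1. *)
Definition multi_index (d : nat) := seq (option 'I_d).

Section MultiIndices.
Context {R : realType} {d : nat}.
Implicit Types (a : multi_index d) (gamma : R).

Definition zeros a : nat := count (pred1 None) a.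

Definition A_set gamma : set (multi_index d) :=
  [set a | (size a + zeros a)%:R <= 2 * gamma \/
           ((size a)%:R = gamma + 2^-1 /\ size a = zeros a)].

(* [behead a] deletes the first entry. *)
Definition B_set (A : set (multi_index d)) : set (multi_index d) :=
  [set a | ~ A a /\ A (behead a)].

Definition phi_exp a : nat :=
  if size a == zeros a then (2 * (size a).-1)%N
  else (size a + zeros a).-1.

End MultiIndices.

Section Coefficients.
Context {R : realType} {d : nat}.
Variables (T : R) (mu : R -> 'rV[R]_d -> 'rV[R]_d) (g : R -> R).
Implicit Types (f : R -> 'rV[R]_d -> R) (a : multi_index d).

(* Time derivatives are taken inside [0, T], hence one-sided at 0 and T. *)
Definition time_quotient f t (x : 'rV[R]_d) : R -> R :=
  fun s => (s - t)^-1 * (f s x - f t x).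

Definition time_nbhs (t : R) : set_system R := within `[0, T] t^'.

Definition dt f : R -> 'rV[R]_d -> R :=
  fun t x => lim (time_quotient f t x @ time_nbhs t).

Definition dx (i : 'I_d) f : R -> 'rV[R]_d -> R :=
  fun t x => 'D_(delta_mx 0 i) (f t) x.

Definition dt_exists f := forall (t : R) (x : 'rV[R]_d), t \in `[0, T] ->
  cvg (time_quotient f t x @ time_nbhs t).

Definition dx_exists i f := forall (t : R) (x : 'rV[R]_d), t \in `[0, T] ->
  derivable (f t) x (delta_mx 0 i).

Definition L0 f : R -> 'rV[R]_d -> R := fun t x =>
  dt f t x + \sum_(i < d) mu t x 0 i * dx i f t x
  + 2^-1 * g t ^+ 2 * \sum_(i < d) dx i (dx i f) t x.

Definition Lspace (r : 'I_d) f : R -> 'rV[R]_d -> R := fun t x =>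
  g t * dx r f t x.

Definition L_op (j : option 'I_d) f :=
  if j is Some r then Lspace r f else L0 f.

Definition L_defined (j : option 'I_d) f : Prop :=
  if j is Some r then dx_exists r f
  else dt_exists f /\ forall i, dx_exists i f /\ dx_exists i (dx i f).

Fixpoint coef_comp a (i : 'I_d) : R -> 'rV[R]_d -> R :=
  if a is j :: b then L_op j (coef_comp b i) else fun _ x => x 0 i.

Definition coef a (t : R) (x : 'rV[R]_d) : 'rV[R]_d :=
  \row_(i < d) coef_comp a i t x.

(* All the derivatives entering the recursive definition of [coef a] exist. *)
Fixpoint coef_defined a : Prop :=
  if a is j :: b
  then coef_defined b /\ forall i, L_defined j (coef_comp b i) else True.

Definition pder1 (j : option 'I_d) f := if j is Some r then dx r f else dt f.

Definition pder1_exists (j : option 'I_d) f :=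
  if j is Some r then dx_exists r f else dt_exists f.

Definition pder (w : multi_index d) f := foldr pder1 f w.

Definition smooth3 f : Prop :=
  (forall j w, (size w < 3)%N -> pder1_exists j (pder w f)) /\
  (forall w, (size w <= 3)%N ->
     {within [set p : R * 'rV[R]_d | p.1 \in `[0, T]],
       continuous (fun p : R * 'rV[R]_d => pder w f p.1 p.2)}).

Definition lipschitz_growth f : Prop := exists L : R,
  forall (t : R) (x y : 'rV[R]_d), t \in `[0, T] ->
    `|f t x - f t y| <= L * enorm (x - y) /\ `|f t x| <= L * (1 + enorm x).

Definition regular3 f : Prop :=
  smooth3 f /\
  forall w, (0 < size w <= 3)%N -> lipschitz_growth (pder w f).

Definition standing_assumptions (Mg CA : R) : Prop :=
  [/\ forall t : R, t \in `[0, T] -> `|g t| <= Mg,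
      0 < CA,
      forall a, (A_set (3 / 2 : R) `|` B_set (A_set (3 / 2 : R))) a ->
        coef_defined a /\
        forall (t : R) (x y : 'rV[R]_d), t \in `[0, T] ->
          enorm (coef a t x - coef a t y) <= CA * enorm (x - y) /\
          enorm (coef a t x) ^+ 2 <= CA ^+ 2 * (1 + enorm x ^+ 2),
      regular3 (fun t _ => g t)
    & forall i, regular3 (fun t x => mu t x 0 i)].

End Coefficients.

Section Probability.
Context {R : realType} {d : nat} {disp : measure_display}
  {Omega : measurableType disp}.
Variable P : probability Omega R.
Implicit Types (X : Omega -> 'rV[R]_d) (W : R -> Omega -> 'rV[R]_d)
  (G : set_system Omega) (F : R -> set_system Omega).

Definition events_of X : set_system Omega :=
  [set A | exists (i : 'I_d) (B : set R),
     measurable B /\ A = (fun w => X w 0 i) @^-1` B].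

Definition vec_measurable G X : Prop := events_of X `<=` G.

Definition real_measurable G (Y : Omega -> R) : Prop :=
  forall B : set R, measurable B -> G (Y @^-1` B).

Definition filtration_of X W : R -> set_system Omega := fun t =>
  <<s events_of X `|` \bigcup_(s in `[0, t]) events_of (W s) >>.

(* In the library, [normal_prob 0 0] is not the Dirac mass. *)
Definition gauss_var (v : R) (B : set R) : \bar R :=
  if v == 0 then \d_(0 : R) B else normal_prob 0 (Num.sqrt v) B.

(* X has law N(0, v I_d). *)
Definition isotropic_gaussian X (v : R) : Prop :=
  vec_measurable measurable X /\
  forall B : 'I_d -> set R, (forall i, measurable (B i)) ->
    P [set w | forall i, B i (X w 0 i)] = (\prod_(i < d) gauss_var v (B i))%E.

Definition independent_of X G : Prop :=
  forall A E, <<s events_of X >> A -> G E -> (P (A `&` E) = P A * P E)%E.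

(* W is a d-dimensional Wiener process with respect to the filtration F. *)
Definition wiener F W : Prop :=
  [/\ forall t, 0 <= t -> vec_measurable (F t) (W t),
      {ae P, forall w, W 0 w = 0},
      forall w, {within `[0, +oo[, continuous (fun t => W t w)}
    & forall s t, 0 <= s -> s < t ->
        isotropic_gaussian (fun w => W t w - W s w) (t - s) /\
        independent_of (fun w => W t w - W s w) (F s)].

(* Y is a version of E[X | G]. *)
Definition is_cond_exp G (X Y : Omega -> R) : Prop :=
  [/\ P.-integrable setT (EFin \o X), P.-integrable setT (EFin \o Y),
      real_measurable G Y
    & forall A, G A ->
        (\int[P]_(w in A) (X w)%:E = \int[P]_(w in A) (Y w)%:E)%E].

Definition cvg_in_prob (X : nat -> Omega -> R) (Y : Omega -> R) : Prop :=
  forall e : R, 0 < e ->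
    (fun n => P [set w | e <= `|X n w - Y w|]) @ \oo --> 0%E.

(* The process equal to [sp_xi i] on ]sp_time i, sp_time i.+1], i < sp_size. *)
Record simple_process := SimpleProcess {
  sp_size : nat;
  sp_time : nat -> R;
  sp_xi : nat -> Omega -> R }.

Definition simple_on F (s t : R) (S : simple_process) : Prop :=
  [/\ sp_time S 0 = s, sp_time S (sp_size S) = t,
      forall i, (i < sp_size S)%N -> sp_time S i <= sp_time S i.+1,
      forall i, (i < sp_size S)%N -> real_measurable (F (sp_time S i)) (sp_xi S i)
    & exists M : R, forall i w, `|sp_xi S i w| <= M].

Definition sp_val (S : simple_process) (r : R) (w : Omega) : R :=
  \sum_(i < sp_size S) sp_xi S i w * \1_(`]sp_time S i, sp_time S i.+1]) r.

Definition sp_int (S : simple_process) (B : R -> Omega -> R) (r : R)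
    (w : Omega) : R :=
  \sum_(i < sp_size S) sp_xi S i w *
    (B (Num.min (sp_time S i.+1) r) w - B (Num.min (sp_time S i) r) w).

Definition jointly_measurable (s t : R) (H : R -> Omega -> R) : Prop :=
  measurable_fun (`[s, t] `*` [set: Omega])
    (fun p : R * Omega => H p.1 p.2).

(* Y r is the Ito integral of H against B over [s, r], for every r in [s, t]:
   the limit in probability of the integrals of simple adapted processes
   approximating H in L^2([s, t]), in probability. *)
Definition is_ito_integral F (B : R -> Omega -> R) (s t : R)
    (H Y : R -> Omega -> R) : Prop :=
  [/\ jointly_measurable s t H,
      forall r : R, r \in `[s, t] -> measurable_fun setT (Y r)
    & exists S : nat -> simple_process,
      [/\ forall n, simple_on F s t (S n),
          forall e : R, 0 < e ->
            (fun n => P [set w | (e%:E <= \int[lebesgue_measure]_(r in `[s, t])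
               ((sp_val (S n) r w - H r w) ^+ 2)%:E)%E]) @ \oo --> 0%E
        & forall r : R, r \in `[s, t] ->
            cvg_in_prob (fun n => sp_int (S n) B r) (Y r)]].

Definition is_time_integral (s t : R) (H Y : R -> Omega -> R) : Prop :=
  jointly_measurable s t H /\
  forall r : R, r \in `[s, t] -> {ae P, forall w,
    lebesgue_measure.-integrable `[s, r] (fun q => (H q w)%:E) /\
    Y r w = \int[lebesgue_measure]_(q in `[s, r]) H q w}.

(* [is_iterated F W s t u a Y]: Y r = I_a[u]_{s,r} for r in [s, t]. *)
Inductive is_iterated F W (s t : R) (u : R -> Omega -> R) :
    multi_index d -> (R -> Omega -> R) -> Prop :=
| IteratedNil : is_iterated F W s t u [::] u
| IteratedTime a Z Y of is_iterated F W s t u a Z & is_time_integral s t Z Y :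
    is_iterated F W s t u (rcons a None) Y
| IteratedWiener a (r : 'I_d) Z Y of is_iterated F W s t u a Z
    & is_ito_integral F (fun q w => W q w 0 r) s t Z Y :
    is_iterated F W s t u (rcons a (Some r)) Y.

(* J is I_a[U]_{s,t}, for a random vector U seen as a time-constant integrand. *)
Definition is_iterated_vec F W (s t : R) (a : multi_index d)
    (U J : Omega -> 'rV[R]_d) : Prop :=
  forall i, exists2 Y, is_iterated F W s t (fun _ w => U w 0 i) a Y
                     & (fun w => J w 0 i) = Y t.

Definition step (T : R) (K : nat) : R := T / K%:R.
Definition grid (T : R) (K k : nat) : R := k%:R * step T K.

(* x K k is the k-th value of the scheme with K steps. *)
Definition general_strong_scheme F W (mu : R -> 'rV[R]_d -> 'rV[R]_d)
    (g : R -> R) (T gamma : R) (x0 : Omega -> 'rV[R]_d)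
    (x : nat -> nat -> Omega -> 'rV[R]_d) : Prop :=
  exists C CR : R, forall K : nat, (0 < K)%N ->
    let h := step T K in
    let t := grid T K in
    let I := A_set gamma `\ ([::] : multi_index d) in
    x K 0%N = x0 /\
    (forall k, (k <= K)%N -> vec_measurable (F (t k)) (x K k)) /\
    exists (G J : multi_index d -> nat -> Omega -> 'rV[R]_d)
           (RM RD : nat -> Omega -> 'rV[R]_d),
      [/\ forall k, (k < K)%N ->
            [/\ forall a, I a -> vec_measurable (F (t k)) (G a k),
                forall a, I a ->
                  is_iterated_vec F W (t k) (t k.+1) a (G a k) (J a k)
              & {ae P, forall w, x K k.+1 w =
                  x K k w + \sum_(a \in I) J a k w + (RM k w + RD k w)}],
          forall a, I a ->
            (\int[P]_w (\big[Num.max/0]_(k < K)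
                 enorm (G a k w - coef T mu g a (t k) (x K k w)) ^+ 2)%:E
             <= (C * h `^ (2 * gamma - (phi_exp a)%:R))%:E)%E,
          forall k, (k < K)%N ->
            [/\ vec_measurable measurable (RM k),
                forall i, is_cond_exp (F (t k)) (fun w => RM k w 0 i) (cst 0)
              & (\int[P]_w (enorm (RM k w) ^+ 2)%:E
                 <= (CR * h `^ (2 * gamma + 1))%:E)%E]
        & forall k, (k < K)%N ->
            vec_measurable measurable (RD k) /\
            (\int[P]_w (enorm (RD k w) ^+ 2)%:E
             <= (CR * h `^ (2 * gamma + 2))%:E)%E].

Section Scheme.
Variables (W : R -> Omega -> 'rV[R]_d) (mu : R -> 'rV[R]_d -> 'rV[R]_d).
Variables (g : R -> R) (T : R) (K : nat).
Let h := step T K.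
Let t := grid T K.

Definition DeltaW (k : nat) (w : Omega) : 'rV[R]_d := W (t k.+1) w - W (t k) w.

Definition DeltaZ (k : nat) (w : Omega) : 'rV[R]_d :=
  \row_(i < d) \int[lebesgue_measure]_(s in `[t k, t k.+1])
    (W s w 0 i - W (t k) w 0 i).

Definition Q (k : nat) (y : 'rV[R]_d) : 'rV[R]_d :=
  y + (2^-1 * h) *: mu (t k) y.

Definition Qstar (k : nat) (w : Omega) (y : 'rV[R]_d) : 'rV[R]_d :=
  y + (2^-1 * h) *: mu (t k) y + (3 / 2 * (g (t k) / h)) *: DeltaZ k w.

Definition Pincr (k : nat) (w : Omega) : 'rV[R]_d :=
  g (t k) *: DeltaW k w +
  ((g (t k.+1) - g (t k)) / h) *: (h *: DeltaW k w - DeltaZ k w).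

Fixpoint scheme (x0 : Omega -> 'rV[R]_d) (k : nat) (w : Omega) : 'rV[R]_d :=
  if k is k'.+1 then
    let y := scheme x0 k' w in
    y + (3^-1 * h) *: (mu (t k' + 2^-1 * h) (Q k' y)
                       + 2 *: mu (t k' + 2^-1 * h) (Qstar k' w y))
      + Pincr k' w
  else x0 w.

End Scheme.

End Probability.

(* Main.v *)
Require Import Defs.
From mathcomp Require Import all_boot all_order all_algebra.
From mathcomp Require Import all_classical all_reals all_analysis.
From mathcomp Require Import measurable_realfun.
From mathcomp Require Import ring lra zify.
Set Implicit Arguments.
Unset Strict Implicit.
Unset Printing Implicit Defensive.
Import Order.TTheory GRing.Theory Num.Theory.
Import numFieldNormedType.Exports.
Local Open Scope classical_set_scope.
Local Open Scope ring_scope.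

(** The coefficients of the scheme are taken to be the functions [f_alpha] themselves,
    evaluated at [(t_k, x_k)], so that what has to be shown is an expansion of one step:
    the increment of the scheme is the sum of the iterated integrals of these
    coefficients, up to a conditionally centered term of order [h ^ 2] and a further term
    of order [h ^ (5 / 2)] in mean square.

    Since [g] depends on time only, the words of order 3/2 with a nonzero coefficient
    are [(0)], [(r)], [(0, r)], [(r, 0)] and [(0, 0)], and their iterated integrals are
    explicit in [h], [DeltaW] and [DeltaZ] ([word_iterated]). The noise [P_k] yields the
    words [(r)] and [(0, r)], up to the error of a difference quotient of [g]. For the
    drift, both evaluation points carry the Euler shift of size [h], and the second one
    also carries the noise shift [b = (3 / 2) (g / h) DeltaZ] of size [h ^ (1 / 2)]. A
    Taylor expansion, of second order in [b], gives [drift_expansion]: with the weights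
    1/3 and 2/3, the linear term in [b] is the word [(r, 0)], and the Euler shift and the
    time shift give the word [(0, 0)] except for the second space derivatives of [mu].
    These come from the quadratic term in [b], of size [h ^ 2]: given the past, the
    coordinates of [DeltaZ] are uncorrelated with variance [h ^ 3 / 3] ([area_cross]), so
    the mean of that quadratic term is exactly [h ^ 2 / 4 g ^ 2] times the Laplacian of
    [mu]. Its fluctuation is the martingale part [R_k^M] ([martingale_part],
    [martingale_part_cond]); all the rest is [R_k^D] ([drift_part_le]).

    These estimates are polynomial in [x_k], [DeltaZ / h ^ (3 / 2)] and
    [DeltaW / h ^ (1 / 2)], and need a bound for the sixth moments of the scheme that is
    uniform in the number of steps ([step_size_moment6]). The process
    [x_k - g (t_k) (W_(t_k) - W_0)] satisfies a recursion without stochastic increment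
    ([centered_step]), since the noise of the scheme telescopes up to increments of [g];
    convexity of the sixth power and a discrete Gronwall argument conclude
    ([centered_recursion]).

    The variable [W_0] vanishes almost surely but may fail to be measurable. Hence
    expectations are computed with the filtration generated by the initial value and the
    increments of [W], which has the same events up to a null set
    ([filtration_modification]). *)

(** * The l1 norm on row vectors, and Taylor expansion along the coordinates *)

Lemma le_of_eq {disp : Order.disp_t} {T : porderType disp} (x y : T) : x = y -> (x <= y)%O.
Proof. by move->. Qed.

Section Norm1.
Context {R : realType} {d : nat}.
Implicit Types (x y v : 'rV[R]_d).

(** The l1 norm is additive over the coordinates, which suits expansions that move
    one coordinate at a time. *)
Definition n1 x : R := \sum_(i < d) `|x 0 i|.

Lemma n1_ge0 x : 0 <= n1 x.
Proof. by apply: sumr_ge0 => i _; exact: normr_ge0. Qed.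

Lemma n1_0 : n1 (0 : 'rV[R]_d) = 0.
Proof. by rewrite /n1 big1// => i _; rewrite mxE normr0. Qed.

Lemma n1D x y : n1 (x + y) <= n1 x + n1 y.
Proof.
by rewrite /n1 -big_split/=; apply: ler_sum => i _; rewrite mxE ler_normD.
Qed.

Lemma n1Z (a : R) x : n1 (a *: x) = `|a| * n1 x.
Proof. by rewrite /n1 mulr_sumr; apply: eq_bigr => i _; rewrite mxE normrM. Qed.

Lemma coord_le_n1 x i : `|x 0 i| <= n1 x.
Proof.
by rewrite /n1 (bigD1 i)//= lerDl; apply: sumr_ge0 => j _; exact: normr_ge0.
Qed.

Lemma enorm_ge0 x : 0 <= enorm x.
Proof. exact: sqrtr_ge0. Qed.

Lemma sqr_enorm x : enorm x ^+ 2 = \sum_(i < d) x 0 i ^+ 2.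
Proof. by rewrite sqr_sqrtr//; apply: sumr_ge0 => i _; exact: sqr_ge0. Qed.

Lemma enorm_le_n1 x : enorm x <= n1 x.
Proof.
rewrite -(ger0_norm (n1_ge0 x)) -sqrtr_sqr ler_wsqrtr//.
rewrite [leRHS]expr2 {1}/n1 mulr_suml; apply: ler_sum => i _.
by rewrite -[X in X <= _](ger0_norm (sqr_ge0 _)) normrX expr2 ler_wpM2l// coord_le_n1.
Qed.

Lemma coord_le_enorm x i : `|x 0 i| <= enorm x.
Proof.
rewrite -sqrtr_sqr ler_wsqrtr// (bigD1 i)//= lerDl.
by apply: sumr_ge0 => j _; exact: sqr_ge0.
Qed.

Lemma n1_delta (j : 'I_d) : n1 (delta_mx 0 j) = 1.
Proof.
rewrite /n1 (bigD1 j)//= mxE !eqxx normr1 big1 ?addr0// => k kj.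
by rewrite mxE (negbTE kj) andbF normr0.
Qed.

End Norm1.

Section CoordinateTaylor.
Context {R : realType} {d : nat}.
Implicit Types (f : 'rV[R]_d -> R) (x y v : 'rV[R]_d) (j : 'I_d).

Let e_ j : 'rV[R]_d := delta_mx 0 j.

Lemma is_derive_line f y j (s : R) : derivable f (y + s *: e_ j) (e_ j) ->
  is_derive s 1 (fun s => f (y + s *: e_ j)) ('D_(e_ j) f (y + s *: e_ j)).
Proof.
move=> df.
have E : (fun h => h^-1 *: ((fun s => f (y + s *: e_ j)) (h *: 1 + s)
                            - f (y + s *: e_ j))) =
         (fun h => h^-1 *: (f (h *: e_ j + (y + s *: e_ j)) - f (y + s *: e_ j))).
  apply/funext => h; congr (_ *: (f _ - _)).
  by rewrite scalerDl [h *: 1]mulr1 addrCA.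
by split; [rewrite /derivable/= E|rewrite /derive/= E].
Qed.

Lemma mean_value_ineq (psi dpsi : R -> R) (v B : R) :
  (forall s : R, is_derive s 1 psi (dpsi s)) ->
  (forall s, `|s| <= `|v| -> `|dpsi s| <= B) ->
  `|psi v - psi 0| <= B * `|v|.
Proof.
move=> D bnd.
have cont a b : {within `[a, b], continuous psi}.
  apply: derivable_within_continuous => x _.
  by have [] := D x.
have [->|v0] := eqVneq v 0; first by rewrite subrr !normr0 mulr0.
have [vp|vn] := ltP 0 v.
  have [c /[!in_itv]/= /andP[c0 cv] ->] :=
    MVT vp (fun r _ => D r) (cont _ _).
  rewrite subr0 normrM ler_wpM2r// bnd//.
  by rewrite !ger0_norm// ltW.
have {vn}vn : v < 0 by rewrite lt_neqAle v0.
have [c /[!in_itv]/= /andP[c0 cv] E] :=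
    MVT vn (fun r _ => D r) (cont _ _).
rewrite distrC E sub0r normrM normrN ler_wpM2r// bnd//.
by rewrite !ler0_norm ?lerN2// ltW.
Qed.

(** The slope [c] is free, because in several variables the derivative is compared
    with its value at a point off the line. *)
Lemma line_taylor1 f y j (v c L : R) (D := 'D_(e_ j) f) :
  (forall x, derivable f x (e_ j)) ->
  (forall s, `|s| <= `|v| -> `|D (y + s *: e_ j) - c| <= L) ->
  `|f (y + v *: e_ j) - f y - v * c| <= L * `|v|.
Proof.
move=> df DL.
pose psi s := f (y + s *: e_ j) - c * s.
have Dpsi (s : R) : is_derive s 1 psi (D (y + s *: e_ j) - c).
  have := is_derive_line (df (y + s *: e_ j)) => d1.
  rewrite /psi; apply: is_deriveB.
  by apply: is_derive_eq; rewrite -[RHS]mulr1.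
have := mean_value_ineq Dpsi DL.
rewrite /psi scale0r addr0 mulr0 subr0.
by rewrite (_ : _ - _ - _ = f (y + v *: e_ j) - f y - v * c)//; ring.
Qed.

Lemma line_taylor2 f y j (v L : R) (D := 'D_(e_ j) f) (H := 'D_(e_ j) D) : 0 <= L ->
  (forall x, derivable f x (e_ j)) -> (forall x, derivable D x (e_ j)) ->
  (forall s, `|H (y + s *: e_ j) - H y| <= L * `|s|) ->
  `|f (y + v *: e_ j) - f y - v * D y - 2^-1 * v ^+ 2 * H y| <= L * `|v| ^+ 3.
Proof.
move=> L0 df dD HL.
pose psi s := f (y + s *: e_ j) - (D y * s + 2^-1 * H y * s ^+ 2).
have Dpsi (s : R) : is_derive s 1 psi (D (y + s *: e_ j) - D y - s * H y).
  have := is_derive_line (df (y + s *: e_ j)) => d1.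
  rewrite /psi -addrA -opprD; apply: is_deriveB.
  apply: is_derive_eq; rewrite ?scaler0 ?scaler1 ?addr0 /GRing.scale/= ?mulr1.
  by field.
have bnd s : `|s| <= `|v| -> `|D (y + s *: e_ j) - D y - s * H y| <= L * `|v| ^+ 2.
  move=> sv; apply: (le_trans (@line_taylor1 D y j s (H y) (L * `|v|) dD _)).
    by move=> r rs; apply: (le_trans (HL r)); rewrite ler_wpM2l// (le_trans rs).
  by rewrite expr2 mulrA ler_wpM2l// mulr_ge0.
have := mean_value_ineq Dpsi bnd.
rewrite /psi scale0r addr0 expr0n/= !mulr0 addr0 subr0.
rewrite (_ : L * `|v| ^+ 2 * `|v| = L * `|v| ^+ 3); last by rewrite -mulrA (exprSr _ 2).
rewrite (_ : _ - _ - _ = f (y + v *: e_ j) - f y - v * D y - 2^-1 * v ^+ 2 * H y)//.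
by ring.
Qed.

(** [cut v m] keeps the first [m] coordinates of [v]: passing from [y] to
    [y + v] through the points [y + cut v m] changes one coordinate at a time,
    so that partial derivatives suffice. *)
Definition cut v (m : nat) : 'rV[R]_d := \row_(j < d) if (j < m)%N then v 0 j else 0.

Lemma cut0 v : cut v 0 = 0.
Proof. by apply/rowP => j; rewrite !mxE ltn0. Qed.

Lemma cut_full v : cut v d = v.
Proof. by apply/rowP => j; rewrite !mxE ltn_ord. Qed.

Lemma cutS v (m : 'I_d) : cut v m.+1 = cut v m + v 0 m *: e_ m.
Proof.
apply/rowP => j; rewrite !mxE eqxx/= ltnS.
have [jm|jm|jm] := ltngtP j m.
- by rewrite (_ : j == m = false) ?mulr0 ?addr0//; apply/negbTE;
    rewrite -(inj_eq val_inj) neq_ltn jm.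
- by rewrite (_ : j == m = false) ?mulr0 ?addr0//; apply/negbTE;
    rewrite -(inj_eq val_inj) neq_ltn jm orbT.
- by rewrite (val_inj jm) eqxx mulr1 add0r.
Qed.

Lemma n1_cut_line v (m : 'I_d) (s : R) : `|s| <= `|v 0 m| ->
  n1 (cut v m + s *: e_ m) <= n1 v.
Proof.
move=> sv; apply: ler_sum => j _; rewrite !mxE eqxx/=.
have [->|jm] := eqVneq j m; first by rewrite ltnn mulr1 add0r.
by case: ifP => _; rewrite mulr0 addr0// normr0.
Qed.

Lemma n1_cut v (m : 'I_d) : n1 (cut v m) <= n1 v.
Proof.
have := @n1_cut_line v m 0; rewrite scale0r addr0; apply.
by rewrite normr0.
Qed.

Lemma telescope_cut f y v :
  f (y + v) - f y = \sum_(m < d) (f (y + cut v m + v 0 m *: e_ m) - f (y + cut v m)).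
Proof.
rewrite (eq_bigr (fun m : 'I_d => f (y + cut v m.+1) - f (y + cut v m))); last first.
  by move=> m _; rewrite cutS addrA.
rewrite -(big_mkord xpredT (fun m => f (y + cut v m.+1) - f (y + cut v m))).
by rewrite telescope_sumr// cut_full cut0 addr0.
Qed.

(** Along the path of the points [y + cut v m], each step is one-dimensional and its
    derivative is compared with the one at [y]. *)
Lemma taylor1 f y v (D := fun j => 'D_(e_ j) f) (L : R) : 0 <= L ->
  (forall j x, derivable f x (e_ j)) ->
  (forall j x z, `|D j x - D j z| <= L * n1 (x - z)) ->
  `|f (y + v) - f y - \sum_(j < d) v 0 j * D j y| <= L * n1 v ^+ 2.
Proof.
move=> L0 df DL; rewrite telescope_cut -sumrB.
apply: (le_trans (ler_norm_sum _ _ _)).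
rewrite expr2 mulrA {2}/n1 mulr_sumr; apply: ler_sum => m _.
apply: line_taylor1 => [x|r rv]; first exact: df.
apply: (le_trans (DL _ _ _)); rewrite ler_wpM2l//.
by rewrite -[y + _ + _]addrA [y + _]addrC addrK n1_cut_line.
Qed.

(** The quadratic term produced by the coordinatewise expansion: the squares come
    with a factor 1/2, and the products [v_l v_j] only occur for [l < j]. *)
Definition quad (H : 'I_d -> 'I_d -> R) v : R :=
  \sum_(j < d) (2^-1 * v 0 j ^+ 2 * H j j
                + v 0 j * \sum_(l < d) cut v j 0 l * H l j).

(** One coordinate step of [taylor2] over plain reals: the one-dimensional expansion
    at the moved point, and the transport of its derivatives back to [y]. *)
Let coordinate_step (fz' fz Dz Dy Hz Hy c n S L : R) : 0 <= L ->
  `|fz' - fz - c * Dz - 2^-1 * c ^+ 2 * Hz| <= L * `|c| ^+ 3 ->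
  `|Dz - Dy - S| <= L * n ^+ 2 -> `|Hz - Hy| <= L * n ->
  `|c| <= n -> 0 <= `|c| -> 0 <= n ->
  `|fz' - fz - c * Dy - (2^-1 * c ^+ 2 * Hy + c * S)| <= 3 * L * n ^+ 2 * `|c|.
Proof.
move=> L0 b1 b2 b3 vm v0 n0.
rewrite (_ : _ - _ - _ = (fz' - fz - c * Dz
            - 2^-1 * c ^+ 2 * Hz) + c * (Dz - Dy - S)
            + 2^-1 * c ^+ 2 * (Hz - Hy)); last by ring.
apply: (le_trans (ler_normD _ _)).
rewrite (_ : 3 * L * _ * _ = 2 * (L * n ^+ 2 * `|c|) + L * n ^+ 2 * `|c|);
  last by ring.
apply: lerD.
  apply: (le_trans (ler_normD _ _)).
  rewrite mulr2n mulrDl mul1r; apply: lerD.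
    apply: (le_trans b1); rewrite exprSr mulrA ler_wpM2r// ler_wpM2l//.
    by rewrite lerXn2r ?nnegrE.
  by rewrite normrM mulrC ler_wpM2r.
rewrite normrM normrM normrX ger0_norm//.
apply: (@le_trans _ _ (2^-1 * (n * `|c|) * (L * n))).
  apply: ler_pM => //.
  by rewrite ler_wpM2l// expr2 ler_wpM2r.
rewrite (_ : L * _ * _ = (n * `|c|) * (L * n)); last by ring.
rewrite -mulrA ler_piMl//; last by lra.
by rewrite !mulr_ge0.
Qed.

(** The first derivatives at the points of the path are themselves expanded by
    [taylor1], which creates the mixed products of [quad]. *)
Lemma taylor2 f y v (D := fun j => 'D_(e_ j) f)
    (H := fun l j => 'D_(e_ l) (D j)) (L : R) : 0 <= L ->
  (forall j x, derivable f x (e_ j)) ->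
  (forall l j x, derivable (D j) x (e_ l)) ->
  (forall l j x z, `|H l j x - H l j z| <= L * n1 (x - z)) ->
  `|f (y + v) - f y - \sum_(j < d) v 0 j * D j y - quad (fun l j => H l j y) v|
    <= 3 * L * n1 v ^+ 3.
Proof.
move=> L0 df dD HL; rewrite telescope_cut -sumrB /quad -sumrB.
apply: (le_trans (ler_norm_sum _ _ _)).
rewrite exprSr mulrA {2}/n1 mulr_sumr; apply: ler_sum => m _.
set z := y + cut v m; set S := \sum_(l < d) _.
have b1 : `|f (z + v 0 m *: e_ m) - f z - v 0 m * D m z
            - 2^-1 * v 0 m ^+ 2 * H m m z| <= L * `|v 0 m| ^+ 3.
  apply: line_taylor2 => // [s|s]; first exact: dD.
  apply: (le_trans (HL _ _ _ _)).
  by rewrite [z + _]addrC addrK n1Z n1_delta mulr1.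
have b2 : `|D m z - D m y - S| <= L * n1 v ^+ 2.
  apply: (le_trans (@taylor1 (D m) y (cut v m) L L0 (fun l x => dD l m x) _)).
    by move=> l x w; exact: HL.
  by rewrite ler_wpM2l// lerXn2r ?nnegrE ?n1_ge0// n1_cut.
have b3 : `|H m m z - H m m y| <= L * n1 v.
  apply: (le_trans (HL _ _ _ _)); rewrite ler_wpM2l//.
  by rewrite /z [y + _]addrC addrK n1_cut.
have vm : `|v 0 m| <= n1 v by exact: coord_le_n1.
have v0 : 0 <= `|v 0 m| by [].
have n0 : 0 <= n1 v by exact: n1_ge0.
exact: (coordinate_step L0 b1 b2 b3).
Qed.

Lemma quad_bound H v (M : R) : (forall l j, `|H l j| <= M) -> `|quad H v| <= 2 * M * n1 v ^+ 2.
Proof.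
move=> HM; apply: (le_trans (ler_norm_sum _ _ _)).
rewrite expr2 mulrA {2}/n1 mulr_sumr; apply: ler_sum => j _.
have M0 : 0 <= M by exact: le_trans (HM j j).
have vj := coord_le_n1 v j.
apply: (le_trans (ler_normD _ _)).
rewrite (_ : 2 * M * _ * _ = `|v 0 j| * n1 v * M + `|v 0 j| * (n1 v * M)); last by ring.
apply: lerD.
  rewrite normrM [X in X * _]normrM normrX (ger0_norm (_ : 0 <= 2^-1))//.
  apply: ler_pM => //.
  apply: (@le_trans _ _ (1 * `|v 0 j| ^+ 2)).
    by rewrite ler_wpM2r ?exprn_ge0//; lra.
  by rewrite mul1r expr2 ler_wpM2l.
rewrite normrM ler_wpM2l//.
apply: (le_trans (ler_norm_sum _ _ _)).
rewrite mulr_suml; apply: ler_sum => l _.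
rewrite normrM; apply: ler_pM => //.
by rewrite !mxE; case: ifP => _; rewrite ?normr0.
Qed.

Lemma quadB H H' v : quad H v - quad H' v = quad (fun l j => H l j - H' l j) v.
Proof.
rewrite /quad -sumrB; apply: eq_bigr => j _.
rewrite [X in _ = _ + _ * X](_ : _ = \sum_(l < d) cut v j 0 l * H l j
  - \sum_(l < d) cut v j 0 l * H' l j); first by ring.
by rewrite -sumrB; apply: eq_bigr => l _; ring.
Qed.

Lemma quadZ H (c : R) v : quad H (c *: v) = c ^+ 2 * quad H v.
Proof.
rewrite /quad mulr_sumr; apply: eq_bigr => j _; rewrite !mxE.
rewrite (eq_bigr (fun l => c * (cut v j 0 l * H l j))); last first.
  by move=> l _; rewrite !mxE; case: ifP => _; ring.
by rewrite -mulr_sumr; ring.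
Qed.

Definition quad_weight (j l : 'I_d) : R :=
  if l == j then 2^-1 else (l < j)%N%:R.

(** The monomial form lets expectations be taken term by term. *)
Lemma quad_sum H v : quad H v =
  \sum_(j < d) \sum_(l < d) quad_weight j l * (H l j * v 0 j * v 0 l).
Proof.
apply: eq_bigr => j _.
have -> : 2^-1 * v 0 j ^+ 2 * H j j = \sum_(l < d) (l == j)%:R * (2^-1 * (H l j * v 0 j * v 0 l)).
  rewrite (bigD1 j)//= eqxx mul1r big1 ?addr0; last by move=> l /negbTE ->; rewrite mul0r.
  by ring.
rewrite mulr_sumr -big_split/=; apply: eq_bigr => l _.
rewrite mxE /quad_weight; have [->|lj]/= := eqVneq l j.
  by rewrite ltnn/=; ring.
by case: ifP => _ /=; ring.
Qed.

End CoordinateTaylor.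
(** * Time derivatives inside [[0, T]], and the coefficient functions *)

Section TimeDerivative.
Context {R : realType} {d : nat}.
Variable T : R.
Hypothesis T0 : 0 < T.
Implicit Types (f : R -> 'rV[R]_d -> R) (x : 'rV[R]_d) (t s r : R).

#[local] Instance time_nbhs_filter t : Filter (time_nbhs T t).
Proof. exact: within_filter. Qed.

(** Every point of [[0, T]], end points included, is a limit of other points of
    [[0, T]], so that the one-sided limits are unique. *)
Let time_nbhs_proper t : t \in `[0, T] -> ProperFilter (time_nbhs T t).
Proof.
rewrite in_itv/= => /andP[t0 tT].
apply: Build_ProperFilter_ex => A.
rewrite /time_nbhs /within/= => /nbhs_ballP[e/= e0 eA].
have [tT'|] := ltP t T.
- pose s := t + Num.min (e / 2) (T - t).
  have m0 : 0 < Num.min (e / 2) (T - t) by rewrite lt_min divr_gt0//= subr_gt0.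
  have m1 : Num.min (e / 2) (T - t) <= e / 2 by rewrite ge_min lexx.
  have m2 : Num.min (e / 2) (T - t) <= T - t by rewrite ge_min lexx orbT.
  exists s; apply: (eA s).
  + rewrite /ball/= /s opprD addNKr normrN gtr0_norm//.
    by apply: (le_lt_trans m1); lra.
  + by rewrite /s -subr_eq0 addrAC subrr add0r gt_eqF.
  + by rewrite /s in_itv/=; lra.
- move=> Tt; pose s := t - Num.min (e / 2) t.
  have tp : 0 < t by exact: lt_le_trans Tt.
  have m0 : 0 < Num.min (e / 2) t by rewrite lt_min divr_gt0.
  have m1 : Num.min (e / 2) t <= e / 2 by rewrite ge_min lexx.
  have m2 : Num.min (e / 2) t <= t by rewrite ge_min lexx orbT.
  exists s; apply: (eA s).
  + rewrite /ball/= /s subKr gtr0_norm//.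
    by apply: (le_lt_trans m1); lra.
  + by rewrite /s -subr_eq0 addrAC subrr add0r oppr_eq0 gt_eqF.
  + by rewrite /s in_itv/=; lra.
Qed.

Lemma dt_eq_lim f t x (l : R) : t \in `[0, T] ->
  time_quotient f t x @ time_nbhs T t --> l -> dt T f t x = l.
Proof.
by move=> /time_nbhs_proper tp fl; apply/cvg_lim => //; exact: Rhausdorff.
Qed.

Lemma dt_cst f t x (c : R) : t \in `[0, T] ->
  (forall s, s \in `[0, T] -> f s x = c) -> dt T f t x = 0.
Proof.
move=> tT fc; apply: dt_eq_lim => //.
apply: (cvg_trans _ (@cvg_cst _ (0 : R) _ (time_nbhs T t) _)).
apply: near_eq_cvg.
change (\forall s \near t^', s \in `[0, T] -> 0 = time_quotient f t x s).
by apply: nearW => s sT; rewrite /time_quotient !fc// subrr mulr0.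
Qed.

Lemma dt_ext f f' t x : t \in `[0, T] ->
  (forall s, s \in `[0, T] -> f s x = f' s x) -> dt T f t x = dt T f' t x.
Proof.
move=> tT ff'; rewrite /dt.
suff : forall f f', (forall s, s \in `[0, T] -> f s x = f' s x) ->
    time_quotient f t x @ time_nbhs T t `=>` time_quotient f' t x @ time_nbhs T t.
  move=> H; congr (lim _); apply/seteqP.
  by split; apply: H => // s sT; rewrite ff'.
move=> {}f {}f' {}ff'.
apply: near_eq_cvg.
change (\forall s \near t^', s \in `[0, T] ->
  time_quotient f' t x s = time_quotient f t x s).
by apply: nearW => s sT; rewrite /time_quotient !ff'.
Qed.

Lemma is_derive_dt f t x : 0 < t < T -> dt_exists T f ->
  is_derive t 1 (fun s => f s x) (dt T f t x).
Proof.
move=> /andP[t0 tT] /(_ t x); rewrite in_itv/= !ltW// => /(_ isT) fl.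
have E : (fun h => h^-1 *: (f (h *: 1 + t) x - f t x))
    @ 0^' --> dt T f t x.
  have S : (fun h : R => h + t) @ 0^' --> time_nbhs T t.
    move=> A; rewrite /time_nbhs /within/= => /nbhs_ballP[e/= e0 eA].
    apply/nbhs_ballP; exists (Num.min e (Num.min t (T - t))) => /=.
      by rewrite !lt_min e0 t0 subr_gt0.
    rewrite /ball => h /=; rewrite sub0r normrN !lt_min => /and3P[h1 h2 h3] h0.
    apply: eA => /=.
    - by rewrite /ball/= opprD addrCA subrr addr0 normrN.
    - by rewrite -subr_eq0 addrK.
    - rewrite in_itv/=; move: h2 h3; rewrite !ltr_norml; lra.
  have := cvg_comp _ _ S fl.
  apply: cvg_trans; apply: near_eq_cvg; near=> h.
  by rewrite /time_quotient/= addrK /GRing.scale/= mulr1.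
split; first by apply/cvg_ex; exists (dt T f t x); exact: E.
by rewrite /derive; apply/cvg_lim => //; exact: Rhausdorff.
Unshelve. all: by end_near. Qed.

Lemma time_MVT f t s x : 0 <= t -> t < s -> s <= T -> dt_exists T f ->
  {within `[0, T], continuous (fun r => f r x)} ->
  exists2 r, t < r < s & f s x - f t x = dt T f r x * (s - t).
Proof.
move=> t0 ts sT df cf.
have D r : r \in `]t, s[ -> is_derive r 1 (fun s => f s x) (dt T f r x).
  rewrite in_itv/= => /andP[tr rs]; apply: is_derive_dt => //; lra.
have [|r] := MVT ts D; last by rewrite in_itv/=; exists r.
apply: continuous_subspaceW cf => r /=; rewrite !in_itv/=; lra.
Qed.

Lemma time_bound f t s x B : 0 <= t -> t <= s -> s <= T -> dt_exists T f ->
  {within `[0, T], continuous (fun r => f r x)} ->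
  (forall r, r \in `[0, T] -> `|dt T f r x| <= B) ->
  `|f s x - f t x| <= B * (s - t).
Proof.
move=> t0; rewrite le_eqVlt => /predU1P[<-|ts] sT df cf dB.
  by rewrite !subrr normr0 mulr0.
have [r /andP[tr rs] ->] := time_MVT t0 ts sT df cf.
have ts0 : 0 <= s - t by rewrite subr_ge0 ltW.
by rewrite normrM (ger0_norm ts0) ler_wpM2r// dB// in_itv/=; lra.
Qed.

Lemma time_taylor f t s x B : 0 <= t -> t <= s -> s <= T ->
  dt_exists T f -> dt_exists T (dt T f) ->
  {within `[0, T], continuous (fun r => f r x)} ->
  {within `[0, T], continuous (fun r => dt T f r x)} ->
  (forall r, r \in `[0, T] -> `|dt T (dt T f) r x| <= B) ->
  `|f s x - f t x - (s - t) * dt T f t x| <= B * (s - t) ^+ 2.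
Proof.
move=> t0; rewrite le_eqVlt => /predU1P[<-|ts] sT df ddf cf cdf dB.
  by rewrite !subrr mul0r subrr normr0 expr0n/= mulr0.
have [r /andP[tr rs] ->] := time_MVT t0 ts sT df cf.
have ts0 : 0 <= s - t by rewrite subr_ge0 ltW.
rewrite [(s - t) * _]mulrC -mulrBl normrM (ger0_norm ts0) expr2 mulrA ler_wpM2r//.
apply: (le_trans (time_bound t0 (ltW tr) _ ddf cdf dB)); first by lra.
rewrite ler_wpM2l; [by []| |lra].
by apply: le_trans (dB t _); rewrite ?in_itv/= ?normr_ge0//; lra.
Qed.

End TimeDerivative.

Section CoefficientFunctions.
Context {R : realType} {d : nat}.
Variables (T : R) (mu : R -> 'rV[R]_d -> 'rV[R]_d) (g : R -> R).
Hypothesis T0 : 0 < T.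
Implicit Types (f : R -> 'rV[R]_d -> R) (x : 'rV[R]_d) (t : R) (i j r : 'I_d).

Lemma derive_coord i r x : 'D_(delta_mx 0 r) (fun y : 'rV[R]_d => y 0 i) x = (i == r)%:R.
Proof.
rewrite /derive; apply/cvg_lim; first exact: Rhausdorff.
apply: (cvg_trans _ (@cvg_cst _ ((i == r)%:R : R) _ 0^' _)).
apply: near_eq_cvg; near=> h.
rewrite /= !mxE eqxx/= addrK /GRing.scale/= mulrA mulVf ?mul1r//.
by near: h; exact: nbhs_dnbhs_neq.
Unshelve. all: by end_near. Qed.

Lemma dx_cst f t r x (c : R) : f t = cst c -> dx r f t x = 0.
Proof. by move=> fc; rewrite /dx fc derive_cst. Qed.

Lemma dx_ext f f' t r : f t = f' t -> dx r f t = dx r f' t.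
Proof. by move=> ff; rewrite /dx ff. Qed.

Lemma L0_ext f f' t x : t \in `[0, T] ->
  (forall s, s \in `[0, T] -> f s = f' s) -> L0 T mu g f t x = L0 T mu g f' t x.
Proof.
move=> tT ff.
have e1 : dt T f t x = dt T f' t x by apply: dt_ext => // s sT; rewrite ff.
have e2 i : dx i f t = dx i f' t by apply/funext => y; rewrite (dx_ext _ (ff _ tT)).
have e3 i : dx i (dx i f) t x = dx i (dx i f') t x by rewrite (dx_ext _ (e2 i)).
have s2 : \sum_(i < d) mu t x 0 i * dx i f t x = \sum_(i < d) mu t x 0 i * dx i f' t x.
  by apply: eq_bigr => i _; rewrite e2.
have s3 : \sum_(i < d) dx i (dx i f) t x = \sum_(i < d) dx i (dx i f') t x.
  by apply: eq_bigr => i _; exact: e3.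
exact: (congr2 +%R (congr2 +%R e1 s2) (congr1 _ s3)).
Qed.

Lemma L0_space_cst f (c : R -> R) t x : t \in `[0, T] ->
  (forall s, s \in `[0, T] -> f s = cst (c s)) ->
  L0 T mu g f t x = dt T f t x.
Proof.
move=> tT fc; rewrite /L0 big1 ?addr0; last first.
  by move=> i _; rewrite (dx_cst _ _ (fc _ tT)) mulr0.
rewrite big1 ?mulr0 ?addr0// => i _.
apply: (@dx_cst _ _ _ _ 0); apply/funext => y.
exact: dx_cst (fc _ tT).
Qed.

(** The noise is additive: the coefficient of one space letter does not depend on
    [x], and a further space letter annihilates it. *)
Lemma coef_comp_space r i t x : coef_comp T mu g [:: Some r] i t x = g t * (i == r)%:R.
Proof.
rewrite -[LHS]/(Defs.Lspace g r (fun _ (y : 'rV[R]_d) => y 0 i) t x).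
by rewrite /Defs.Lspace /dx derive_coord.
Qed.

Lemma coef_comp_space2 r s i t x : coef_comp T mu g [:: Some s; Some r] i t x = 0.
Proof.
rewrite -[LHS]/(Defs.Lspace g s (coef_comp T mu g [:: Some r] i) t x) /Defs.Lspace.
rewrite (@dx_cst _ t s x (g t * (i == r)%:R)) ?mulr0//.
by apply/funext => y; exact: coef_comp_space.
Qed.

Lemma coef_comp_space3 r s q i t x :
  coef_comp T mu g [:: Some q; Some s; Some r] i t x = 0.
Proof.
rewrite -[LHS]/(Defs.Lspace g q (coef_comp T mu g [:: Some s; Some r] i) t x) /Defs.Lspace.
rewrite (@dx_cst _ t q x 0) ?mulr0//.
by apply/funext => y; exact: (coef_comp_space2 r s).
Qed.

Lemma coef_comp_time i t x : t \in `[0, T] ->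
  coef_comp T mu g [:: None] i t x = mu t x 0 i.
Proof.
move=> tT; rewrite -[LHS]/(L0 T mu g (fun _ (y : 'rV[R]_d) => y 0 i) t x).
rewrite /L0 (@dt_cst _ _ _ T0 _ _ _ (x 0 i))// add0r.
rewrite [X in _ * X]big1 ?mulr0 ?addr0.
  rewrite (bigD1 i)//= /dx derive_coord eqxx mulr1 big1 ?addr0// => j ji.
  by rewrite derive_coord eq_sym (negbTE ji) mulr0.
move=> j _; apply: (@dx_cst _ _ _ _ ((i == j)%:R)).
by apply/funext => y; rewrite /dx derive_coord.
Qed.

Lemma coef_comp_time_space r i t x : t \in `[0, T] ->
  coef_comp T mu g [:: None; Some r] i t x
  = (i == r)%:R * dt T (fun s (_ : 'rV[R]_d) => g s) t x.
Proof.
move=> tT; rewrite -[LHS]/(L0 T mu g (coef_comp T mu g [:: Some r] i) t x).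
rewrite (@L0_space_cst _ (fun s => g s * (i == r)%:R))//; last first.
  by move=> s _; apply/funext => y; exact: coef_comp_space.
case: eqP => [ir|ir].
  rewrite mul1r; apply: dt_ext => // s sT.
  by rewrite coef_comp_space ir eqxx mulr1.
rewrite mul0r; apply: (@dt_cst _ _ _ T0 _ _ _ 0) => // s sT.
rewrite coef_comp_space.
by rewrite (introF eqP ir) mulr0.
Qed.

Let coef_comp_timeE i t : t \in `[0, T] ->
  coef_comp T mu g [:: None] i t = (fun x => mu t x 0 i).
Proof. by move=> tT; apply/funext => x; exact: coef_comp_time. Qed.

Lemma coef_comp_space_time r i t x : t \in `[0, T] ->
  coef_comp T mu g [:: Some r; None] i t x = g t * dx r (fun s y => mu s y 0 i) t x.
Proof.
move=> tT; rewrite -[LHS]/(Defs.Lspace g r (coef_comp T mu g [:: None] i) t x) /Defs.Lspace.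
by rewrite (@dx_ext _ (fun s y => mu s y 0 i) t r (coef_comp_timeE i tT)).
Qed.

Lemma coef_comp_time2 i t x : t \in `[0, T] ->
  coef_comp T mu g [:: None; None] i t x = L0 T mu g (fun s y => mu s y 0 i) t x.
Proof.
move=> tT; rewrite -[LHS]/(L0 T mu g (coef_comp T mu g [:: None] i) t x).
by apply: L0_ext => // s sT; exact: coef_comp_timeE.
Qed.

End CoefficientFunctions.
(** * One step of the drift part: the deterministic expansion *)

Section DerivativeBound.
Context {R : realType} {d : nat}.

(** The hypotheses bound derivatives only through Lipschitz constants. *)
Lemma derive_le (f : 'rV[R]_d -> R) (x v : 'rV[R]_d) (M : R) :
  derivable f x v -> (forall y, `|f y - f x| <= M * n1 (y - x)) ->
  `|'D_v f x| <= M * n1 v.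
Proof.
move=> df fM; rewrite leNgt; apply/negP => MD.
have e0 : 0 < `|'D_v f x| - M * n1 v by rewrite subr_gt0.
have /cvgrPdist_lt/(_ _ e0) := df.
rewrite -/('D_v f x) => H.
near (0 : R)^' => h.
have h0 : h != 0 by near: h; exact: nbhs_dnbhs_neq.
have : `|'D_v f x - h^-1 *: (f (h *: v + x) - f x)| < `|'D_v f x| - M * n1 v.
  by near: h.
apply/negP; rewrite -leNgt; apply: le_trans (lerB_dist _ _).
rewrite lerD2l lerN2 normrM normfV.
rewrite -(ler_pM2l (_ : 0 < `|h|)) ?normr_gt0// mulrA mulfV ?normr_eq0// mul1r.
by apply: (le_trans (fM _)); rewrite addrK n1Z mulrCA.
Unshelve. all: by end_near. Qed.

End DerivativeBound.

Section DriftExpansion.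
Context {R : realType} {d : nat}.
Variables (T : R) (mu : R -> 'rV[R]_d -> 'rV[R]_d) (g : R -> R).
Implicit Types (x y b v : 'rV[R]_d) (t s h M : R) (i j l : 'I_d).

Definition drift i : R -> 'rV[R]_d -> R := fun t x => mu t x 0 i.

Definition hess i t x : 'I_d -> 'I_d -> R := fun l j => dx l (dx j (drift i)) t x.

(** The quantitative content of the regularity hypotheses, with one constant. *)
Record regular_bounds M : Prop := RegularBounds {
  bound_ge0 : 0 <= M;
  drift_growth : forall i t x, t \in `[0, T] -> `|drift i t x| <= M * (1 + n1 x);
  drift_derivable : forall i j t x, t \in `[0, T] ->
    derivable (drift i t) x (delta_mx 0 j);
  drift_derivable2 : forall i l j t x, t \in `[0, T] ->
    derivable (dx j (drift i) t) x (delta_mx 0 l);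
  drift_jac_bound : forall i j t x, t \in `[0, T] -> `|dx j (drift i) t x| <= M;
  drift_jac_lip : forall i j t x y, t \in `[0, T] ->
    `|dx j (drift i) t x - dx j (drift i) t y| <= M * n1 (x - y);
  drift_hess_bound : forall i l j t x, t \in `[0, T] -> `|hess i t x l j| <= M;
  drift_hess_lip : forall i l j t x y, t \in `[0, T] ->
    `|hess i t x l j - hess i t y l j| <= M * n1 (x - y);
  drift_time : forall i t s x, 0 <= t -> t <= s -> s <= T ->
    `|drift i s x - drift i t x - (s - t) * dt T (drift i) t x|
      <= M * (1 + n1 x) * (s - t) ^+ 2;
  drift_jac_time : forall i j t s x, 0 <= t -> t <= s -> s <= T ->
    `|dx j (drift i) s x - dx j (drift i) t x| <= M * (1 + n1 x) * (s - t);
  drift_hess_time : forall i l j t s x, 0 <= t -> t <= s -> s <= T ->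
    `|hess i s x l j - hess i t x l j| <= M * (1 + n1 x) * (s - t);
  diffusion_bound : forall t, t \in `[0, T] -> `|g t| <= M;
  diffusion_lip : forall t s, 0 <= t -> t <= s -> s <= T ->
    `|g s - g t| <= M * (s - t);
  diffusion_time : forall t s x, 0 <= t -> t <= s -> s <= T ->
    `|g s - g t - (s - t) * dt T (fun s (_ : 'rV[R]_d) => g s) t x|
      <= M * (s - t) ^+ 2 }.

Let sum_mulrB (v : 'rV[R]_d) (F G : 'I_d -> R) :
  \sum_(j < d) v 0 j * (F j - G j) = \sum_(j < d) v 0 j * F j - \sum_(j < d) v 0 j * G j.
Proof. by rewrite -sumrB; apply: eq_bigr => j _; rewrite mulrBr. Qed.

Lemma sum_mul_le (v : 'rV[R]_d) (F : 'I_d -> R) B : 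
  (forall j, `|F j| <= B) -> `|\sum_(j < d) v 0 j * F j| <= n1 v * B.
Proof.
move=> FB; apply: (le_trans (ler_norm_sum _ _ _)).
by rewrite mulr_suml; apply: ler_sum => j _; rewrite normrM ler_wpM2l.
Qed.

Variable M : R.
Hypothesis bM : regular_bounds M.

Let M0 : 0 <= M := bound_ge0 bM.

Let K := 1 + d%:R * M.

Let K1 : 1 <= K.
Proof. by rewrite lerDl mulr_ge0. Qed.

Lemma n1_drift t x : t \in `[0, T] -> n1 (mu t x) <= d%:R * M * (1 + n1 x).
Proof.
move=> tT; have -> : d%:R * M * (1 + n1 x) = \sum_(i < d) M * (1 + n1 x).
  by rewrite sumr_const card_ord -mulrA mulr_natl.

by apply: ler_sum => i _; exact: (drift_growth bM).
Qed.

Variables (t h : R) (y : 'rV[R]_d).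
Hypotheses (t0 : 0 <= t) (h0 : 0 <= h) (thT : t + 2^-1 * h <= T).

Let s := t + 2^-1 * h.
Let a := (2^-1 * h) *: mu t y.
Let Y := 1 + n1 y.

Let ts : t <= s.
Proof. by rewrite lerDl mulr_ge0. Qed.

Let tT : t \in `[0, T].
Proof. by rewrite in_itv/= t0 (le_trans ts). Qed.

Let sT : s \in `[0, T].
Proof. by rewrite in_itv/= thT (le_trans t0). Qed.

Let st : s - t = 2^-1 * h.
Proof. by rewrite /s addrC addKr. Qed.

Let Y1 : 1 <= Y.
Proof. by rewrite lerDl n1_ge0. Qed.

Let n1a : n1 a <= 2^-1 * h * (d%:R * M) * Y.
Proof.
rewrite n1Z ger0_norm ?mulr_ge0// -[leRHS]mulrA ler_wpM2l ?mulr_ge0//.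
exact: n1_drift.
Qed.

Let jac_shift i j : `|dx j (drift i) s (y + a) - dx j (drift i) t y| <= 2^-1 * M * K * (h * Y).
Proof.
rewrite (_ : _ - _ = (dx j (drift i) s (y + a) - dx j (drift i) s y)
  + (dx j (drift i) s y - dx j (drift i) t y)); last by rewrite addrA subrK.
apply: (le_trans (ler_normD _ _)).
apply: (@le_trans _ _ (M * (2^-1 * h * (d%:R * M) * Y) + M * Y * (2^-1 * h))).
  apply: lerD; last by have := drift_jac_time bM i j y t0 ts thT; rewrite st.
  apply: (le_trans (drift_jac_lip bM _ _ _ _ sT)); rewrite ler_wpM2l//.
  by rewrite [y + a]addrC addrK.
by apply: le_of_eq; rewrite /K; ring.
Qed.

Let hess_shift i l j : `|hess i s (y + a) l j - hess i t y l j| <= 2^-1 * M * K * (h * Y).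
Proof.
rewrite (_ : _ - _ = (hess i s (y + a) l j - hess i s y l j)
  + (hess i s y l j - hess i t y l j)); last by rewrite addrA subrK.
apply: (le_trans (ler_normD _ _)).
apply: (@le_trans _ _ (M * (2^-1 * h * (d%:R * M) * Y) + M * Y * (2^-1 * h))).
  apply: lerD; last by have := drift_hess_time bM i l j y t0 ts thT; rewrite st.
  apply: (le_trans (drift_hess_lip bM _ _ _ _ _ sT)); rewrite ler_wpM2l//.
  by rewrite [y + a]addrC addrK.
by apply: le_of_eq; rewrite /K; ring.
Qed.

(** First order in the Euler shift [a], which has size [h], and in time. *)
Let euler_shift i :
  `|drift i s (y + a) - drift i t y - 2^-1 * h * dt T (drift i) t y
    - \sum_(j < d) a 0 j * dx j (drift i) t y| <= M * K ^+ 2 * (h ^+ 2 * Y ^+ 2).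
Proof.
rewrite (_ : _ - _ - _ - _ =
  (drift i s (y + a) - drift i s y - \sum_(j < d) a 0 j * dx j (drift i) s y)
  + \sum_(j < d) a 0 j * (dx j (drift i) s y - dx j (drift i) t y)
  + (drift i s y - drift i t y - 2^-1 * h * dt T (drift i) t y)); last first.
  rewrite sum_mulrB.
  set S1 := \sum_(j < d) _ * dx j (drift i) s _.
  set S2 := \sum_(j < d) _ * dx j (drift i) t _.
  move: S1 S2 (drift i s (y + a)) (drift i s y) (drift i t y) (dt T (drift i) t y).
  by move=> *; ring.
have b1 : `|drift i s (y + a) - drift i s y - \sum_(j < d) a 0 j * dx j (drift i) s y|
    <= M * (2^-1 * h * (d%:R * M) * Y) ^+ 2.
  apply: (@le_trans _ _ (M * n1 a ^+ 2)).
    apply: (@taylor1 _ _ (drift i s) y a M M0) => [j x|j x z].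
      exact: (drift_derivable bM).
    exact: (drift_jac_lip bM).
  by rewrite ler_wpM2l// lerXn2r ?nnegrE ?n1_ge0// (le_trans _ n1a) ?n1_ge0.
have b2 : `|\sum_(j < d) a 0 j * (dx j (drift i) s y - dx j (drift i) t y)|
    <= (2^-1 * h * (d%:R * M) * Y) * (M * Y * (2^-1 * h)).
  apply: (le_trans (sum_mul_le a (B := M * Y * (2^-1 * h)) _)).
    by move=> j; have := drift_jac_time bM i j y t0 ts thT; rewrite st.
  by rewrite ler_wpM2r// !mulr_ge0// (le_trans _ Y1).
have b3 : `|drift i s y - drift i t y - 2^-1 * h * dt T (drift i) t y|
    <= M * Y * (2^-1 * h) ^+ 2.
  by have := drift_time bM i y t0 ts thT; rewrite st.
apply: (le_trans (ler_normD _ _)); apply: (le_trans (lerD (ler_normD _ _) b3)).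
apply: (le_trans (lerD (lerD b1 b2) (lexx _))).
have D0 : 0 <= d%:R * M by rewrite mulr_ge0.
have Y0 : 0 <= Y by exact: le_trans Y1.
have YY : Y <= Y ^+ 2 by rewrite expr2 ler_peMl.
apply: (@le_trans _ _ (M * (2^-1 * h * (d%:R * M) * Y) ^+ 2
  + 2^-1 * h * (d%:R * M) * Y * (M * Y * (2^-1 * h)) + M * Y ^+ 2 * (2^-1 * h) ^+ 2)).
  by rewrite lerD2l// ler_wpM2r ?sqr_ge0// ler_wpM2l.
rewrite (_ : _ + _ + _ = M * (h ^+ 2 * Y ^+ 2) *
  (4^-1 * ((d%:R * M) ^+ 2 + d%:R * M + 1))); last by field.
rewrite (_ : M * K ^+ 2 * _ = M * (h ^+ 2 * Y ^+ 2) * K ^+ 2); last by ring.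
rewrite ler_wpM2l ?mulr_ge0 ?sqr_ge0//.
rewrite /K; move: (d%:R * M) D0 => D D0; nra.
Qed.

(** Second order in the noise shift [b], of size [h ^ (1 / 2)]; moving the first and
    second derivatives from [(s, y + a)] back to [(t, y)] costs a factor [h]. *)
Let noise_shift i b :
  `|drift i s (y + a + b) - drift i s (y + a) - \sum_(j < d) b 0 j * dx j (drift i) t y
    - quad (hess i t y) b|
  <= 3 * M * n1 b ^+ 3 + M * K * (h * Y) * (2^-1 * n1 b + n1 b ^+ 2).
Proof.
have split3 (A B s1 s2 q1 q2 : R) :
    A - B - s2 - q2 = (A - B - s1 - q1) + (s1 - s2) + (q1 - q2) by ring.
rewrite (split3 _ _ (\sum_(j < d) b 0 j * dx j (drift i) s (y + a)) _
  (quad (hess i s (y + a)) b)) -sum_mulrB.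
apply: (le_trans (ler_normD _ _)).
apply: (@le_trans _ _ ((3 * M * n1 b ^+ 3 + n1 b * (2^-1 * M * K * (h * Y)))
   + 2 * (2^-1 * M * K * (h * Y)) * n1 b ^+ 2)); last first.
  by apply: le_of_eq; field.
apply: lerD; last first.
  by rewrite quadB; apply: quad_bound => l j; exact: hess_shift.
apply: (le_trans (ler_normD _ _)); apply: lerD; last first.
  by apply: sum_mul_le => // j; exact: jac_shift.
apply: (@taylor2 _ _ (drift i s) (y + a) b M M0) => [j x|l j x|l j x z].
- exact: (drift_derivable bM).
- exact: (drift_derivable2 bM).
- exact: (drift_hess_lip bM).
Qed.

(** The weights 1/3 and 2/3 are chosen so that the second evaluation point,
    shifted by [b], contributes its first and second order terms in [b] with
    the factor 2/3, while both points share the Euler shift [a]. *)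
Lemma drift_expansion i b :
  `|3^-1 * h * (drift i s (y + a) + 2 * drift i s (y + a + b))
    - (h * drift i t y
       + 2^-1 * h ^+ 2 * (dt T (drift i) t y + \sum_(j < d) mu t y 0 j * dx j (drift i) t y)
       + 2 / 3 * h * \sum_(j < d) b 0 j * dx j (drift i) t y
       + 2 / 3 * h * quad (hess i t y) b)|
  <= 2 * M * K ^+ 2 * (h * (h ^+ 2 * Y ^+ 2 + h * Y * n1 b + h * Y * n1 b ^+ 2 + n1 b ^+ 3)).
Proof.
have e1 := euler_shift i; have e2 := noise_shift i b.
have aE : \sum_(j < d) a 0 j * dx j (drift i) t y =
    2^-1 * h * \sum_(j < d) mu t y 0 j * dx j (drift i) t y.
  by rewrite mulr_sumr; apply: eq_bigr => j _; rewrite mxE mulrA.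
rewrite aE in e1.
have Y0 : 0 <= Y by exact: le_trans Y1.
have B0 := n1_ge0 b.
have K1' := K1.
move: e1 e2.
move: (drift i s (y + a)) (drift i s (y + a + b)) (drift i t y) (dt T (drift i) t y).
move: (quad (hess i t y) b).
set S1 := \sum_(j < d) b 0 j * dx j (drift i) t y.
set S2 := \sum_(j < d) mu t y 0 j * dx j (drift i) t y.
move: S1 S2 (n1 b) B0 (Y) Y0 (K) K1'.
move=> S1 S2 B B0 Z Z0 k k1 q A B' m dm e1 e2.
rewrite (_ : _ - _ = h * (A - m - 2^-1 * h * dm - 2^-1 * h * S2)
   + 2 / 3 * h * (B' - A - S1 - q)); last by field.
apply: (le_trans (ler_normD _ _)); rewrite !normrM ger0_norm//.
rewrite (_ : `|(3 : R)^-1| = 3^-1); last by rewrite ger0_norm.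
rewrite (_ : `|(2 : R)| = 2); last by rewrite ger0_norm.
apply: (le_trans (lerD (ler_wpM2l h0 e1) (ler_wpM2l _ e2))).
  by rewrite mulr_ge0.
rewrite -mulrA -[2 / 3 * h * _]mulrA [h * _ in X in _ + X <= _]mulrC.
rewrite -subr_ge0.
have kk : k <= k ^+ 2 by rewrite expr2 ler_peMl// (le_trans _ k1).
have kk1 : 1 <= k ^+ 2 by apply: le_trans kk.
have hZ : 0 <= h * Z by exact: mulr_ge0.
rewrite (_ : _ - _ = h * M * (k ^+ 2 * (h * Z) ^+ 2
  + (2 * k ^+ 2 - 3^-1 * k) * (h * Z * B) + (2 * k ^+ 2 - 2 / 3 * k) * (h * Z * B ^+ 2)
  + 2 * (k ^+ 2 - 1) * B ^+ 3)); last by field.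
rewrite mulr_ge0 ?mulr_ge0// !addr_ge0// ?mulr_ge0 ?sqr_ge0 ?exprn_ge0//; lra.
Qed.

End DriftExpansion.
(** * Uniform bounds from the regularity assumptions *)

Section RegularBounds.
Context {R : realType} {d : nat}.
Variables (T : R) (mu : R -> 'rV[R]_d -> 'rV[R]_d) (g : R -> R) (Mg CA : R).
Implicit Types (f : R -> 'rV[R]_d -> R) (x y : 'rV[R]_d) (t s M : R) (w : multi_index d).

Lemma joint_time_continuous f x :
  {within [set p : R * 'rV[R]_d | p.1 \in `[0, T]],
    continuous (fun p : R * 'rV[R]_d => f p.1 p.2)} ->
  {within `[0, T], continuous (fun r => f r x)}.
Proof.
move=> /subspace_continuousP cf; apply/subspace_continuousP => r rT.
have {}cf := cf (r, x) rT.
have S : (fun s => (s, x)) @ within `[0, T] (nbhs r)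
    --> within [set p : R * 'rV[R]_d | p.1 \in `[0, T]] (nbhs (r, x)).
  move=> A; have : (fun s : R => (s, x)) @ nbhs r --> nbhs (r, x).
    exact: (@cvg_pair _ _ _ (nbhs r) (nbhs r) (nbhs x) _ _ _ id (fun=> x) (@cvg_id _ _) (cvg_cst _)).
  by move=> + HA => /(_ _ HA).
exact: cvg_comp S cf.
Qed.

Lemma joint_space_continuous f t : t \in `[0, T] ->
  {within [set p : R * 'rV[R]_d | p.1 \in `[0, T]],
    continuous (fun p : R * 'rV[R]_d => f p.1 p.2)} ->
  continuous (f t).
Proof.
move=> tT /subspace_continuousP cf x.
have {}cf := cf (t, x) tT.
have S : (fun y => (t, y)) @ nbhs x
    --> within [set p : R * 'rV[R]_d | p.1 \in `[0, T]] (nbhs (t, x)).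
  move=> A; have : (fun y : 'rV[R]_d => (t, y)) @ nbhs x --> nbhs (t, x).
    exact: (@cvg_pair _ _ _ (nbhs x) (nbhs t) (nbhs x) _ _ _ (fun=> t) id (cvg_cst _) (@cvg_id _ _)).
  move=> + HA => /(_ _ HA); change ((\forall y \near x, (t \in `[0, T]) -> A (t, y)) ->
    \forall y \near x, A (t, y)); apply: filterS => y; exact: (fun H => H tT).
exact: cvg_comp S cf.
Qed.

(** The constant is a parameter, so that finitely many such bounds can be merged by
    taking it large. *)
Definition lip_growth_by M f := forall t x y, t \in `[0, T] ->
  `|f t x - f t y| <= M * n1 (x - y) /\ `|f t x| <= M * (1 + n1 x).

Lemma lipschitz_growth_near f : lipschitz_growth T f ->
  \forall M \near +oo, lip_growth_by M f.
Proof.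
move=> [L fL]; near=> M.
have LM : L <= M by near: M; exact: (nbhs_pinfty_ge (num_real _)).
have M0 : 0 <= M by near: M; exact: (nbhs_pinfty_ge (num_real _)).
move=> t x y tT; have [f1 f2] := fL t x y tT; split.
- apply: (le_trans f1); apply: (le_trans (ler_wpM2r _ LM)); first exact: enorm_ge0.
  by rewrite ler_wpM2l// enorm_le_n1.
- apply: (le_trans f2); apply: (le_trans (ler_wpM2r _ LM)).
    by rewrite addr_ge0// enorm_ge0.
  by rewrite ler_wpM2l// lerD2l enorm_le_n1.
Unshelve. all: by end_near. Qed.

(** There are finitely many derivatives of order at most three, so that all large
    constants serve them all. *)
Lemma regular3_near f : regular3 T f ->
  \forall M \near +oo, forall w, (0 < size w <= 3)%N -> lip_growth_by M (pder T w f).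
Proof.
move=> [_ fw].
have H : \forall M \near +oo, forall (n : 'I_4) (w : n.-tuple (option 'I_d)),
    (0 < n)%N -> lip_growth_by M (pder T w f).
  apply: filter_forall => n; apply: filter_forall => w.
  case: (posnP n) => [n0|n0]; first exact: nearW.
  have : lipschitz_growth T (pder T w f).
    by apply: fw; rewrite size_tuple n0/= -ltnS ltn_ord.
  by move=> /lipschitz_growth_near; apply: filterS => M.
apply: filterS H => M H w /andP[w0 w3].
exact: (H (Ordinal (w3 : (size w < 4)%N)) (in_tuple w)).
Qed.

(** The regularity of the derivatives of [mu] does not bound [mu] itself: its growth
    and its Jacobian come from the word [[:: None]], whose coefficient is [mu]. *)
Lemma standing_regular_bounds : 0 < T -> standing_assumptions T mu g Mg CA ->
  exists M, regular_bounds T mu g M.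
Proof.
move=> T0 [gM CA0 coefA [gs gr] mur].
have drift_coef t x y : t \in `[0, T] -> enorm (mu t x - mu t y) <= CA * enorm (x - y) /\
    enorm (mu t x) ^+ 2 <= CA ^+ 2 * (1 + enorm x ^+ 2).
  move=> tT.
  have A0 : A_set (3 / 2 : R) ([:: None] : multi_index d).
    by left; rewrite /zeros/= mulrCA divff// mulr1 ler_nat.
  have [_ /(_ t x y tT)] := coefA _ (or_introl A0).
  have E z : coef T mu g [:: None] t z = mu t z.
    by apply/rowP => i; rewrite mxE; exact: coef_comp_time.
  by rewrite !E.
have near_drift : \forall M \near +oo, forall i w, (0 < size w <= 3)%N ->
    lip_growth_by M (pder T w (drift mu i)).
  by apply: filter_forall => i; exact/regular3_near/mur.
have near_g : \forall M \near +oo, forall w, (0 < size w <= 3)%N ->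
    lip_growth_by M (pder T w (fun t (_ : 'rV[R]_d) => g t)).
  exact: regular3_near.
near (+oo : set_system R) => M.
have Mdrift : forall i w, (0 < size w <= 3)%N -> lip_growth_by M (pder T w (drift mu i)).
  by near: M.
have Mdiff : forall w, (0 < size w <= 3)%N ->
    lip_growth_by M (pder T w (fun t (_ : 'rV[R]_d) => g t)) by near: M.
have M0 : 0 <= M by near: M; exact: (nbhs_pinfty_ge (num_real _)).
have MCA : CA <= M by near: M; exact: (nbhs_pinfty_ge (num_real _)).
have MMg : Mg <= M by near: M; exact: (nbhs_pinfty_ge (num_real _)).
have n11 (v : 'rV[R]_d) : 0 <= 1 + n1 v by rewrite addr_ge0// n1_ge0.
have cont i w x : (size w <= 3)%N ->
    {within `[0, T], continuous (fun r => pder T w (drift mu i) r x)}.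
  by move=> w3; have [[_ cw] _] := mur i; exact/joint_time_continuous/cw.
have ex i j w : (size w < 3)%N -> pder1_exists T j (pder T w (drift mu i)).
  by have [[dw _] _] := mur i; exact: dw.
have tin t s : 0 <= t -> t <= s -> s <= T -> t \in `[0, T].
  by move=> t0 ts sT; rewrite in_itv/= t0 (le_trans ts).
exists M; split.
- by [].
- move=> i t x tT; have [_ mx] := drift_coef t x 0 tT.
  apply: (le_trans (coord_le_enorm _ _)).
  apply: (@le_trans _ _ (CA * (1 + enorm x))).
    rewrite -(@ler_pXn2r _ 2)// ?nnegrE ?enorm_ge0//; last first.
      by rewrite mulr_ge0 ?addr_ge0 ?enorm_ge0// ltW.
    apply: (le_trans mx); rewrite exprMn ler_wpM2l ?sqr_ge0// sqrrD expr1n mul1r.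
    by rewrite lerD2r lerDl mulrn_wge0// enorm_ge0.
  apply: ler_pM => //; [exact: ltW|by rewrite addr_ge0// enorm_ge0|].
  by rewrite lerD2l enorm_le_n1.
- by move=> i j t x; exact: (ex i (Some j) [::]).
- by move=> i l j t x; exact: (ex i (Some l) [:: Some j]).
- move=> i j t x tT.
  have := @derive_le _ _ (drift mu i t) x (delta_mx 0 j) M.
  rewrite n1_delta mulr1; apply; first exact: (ex i (Some j) [::]).
  move=> y; have [mx _] := drift_coef t y x tT.
  have := coord_le_enorm (mu t y - mu t x) i; rewrite !mxE => /le_trans; apply.
  apply: (le_trans mx); apply: ler_pM => //; [exact: ltW|exact: enorm_ge0|].
  exact: enorm_le_n1.
- by move=> i j t x y tT; have [] := Mdrift i [:: Some j] isT t x y tT.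
- move=> i l j t x tT.
  have := @derive_le _ _ (dx j (drift mu i) t) x (delta_mx 0 l) M.
  rewrite n1_delta mulr1; apply; first exact: (ex i (Some l) [:: Some j]).
  by move=> y; have [] := Mdrift i [:: Some j] isT t y x tT.
- by move=> i l j t x y tT; have [] := Mdrift i [:: Some l; Some j] isT t x y tT.
- move=> i t s x t0 ts sT.
  apply: (@time_taylor _ _ T (drift mu i)) => //.
  + exact: (ex i None [::]).
  + exact: (ex i None [:: None]).
  + exact: (cont i [::]).
  + exact: (cont i [:: None]).
  + by move=> r rT; have [] := Mdrift i [:: None; None] isT r x x rT.
- move=> i j t s x t0 ts sT.
  apply: (@time_bound _ _ T (dx j (drift mu i))) => //.
  + exact: (ex i None [:: Some j]).
  + exact: (cont i [:: Some j]).
  + by move=> r rT; have [] := Mdrift i [:: None; Some j] isT r x x rT.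
- move=> i l j t s x t0 ts sT.
  apply: (@time_bound _ _ T (fun t x => hess mu i t x l j)) => //.
  + exact: (ex i None [:: Some l; Some j]).
  + exact: (cont i [:: Some l; Some j]).
  + by move=> r rT; have [] := Mdrift i [:: None; Some l; Some j] isT r x x rT.
- by move=> t tT; apply: (le_trans (gM t tT)).
- move=> t s t0 ts sT.
  apply: (@time_bound _ d T (fun t (_ : 'rV[R]_d) => g t) t s 0) => //.
  + by have [] := gs => + _; exact: (fun H => H None [::] isT).
  + by have [_ cw] := gs; apply: (@joint_time_continuous (fun t _ => g t) 0); exact: (cw [::]).
  + move=> r rT; have [_] := Mdiff [:: None] isT r 0 0 rT.
    by rewrite n1_0 addr0 mulr1.
- move=> t s x t0 ts sT.
  apply: (@time_taylor _ d T (fun t (_ : 'rV[R]_d) => g t) t s x) => //.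
  + by have [] := gs => + _; exact: (fun H => H None [::] isT).
  + by have [] := gs => + _; exact: (fun H => H None [:: None] isT).
  + by have [_ cw] := gs; apply: (@joint_time_continuous (fun t _ => g t) x); exact: (cw [::]).
  + by have [_ cw] := gs; apply: (@joint_time_continuous (dt T (fun t _ => g t)) x); exact: (cw [:: None]).
  + move=> r rT; have [_] := Mdiff [:: None; None] isT r 0 0 rT.
    by rewrite n1_0 addr0 mulr1.
Unshelve. all: by end_near. Qed.

End RegularBounds.
(** * Measurability, Riemann sums, and integrals of continuous paths *)

Section ContinuousOfMeasurable.
Context {R : realType} {d : nat} {disp : measure_display} {Om : measurableType disp}.

(** An open set is a countable union of sup-norm balls with rational centres, and the
    preimage of such a ball is measurable coordinate by coordinate. *)
Lemma continuous_vector_measurable (f : 'rV[R]_d -> R) (X : Om -> 'rV[R]_d) :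
  continuous f -> (forall i, measurable_fun setT (fun w => X w 0 i)) ->
  measurable_fun setT (f \o X).
Proof.
move=> cf mX.
apply: (measurability _ (RGenOInfty.measurableE R)) => _ [_ [a ->] <-]; rewrite setTI.
pose O := f @^-1` `]a, +oo[.
have oO : open O by move/continuousP : cf; apply; exact: interval_open.
(* The ball of centre [p.1] and radius [1 / (p.2 + 1)], when it lies in [O]. *)
pose V (p : 'rV[rat]_d * nat) : set Om :=
  if `[< [set x : 'rV[R]_d | forall i, `|x 0 i - ratr (p.1 0 i)| < p.2.+1%:R^-1] `<=` O >]
  then [set w | forall i, `|X w 0 i - ratr (p.1 0 i)| < p.2.+1%:R^-1] else set0.
have -> : (f \o X) @^-1` `]a, +oo[ = \bigcup_p V p.
  apply/seteqP; split => [w Ow|w [p _]]; last first.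
    by rewrite /V; case: asboolP => // sO; exact: sO.
  have /nbhs_ballP[e /= e0 eO] := open_nbhs_nbhs (conj oO Ow).
  have [n /= ne] : exists n : nat, n.+1%:R^-1 < e / 2.
    have e20 : 0 < e / 2 by rewrite divr_gt0.
    near \oo => n; exists n; near: n; exact: (near_infty_natSinv_lt (PosNum e20)).
  have /choice[q qX] : forall i : 'I_d, exists q : rat,
      `|X w 0 i - ratr q| < n.+1%:R^-1.
    move=> i; have lt : X w 0 i < X w 0 i + n.+1%:R^-1 by rewrite ltrDl.
    have [q /itvP qi] := rat_in_itvoo lt.
    exists q; rewrite distrC ger0_norm ?subr_ge0 ?qi//.
    by rewrite ltrBlDl qi.
  exists (\row_i q i, n) => //; rewrite /V asboolT/=.
    by move=> i; rewrite mxE.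
  move=> x /= xq; apply: eO; split=> // k i; rewrite /ball/= (ord1 k).
  apply: (le_lt_trans (ler_distD (ratr (q i)) _ _)).
  have := xq i; rewrite mxE distrC => x1; have x2 := qX i.
  rewrite [e]splitr; apply: ltrD; rewrite distrC.
    exact: lt_trans x2 ne.
  exact: lt_trans x1 ne.
apply: countable_bigcupT_measurable; first exact: countableP.
move=> p; rewrite /V; case: asboolP => // _.
rewrite (_ : [set w | _] = ~` \bigcup_i
   (fun w => `|X w 0 i - ratr (p.1 0 i)|) @^-1` `[p.2.+1%:R^-1, +oo[); last first.
  apply/seteqP; split=> w /=.
    by move=> Xw [i _]; rewrite /= in_itv/= andbT leNgt Xw.
  move=> H i; rewrite ltNge; apply/negP => Hi; apply: H; exists i => //.
  by rewrite /= in_itv/= andbT.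
apply: measurableC; apply: countable_bigcupT_measurable; first exact: countableP.
move=> i; rewrite -[X in measurable X]setTI.
have : measurable_fun setT (fun w => `|X w 0 i - ratr (p.1 0 i)|).
  by apply: measurableT_comp => //; apply: measurable_funB => //; exact: measurable_cst.
by apply => //; exact: measurable_itv.
Unshelve. all: by end_near. Qed.

End ContinuousOfMeasurable.

Section UniformPartition.
Context {R : realType}.
Variables (s t : R).
Hypothesis st : s < t.
Implicit Types (n i : nat) (q r : R) (c : nat -> R) (f : R -> R).

(** There are [n.+1] subintervals, so that the mesh makes sense for every [n]. *)
Definition pt n i : R := s + i%:R * ((t - s) / n.+1%:R).

Definition stepfun n (c : nat -> R) q : R :=
  \sum_(i < n.+1) c i * \1_(`]pt n i, pt n i.+1]) q.

Let mesh_gt0 n : 0 < (t - s) / n.+1%:R.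
Proof. by rewrite divr_gt0// subr_gt0. Qed.

Lemma pt0 n : pt n 0 = s.
Proof. by rewrite /pt mul0r addr0. Qed.

Lemma pt_last n : pt n n.+1 = t.
Proof. by rewrite /pt mulrCA divff// mulr1 addrC subrK. Qed.

Lemma ptS n i : pt n i.+1 = pt n i + (t - s) / n.+1%:R.
Proof. by rewrite /pt -addrA -[i.+1]addn1 natrD mulrDl mul1r. Qed.

Lemma pt_le n i j : (i <= j)%N -> pt n i <= pt n j.
Proof. by move=> ij; rewrite lerD2l ler_wpM2r ?ler_nat// ltW. Qed.

Lemma pt_in n i : (i <= n.+1)%N -> pt n i \in `[s, t].
Proof.
move=> ni; rewrite in_itv/=; apply/andP; split.
  by rewrite -[leLHS](pt0 n) pt_le.
by rewrite -[leRHS](pt_last n) pt_le.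
Qed.

Lemma stepfun_eval n q : s < q <= t -> exists i, [/\ (i < n.+1)%N,
  pt n i < q <= pt n i.+1 & forall c, stepfun n c q = c i].
Proof.
move=> /andP[sq qt].
have ex : exists i, q <= pt n i by exists n.+1; rewrite pt_last.
case: (ex_minnP ex) => -[|i]; first by rewrite pt0 leNgt sq.
move=> qi mini.
have iq : pt n i < q.
  by rewrite ltNge; apply/negP => /mini; rewrite ltnn.
have i_n : (i < n.+1)%N by apply: mini; rewrite pt_last.
exists i; split => //; first by rewrite iq.
move=> c; rewrite /stepfun (bigD1 (Ordinal i_n))//= big1 ?addr0.
  by rewrite indicE mem_set/= ?mulr1// in_itv/= iq.
move=> j ji; rewrite indicE memNset ?mulr0//= in_itv/= => /andP[jq qj].
have [ij|ji'] := ltnP i j.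
  by move: jq; rewrite ltNge (le_trans qi)// pt_le.
have {}ji' : (j < i)%N.
  by rewrite ltn_neqAle ji' andbT; apply: contra ji => /eqP jE; apply/eqP/val_inj.
by move: iq; rewrite ltNge (le_trans qj)// pt_le.
Qed.

Lemma stepfun0 n c : stepfun n c s = 0.
Proof.
rewrite /stepfun big1// => i _; rewrite indicE memNset ?mulr0//= in_itv/=.
move=> /andP[+ _]; apply/negP; rewrite -leNgt -[leLHS](pt0 n).
exact: pt_le.
Qed.

Lemma mesh_cvg0 : (fun n => (t - s) / n.+1%:R) @ \oo --> (0 : R).
Proof.
rewrite -(mulr0 (t - s)); apply: cvgM; first exact: cvg_cst.
exact: cvg_harmonic.
Qed.

Let within_pt f q : {within `[s, t], continuous f} -> s < q <= t ->
  forall e, 0 < e -> \forall n \near \oo, forall i, (i <= n.+1)%N ->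
   `|pt n i - q| <= (t - s) / n.+1%:R -> `|f (pt n i) - f q| < e.
Proof.
move=> /subspace_continuousP cf /andP[sq qt] e e0.
have qst : `[s, t]%classic q by rewrite /= in_itv/= qt ltW.
have /cvgrPdist_lt/(_ _ e0) := cf q qst.
rewrite near_withinE => /nbhs_ballP[r /= r0 rf].
have /cvgrPdist_lt/(_ _ r0) Hm := mesh_cvg0.
near=> n => i ni iq.
rewrite distrC; apply: rf; last exact: pt_in.
rewrite /ball/= distrC; apply: (le_lt_trans iq).
have : `|0 - (t - s) / n.+1%:R| < r by near: n; exact: Hm.
by rewrite sub0r normrN gtr0_norm.
Unshelve. all: by end_near. Qed.

Lemma stepfun_cvg f q : {within `[s, t], continuous f} -> s < q <= t ->
  (fun n => stepfun n (fun i => f (pt n i.+1)) q) @ \oo --> f q.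
Proof.
move=> cf sqt; apply/cvgrPdist_lt => e e0.
have := within_pt cf sqt e0; apply: filterS => n H.
have [i [i_n /andP[iq qi] ->]] := stepfun_eval n sqt.
rewrite distrC; apply: H => //.
rewrite ger0_norm ?subr_ge0// ptS.
by rewrite addrAC -lerBrDr subrr subr_le0 ltW.
Qed.

Lemma integrable_path f : {within `[s, t], continuous f} ->
  (@lebesgue_measure R).-integrable `[s, t] (EFin \o f).
Proof. by move=> cf; apply: continuous_compact_integrable => //; exact: segment_compact. Qed.

Lemma integral_path_EFin f : {within `[s, t], continuous f} ->
  (\int[@lebesgue_measure R]_(q in `[s, t]) (f q)%:E)%E
  = (\int[@lebesgue_measure R]_(q in `[s, t]) f q)%:E.
Proof.
by move=> cf; rewrite /Rintegral fineK//; exact: integrable_fin_num (integrable_path cf).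
Qed.

Lemma integrable_path_sub f r : s <= r <= t -> {within `[s, t], continuous f} ->
  (@lebesgue_measure R).-integrable `[s, r] (EFin \o f).
Proof.
move=> /andP[sr rt] cf; apply: (integrableS _ _ _ (integrable_path cf)) => //.
by apply: subset_itvl; rewrite bnd_simp.
Qed.

Lemma path_bounded f : {within `[s, t], continuous f} ->
  exists2 B, 0 <= B & forall q, q \in `[s, t] -> `|f q| <= B.
Proof.
move=> cf.
have := compact_bounded (continuous_compact cf (@segment_compact _ s t)).
move=> [B [_ /(_ (`|B| + 1))]] H; exists (`|B| + 1); first by rewrite addr_ge0.
move=> q qst; apply: H; last by exists q.
by rewrite (le_lt_trans (ler_norm _))// ltrDl.
Qed.

Lemma measurable_stepfun n c : measurable_fun setT (stepfun n c).
Proof.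
apply: measurable_sum => i; exact: measurable_funM.
Qed.

Lemma integral_stepfun n c : (\int[@lebesgue_measure R]_(q in `]s, t]) (stepfun n c q)%:E)%E
  = (\sum_(i < n.+1) c i * ((t - s) / n.+1%:R))%:E.
Proof.
rewrite /stepfun; under eq_integral do rewrite -sumEFin.
have fin i : (@lebesgue_measure R).-integrable `]s, t]
    (fun q => (\1_(`]pt n i, pt n i.+1]%classic : set R) q)%:E).
  by apply: (integrableS _ _ _ (integrable_indic_itv _ _ _ _)).
rewrite integral_sum//=; last first.
  move=> i; rewrite (_ : (fun q => _) = (fun q => (c i)%:E * (\1_(`]pt n i, pt n i.+1]) q)%:E)%E).
    exact: integrableZl.
  by apply/funext => q; rewrite EFinM.
rewrite -sumEFin; apply: eq_bigr => i _.
under eq_integral do rewrite EFinM.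
rewrite integralZl// integral_indic// EFinM; congr (_ * _)%E.
rewrite setIidl; last first.
  by apply: subset_itv; rewrite bnd_simp; [rewrite -(pt0 n)|rewrite -(pt_last n)];
    rewrite pt_le.
have : (@lebesgue_measure R) `]pt n i, pt n i.+1]%classic = ((t - s) / n.+1%:R)%:E.
  rewrite lebesgue_measure_itv/= lte_fin ptS ltrDl mesh_gt0 -EFinB.
  by congr EFin; rewrite addrC addKr.
exact.
Qed.

(** The sums are integrals of step functions, and dominated convergence applies to
    these since a continuous path is bounded. *)
Lemma riemann_sum f : {within `[s, t], continuous f} ->
  (fun n => \sum_(i < n.+1) f (pt n i.+1) * ((t - s) / n.+1%:R)) @ \oo
    --> (\int[@lebesgue_measure R]_(q in `[s, t]) f q : R).
Proof.
move=> cf.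
have [B B0 fB] := path_bounded cf.
have int_oc : (@lebesgue_measure R).-integrable `]s, t] (EFin \o f).
  by apply: (integrableS _ _ _ (integrable_path cf)) => //; exact: subset_itv_oc_cc.
have mB : (@lebesgue_measure R).-integrable `]s, t] (EFin \o cst B).
  apply: (integrableS _ _ _ (integrable_path (f := cst B) _)) => //.
    exact: subset_itv_oc_cc.
  by apply: continuous_subspaceT => x; exact: cst_continuous.
have := @dominated_cvg _ _ _ (@lebesgue_measure R) `]s, t]%classic
  (measurable_itv _) (fun n q => (stepfun n (fun i => f (pt n i.+1)) q)%:E)
  (EFin \o f) (EFin \o cst B).
rewrite -Rintegral_itv_obnd_cbnd//.
have -> : (fun n => \sum_(i < n.+1) f (pt n i.+1) * ((t - s) / n.+1%:R)) =
    fine \o (fun n => \int[@lebesgue_measure R]_(q in `]s, t])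
      (stepfun n (fun i => f (pt n i.+1)) q)%:E)%E.
  by apply/funext => n; rewrite /= integral_stepfun.
move=> H; apply: fine_cvg; rewrite fineK.
  apply: H => //.
  - by move=> n; apply/measurable_EFinP; apply: measurable_funTS; exact: measurable_stepfun.
  - by move=> q; rewrite /= in_itv/= => sqt; apply: cvg_EFin; [exact: nearW|exact: stepfun_cvg].
  - move=> n q; rewrite /= in_itv/= => sqt.
    have [i [i_n _ ->]] := stepfun_eval n sqt.
    by rewrite lee_fin fB// pt_in.
exact: integrable_fin_num.
Qed.

End UniformPartition.

Section WithinContinuous.
Context {R : realType}.
Implicit Types (A : set R) (f g : R -> R).

Lemma within_continuousM A f g : {within A, continuous f} -> {within A, continuous g} ->
  {within A, continuous (fun x => f x * g x)}.
Proof.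
move=> /subspace_continuousP cf /subspace_continuousP cg.
by apply/subspace_continuousP => x Ax; apply: cvgM; [exact: cf|exact: cg].
Qed.

Lemma within_continuousB A f g : {within A, continuous f} -> {within A, continuous g} ->
  {within A, continuous (fun x => f x - g x)}.
Proof.
move=> /subspace_continuousP cf /subspace_continuousP cg.
by apply/subspace_continuousP => x Ax; apply: cvgB; [exact: cf|exact: cg].
Qed.

Lemma within_continuous_cst A (k : R) : {within A, continuous (fun=> k : R)}.
Proof. by apply: continuous_subspaceT => x; exact: cst_continuous. Qed.

Lemma within_continuousX A f n : {within A, continuous f} ->
  {within A, continuous (fun x => f x ^+ n)}.
Proof.
move=> cf; elim: n => [|n IHn].
  rewrite (_ : (fun x => f x ^+ 0) = (fun=> 1)); first exact: within_continuous_cst.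
  by apply/funext => x; rewrite expr0.
rewrite (_ : (fun x => f x ^+ n.+1) = (fun x => f x * f x ^+ n)).
  exact: within_continuousM.
by apply/funext => x; rewrite exprS.
Qed.

Lemma within_continuous_id A : {within A, continuous (fun x : R => x)}.
Proof. by apply: continuous_subspaceT => x; exact: cvg_id. Qed.

End WithinContinuous.

Section PathProcesses.
Context {R : realType} {disp : measure_display} {Om : measurableType disp}.
Variables (s t : R).
Hypothesis st : s < t.
Variable H : R -> Om -> R.
Hypothesis mH : forall q, q \in `[s, t] -> measurable_fun setT (H q).
Hypothesis cH : forall w, {within `[s, t], continuous (fun q => H q w)}.

(** A process with continuous paths is the pointwise limit of its right-endpoint
    step approximations, which are sums of products of a function of time and a
    function of the outcome. *)
Lemma path_jointly_measurable : jointly_measurable s t H.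
Proof.
rewrite /jointly_measurable.
pose A n (p : R * Om) := stepfun s t n (fun i => H (pt s t n i.+1) p.2) p.1
  + H s p.2 * \1_([set s]) p.1.
apply: (@measurable_fun_cvg _ _ _ _ A).
  move=> n; apply: measurable_funTS; apply: measurable_funD.
    apply: measurable_sum => i; apply: measurable_funM.
      by apply: measurableT_comp => //; apply: mH; apply: pt_in.
    by apply: measurableT_comp => //; exact: measurable_indic.
  apply: measurable_funM.
    by apply: measurableT_comp => //; apply: mH; rewrite in_itv/= lexx ltW.
  by apply: measurableT_comp => //; exact: measurable_indic.
move=> [q w] /= [+ _]; rewrite in_itv/= => /andP[+ qt].
rewrite le_eqVlt => /predU1P[<-|sq].
  rewrite /A/=; under eq_cvg do rewrite stepfun0// indicE mem_set// mulr1 add0r.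
  exact: cvg_cst.
rewrite /A/=; under eq_cvg do
  (rewrite indicE memNset ?mulr0 ?addr0; last by move=> /= E; rewrite E ltxx in sq).
by apply: (@stepfun_cvg _ s t st (fun q => H q w)) => //; rewrite sq.
Qed.

Lemma measurable_path_integral :
  measurable_fun setT (fun w => \int[@lebesgue_measure R]_(q in `[s, t]) H q w).
Proof.
apply: (@measurable_fun_cvg _ _ _ _
  (fun n w => \sum_(i < n.+1) H (pt s t n i.+1) w * ((t - s) / n.+1%:R))).
  move=> n; apply: measurable_sum => i; apply: measurable_funM => //.
  by apply: mH; exact: pt_in.
by move=> w _; exact: (riemann_sum st (@cH w)).
Qed.

End PathProcesses.

Lemma Rintegral_cst_itv {R : realType} (a b k : R) : a <= b ->
  \int[@lebesgue_measure R]_(_ in `[a, b]) k = k * (b - a).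
Proof.
move=> ab; rewrite Rintegral_cst//; congr (_ * _).
have lam : (@lebesgue_measure R) `[a, b]%classic = (b - a)%:E.
  rewrite lebesgue_measure_itv/= lte_fin; case: ltP => // ba.
  by rewrite (le_anti (introT andP (conj ab ba))) subrr.
exact: (congr1 fine lam).
Qed.

Lemma pow6_ge0 {R : realDomainType} (x : R) : 0 <= x ^+ 6.
Proof. by rewrite -[6%N]/(2 * 3)%N exprM exprn_ge0// sqr_ge0. Qed.

Lemma sqr_le_pow6 {R : realFieldType} (x : R) : x ^+ 2 <= 1 + x ^+ 6.
Proof.
rewrite (_ : x ^+ 6 = (x ^+ 2) ^+ 3); last by rewrite -exprM.
move: (x ^+ 2) (sqr_ge0 x) => y y0; have [y1|/ltW y1] := leP y 1.
  by apply: (le_trans y1); rewrite lerDl exprn_ge0.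
by apply: (@le_trans _ _ (y ^+ 3)); [rewrite ler_eXnr|rewrite lerDr].
Qed.

(** The tangent line of the sixth power at [c], from which the forms of Jensen's
    inequality below follow by taking for [c] a mean value. *)
Lemma pow6_tangent {R : realFieldType} (c x : R) : 6 * c ^+ 5 * x - 5 * c ^+ 6 <= x ^+ 6.
Proof.
rewrite -subr_ge0 (_ : _ - _ = (x - c) ^+ 2 *
  (x ^+ 4 + 2 * c * x ^+ 3 + 3 * c ^+ 2 * x ^+ 2 + 4 * c ^+ 3 * x + 5 * c ^+ 4)); last by ring.
apply: mulr_ge0; first exact: sqr_ge0.
rewrite (_ : _ + _ = (x ^+ 2 + c * x) ^+ 2 + 2 * (c * x + c ^+ 2) ^+ 2 + 3 * (c ^+ 2) ^+ 2);
  last by ring.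
have := sqr_ge0 (x ^+ 2 + c * x); have := sqr_ge0 (c * x + c ^+ 2).
have := sqr_ge0 (c ^+ 2); lra.
Qed.

Section PathInequalities.
Context {R : realType}.
Variables (s t : R).
Hypothesis st : s < t.

(** Jensen's inequality: integrate the tangent line at the mean value. *)
Lemma path_integral_pow6 (f : R -> R) : {within `[s, t], continuous f} ->
  (\int[@lebesgue_measure R]_(q in `[s, t]) f q) ^+ 6
  <= (t - s) ^+ 5 * \int[@lebesgue_measure R]_(q in `[s, t]) f q ^+ 6.
Proof.
move=> cf; set I := \int[@lebesgue_measure R]_(q in `[s, t]) f q.
have ts0 : 0 < t - s by rewrite subr_gt0.
have h0 := lt0r_neq0 ts0.
pose c := I / (t - s).
have contc (k : R) : {within `[s, t], continuous (cst k : R -> R)} := @within_continuous_cst R _ k.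
have cont6 := @within_continuousX R _ f 6%N cf.
have contl : {within `[s, t], continuous (fun q => 6 * c ^+ 5 * f q)}.
  exact: (within_continuousM (contc (6 * c ^+ 5)) cf).
have tang := pow6_tangent c.
have : \int[@lebesgue_measure R]_(q in `[s, t]) (6 * c ^+ 5 * f q - 5 * c ^+ 6)
    <= \int[@lebesgue_measure R]_(q in `[s, t]) f q ^+ 6.
  apply: le_Rintegral => //.
  - by apply: integrable_path; apply: (within_continuousB contl (contc _)).
  - exact: integrable_path.
rewrite RintegralB//; [|exact: (integrable_path contl)|exact: (integrable_path (contc _))].
rewrite RintegralZl//; last exact: integrable_path.
rewrite Rintegral_cst_itv; last exact: ltW.
rewrite -/I (_ : I = c * (t - s)); last by rewrite /c divfK.
move=> le6; rewrite exprMn.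
rewrite (_ : c ^+ 6 * (t - s) ^+ 6 = (t - s) ^+ 5 * (c ^+ 6 * (t - s))); last by ring.
apply: ler_wpM2l; first by rewrite exprn_ge0// ltW.
apply: le_trans le6.
by apply: le_of_eq; ring.
Qed.

End PathInequalities.

Section Swap.
Context {R : realType} {disp : measure_display} {Om : measurableType disp}.
Variable P : probability Om R.
Variables (s t : R).
Local Open Scope ereal_scope.

(** The time set is moved into the integrand, since the theorems of Fubini and
    Tonelli concern integrals over a whole product. *)
Let restricted (H : R -> Om -> R) (p : R * Om) : R :=
  (((fun q => H q p.2) \_ `[s, t]) p.1)%R.

Let measurable_restricted H : jointly_measurable s t H ->
  measurable_fun setT (restricted H).
Proof.
move=> jH.
have -> : restricted H = (fun p : R * Om => H p.1 p.2) \_ (`[s, t] `*` setT).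
  apply/funext => -[q w]; rewrite /restricted /patch/=.
  have -> // : ((q, w) \in `[s, t] `*` [set: Om]) = (q \in (`[s, t]%classic : set R)).
  by apply/idP/idP; rewrite !inE => //= -[].
by apply/(measurable_restrictT _ _).1 => //; exact: measurableX.
Qed.

Let int_restricted H w : \int[@lebesgue_measure R]_q (restricted H (q, w))%:E
  = \int[@lebesgue_measure R]_(q in `[s, t]) (H q w)%:E.
Proof.
rewrite [RHS]integral_mkcond; apply: eq_integral => q _.
by rewrite /restricted/= restrict_EFin.
Qed.

Let exp_restricted H : \int[@lebesgue_measure R]_q \int[P]_w (restricted H (q, w))%:E
  = \int[@lebesgue_measure R]_(q in `[s, t]) \int[P]_w (H q w)%:E.
Proof.
rewrite [RHS]integral_mkcond; apply: eq_integral => q _.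
rewrite /restricted/= /patch; case: ifPn => // _.
by rewrite integral0.
Qed.

Lemma tonelli_path (H : R -> Om -> R) : jointly_measurable s t H ->
  (forall q w, q \in `[s, t] -> (0 <= H q w)%R) ->
  \int[P]_w \int[@lebesgue_measure R]_(q in `[s, t]) (H q w)%:E
  = \int[@lebesgue_measure R]_(q in `[s, t]) \int[P]_w (H q w)%:E.
Proof.
move=> jH H0.
have mf := measurable_restricted jH.
have f0 z : 0 <= (restricted H z)%:E.
  case: z => q w; rewrite /restricted/= lee_fin /patch; case: ifPn => //.
  by rewrite inE => qst; exact: H0.
rewrite -exp_restricted.
have := @fubini_tonelli _ _ _ _ _ (@lebesgue_measure R) P (EFin \o restricted H).
move=> ->; [|exact/measurable_EFinP|exact: f0].
by apply: eq_integral => w _; rewrite int_restricted.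
Qed.

(** First absolute moments that are bounded over a bounded time interval give
    integrability on the product. *)
Lemma fubini_path (H : R -> Om -> R) (C : R) : jointly_measurable s t H ->
  (forall q, q \in `[s, t] -> \int[P]_w `|H q w|%:E <= C%:E) ->
  \int[P]_w \int[@lebesgue_measure R]_(q in `[s, t]) (H q w)%:E
  = \int[@lebesgue_measure R]_(q in `[s, t]) \int[P]_w (H q w)%:E.
Proof.
move=> jH HC.
have mf := measurable_restricted jH.
rewrite -exp_restricted.
have := @Fubini _ _ _ _ _ (@lebesgue_measure R) P (EFin \o restricted H).
move=> ->; first by apply: eq_integral => w _; rewrite int_restricted.
apply/integrable12ltyP; first exact/measurable_EFinP.
rewrite (_ : \int[_]_x _ = \int[@lebesgue_measure R]_(q in `[s, t]) \int[P]_w `|H q w|%:E); last first.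
  rewrite [RHS]integral_mkcond; apply: eq_integral => q _.
  rewrite /restricted/= /patch; case: ifPn => // _.
  by rewrite integral0_eq// => w _; rewrite normr0.
apply: (@le_lt_trans _ _ (\int[@lebesgue_measure R]_(q in `[s, t]) `|C|%:E)).
  rewrite integral_mkcond [leRHS]integral_mkcond.
  apply: ge0_le_integral => //.
  - move=> q _; rewrite /patch; case: ifPn => // _.
    by apply: integral_ge0 => w _; rewrite lee_fin.
  - rewrite (_ : _ \_ _ = (fun q => \int[P]_w `|restricted H (q, w)|%:E)).
      apply: (@measurable_fun_fubini_tonelli_F _ _ _ _ _ P (fun p => `|restricted H p|%:E)).
        by apply/measurable_EFinP; exact: measurableT_comp.
      by move=> z; rewrite lee_fin.
    apply/funext => q; rewrite /restricted/= /patch; case: ifPn => // _.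
    by rewrite integral0_eq// => w _; rewrite normr0.
  - by apply/(measurable_restrictT _ _).1 => //; exact: measurable_cst.
  - move=> q _; rewrite /patch; case: ifPn => //; rewrite inE => qst.
    by apply: (le_trans (HC q qst)); rewrite lee_fin ler_norm.
have lam : (@lebesgue_measure R) `[s, t]%classic < +oo.
  by rewrite lebesgue_measure_itv/=; case: ifP => _; rewrite ?ltry// -EFinB ltry.
by rewrite integral_cst//; exact: lte_mul_pinfty.
Qed.

End Swap.

Section InProbability.
Context {R : realType} {disp : measure_display} {Om : measurableType disp}.
Variable P : probability Om R.

(** Dominated convergence for the indicators of the events of large deviation. *)
Lemma cvg_cvg_in_prob (X : nat -> Om -> R) (Y : Om -> R) :
  (forall n, measurable_fun setT (X n)) -> measurable_fun setT Y ->
  (forall w, (fun n => X n w) @ \oo --> Y w) -> cvg_in_prob P X Y.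
Proof.
move=> mX mY XY e e0.
pose A n := [set w | e <= `|X n w - Y w|].
have mA n : measurable (A n).
  have : measurable_fun setT (fun w => `|X n w - Y w|).
    by apply: measurableT_comp => //; exact: measurable_funB.
  move=> /(_ measurableT `[e, +oo[%classic (measurable_itv _)); rewrite setTI.
  congr measurable; apply/seteqP; split=> w /=; rewrite in_itv/= andbT//.
have := @dominated_cvg _ _ _ P setT measurableT (fun n w => (\1_(A n) w)%:E)
  (cst 0%E) (cst 1%E).
rewrite integral0 => H.
rewrite (_ : (fun n => P (A n)) = (fun n => \int[P]_w (\1_(A n) w)%:E)%E); last first.
  by apply/funext => n; rewrite integral_indic// setIT.
apply: H => //.
- by move=> n; apply/measurable_EFinP; exact: measurable_indic.
- move=> w _; apply: (cvg_trans _ (@cvg_cst _ (0%E : \bar R) _ \oo _)).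
  apply: near_eq_cvg.
  have /cvgrPdist_lt/(_ _ e0) := XY w; apply: filterS => n.
  rewrite distrC => nw; rewrite indicE memNset//.
  by apply/negP; rewrite -ltNge.
- exact: finite_measure_integrable_cst.
- by move=> n w _; rewrite indicE; case: (_ \in _); rewrite /= ?normr1 ?normr0// lee_fin.
Qed.

End InProbability.
(** * Gaussian moments *)

Section DerivativeOnTheLine.
Context {R : realType}.
Local Notation mu := (@lebesgue_measure R).

(** The integral over the line is the limit of the integrals over [[- n, n]], which
    the fundamental theorem of calculus evaluates. *)
Lemma integral_derivative_eq0 (F f : R -> R) : continuous f ->
  (forall x : R, is_derive x 1 F (f x)) -> mu.-integrable setT (EFin \o f) ->
  (fun n : nat => F n%:R - F (- n%:R)) @ \oo --> (0 : R) ->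
  (\int[mu]_x (f x)%:E = 0)%E.
Proof.
move=> cf dF intf F0.
pose f_ (n : nat) : R -> \bar R := (EFin \o f) \_ `[- (n%:R : R), n%:R].
have mf := measurable_int _ intf.
have H := @dominated_cvg _ _ _ mu setT measurableT f_ (EFin \o f) (abse \o (EFin \o f)).
have {}H : (\int[mu]_x f_ n x)%E @[n --> \oo] --> (\int[mu]_x (f x)%:E)%E.
  apply: H => //.
  - move=> n; apply/(measurable_restrictT _ _).1 => //; exact: measurable_funTS.
  - move=> x _; apply: (cvg_trans _ (@cvg_cst _ ((f x)%:E : \bar R) _ \oo _)).
    apply: near_eq_cvg; near=> n.
    rewrite /f_ /patch mem_set//= in_itv/= -ler_norml.
    by near: n; exact: nbhs_infty_ger.
  - exact: integrable_abse.
  - by move=> n x _; rewrite /f_ /patch; case: ifPn => _ //=; rewrite normr0 lee_fin.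
have E : (\int[mu]_x f_ n x)%E @[n --> \oo] --> (0%:E : \bar R).
  have G : ((fun n : nat => (F n%:R - F (- n%:R))%:E) @ \oo --> (0%:E : \bar R)).
    by apply: cvg_EFin => //; exact: nearW.
  apply: (cvg_trans _ G); apply: near_eq_cvg; near=> n.
  have n0 : (0 < n)%N by near: n; exact: nbhs_infty_gt.
  rewrite /f_ -integral_mkcond (@continuous_FTC2 _ f F)//.
  - by rewrite gtrN// ltr0n.
  - exact: continuous_subspaceT.
  - have cF x : {for x, continuous F}.
      by apply/differentiable_continuous/derivable1_diffP; have [] := dF x.
    split.
    + by move=> x _; have [] := dF x.
    + by apply: cvg_at_right_filter; exact: cF.
    + by apply: cvg_at_left_filter; exact: cF.
  - by move=> x _; rewrite derive1E; have [_] := dF x.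
by apply: (cvg_unique _ H E).
Unshelve. all: by end_near. Qed.

End DerivativeOnTheLine.

(** A crude upper bound for the sixth moment of the standard normal law, from
    [x ^ 6 = 64 u ^ 3], [u ^ 3 exp (- u) <= 27], and a factor 2 between the peaks of
    two densities. *)
Definition gauss6 {R : realType} : R := 64 * (27 * 2).

Lemma gauss6_ge0 {R : realType} : 0 <= gauss6 :> R.
Proof. by rewrite /gauss6 !mulr_ge0. Qed.

Section NormalMoments.
Context {R : realType}.
Local Notation mu := (@lebesgue_measure R).
Variable s : R.
Hypothesis s0 : 0 < s.

Let sN0 : s != 0 := lt0r_neq0 s0.

Local Notation p := (normal_pdf 0 s).

Let pE : p = (fun x => normal_peak s * expR ((- (2 * s ^+ 2)^-1) * x ^+ 2)).
Proof.
rewrite normal_pdfE//; apply/funext => x; congr (_ * expR _).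
by rewrite subr0 -mulr_natl; field.
Qed.

Lemma is_derive_normal_pdf (x : R) : is_derive x 1 p (- (s ^+ 2)^-1 * x * p x).
Proof.
rewrite pE; set c := - (2 * s ^+ 2)^-1.
have d1 : is_derive x 1 (fun x : R => c * x ^+ 2) (c * (2 * x)).
  by apply: is_derive_eq; rewrite ?scaler0 ?scaler1 ?addr0 /GRing.scale/= ?mulr1; ring.
have d2 := @is_derive1_comp _ expR (fun x : R => c * x ^+ 2) x _ _ (is_derive_expR _) d1.
have d3 : is_derive x 1 (fun x => normal_peak s * expR (c * x ^+ 2))
    (normal_peak s * (expR (c * x ^+ 2) * (c * (2 * x)))).
  by apply: is_derive_eq; rewrite ?scaler0 ?addr0.
apply: is_derive_eq; rewrite /c; field.
by rewrite sN0.
Qed.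

(** A polynomial factor is absorbed by half of the Gaussian exponent, at the
    price of doubling the variance. *)
Lemma pow6_normal_pdf x : x ^+ 6 * p x <= gauss6 * s ^+ 6 * normal_pdf 0 (Num.sqrt 2 * s) x.
Proof.
have s20 : Num.sqrt 2 * s != 0 by rewrite mulf_neq0// sqrtr_eq0 -ltNge.
have sq2 : Num.sqrt 2 ^+ 2 = 2 :> R by rewrite sqr_sqrtr.
have peakE : normal_peak s <= 2 * normal_peak (Num.sqrt 2 * s).
  have -> : normal_peak (Num.sqrt 2 * s) = (Num.sqrt 2)^-1 * normal_peak s :> R.
    rewrite /normal_peak exprMn sq2 -mulrA -mulrnAr sqrtrM//.
    by rewrite invfM.
  have q0 : 0 < Num.sqrt 2 :> R by rewrite sqrtr_gt0.
  have -> : 2 * ((Num.sqrt 2)^-1 * normal_peak s) = Num.sqrt 2 * normal_peak s.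
    by rewrite -{1}sq2 expr2 mulrA mulfK// lt0r_neq0.
  rewrite ler_peMl ?normal_peak_ge0// -(@ler_pXn2r _ 2)// ?nnegrE ?(ltW q0)// sq2.
  by rewrite expr1n ler1n.
rewrite pE (normal_pdfE _ s20).
rewrite [normal_fun _ _ _](_ : _ = expR (- (4 * s ^+ 2)^-1 * x ^+ 2)); last first.
  rewrite /normal_fun subr0 exprMn sq2 -mulr_natl; congr expR; field.
  by rewrite sN0.
(* In terms of [u], the two exponents are [- u - u] and [- u]. *)
pose u := (4 * s ^+ 2)^-1 * x ^+ 2.
have u0 : 0 <= u by rewrite mulr_ge0 ?sqr_ge0// invr_ge0 mulr_ge0 ?sqr_ge0.
have -> : - (2 * s ^+ 2)^-1 * x ^+ 2 = - u - u by rewrite /u; field; rewrite sN0.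
have -> : - (4 * s ^+ 2)^-1 * x ^+ 2 = - u by rewrite /u mulNr.
have -> : x ^+ 6 = 64 * s ^+ 6 * u ^+ 3 by rewrite /u; field; rewrite sN0.
(* From [u / 3 <= exp (u / 3)]. *)
have u3 : u ^+ 3 * expR (- u) <= 27.
  have : (u / 3) ^+ 3 <= expR (u / 3) ^+ 3.
    rewrite lerXn2r ?nnegrE ?divr_ge0 ?expR_ge0//.
    by apply: le_trans (expR_ge1Dx _); rewrite lerDr.
  have -> : expR (u / 3) ^+ 3 = expR u by rewrite -expRM_natl mulrCA divff ?mulr1.
  rewrite expr_div_n ler_pdivrMr ?exprn_gt0// => H.
  apply: (le_trans (ler_wpM2r (expR_ge0 _) H)).
  by rewrite mulrAC -expRD subrr expR0 mul1r -natrX ler_nat.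
rewrite expRD.
rewrite (_ : _ * (normal_peak s * _) =
  64 * s ^+ 6 * expR (- u) * (u ^+ 3 * expR (- u) * normal_peak s)); last by ring.
rewrite (_ : gauss6 * s ^+ 6 * _ =
  64 * s ^+ 6 * expR (- u) * (27 * (2 * normal_peak (Num.sqrt 2 * s)))); last first.
  by rewrite /gauss6; ring.
have s6 : 0 <= s ^+ 6 by rewrite exprn_ge0// ltW.
have e0 : 0 <= expR (- u) by exact: expR_ge0.
apply: ler_wpM2l; first by rewrite mulr_ge0// mulr_ge0.
by apply: ler_pM => //; [rewrite mulr_ge0// exprn_ge0|exact: normal_peak_ge0].
Qed.

Let cp : continuous p. Proof. exact: continuous_normal_pdf. Qed.

Let p0 x : 0 <= p x. Proof. exact: normal_pdf_ge0. Qed.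

Let mp : measurable_fun setT p. Proof. exact: measurable_normal_pdf. Qed.

Let intp : mu.-integrable setT (EFin \o p).
Proof. exact: integrable_normal_pdf. Qed.

(** It dominates [q * p] for every [q] with [`|q x| <= 1 + x ^ 6]. *)
Let majorant x := p x + gauss6 * s ^+ 6 * normal_pdf 0 (Num.sqrt 2 * s) x.

Let int_majorant : mu.-integrable setT (EFin \o majorant).
Proof.
have i2 : mu.-integrable setT (EFin \o (fun x => gauss6 * s ^+ 6 * normal_pdf 0 (Num.sqrt 2 * s) x)).
  have := @integrableZl _ _ _ mu setT measurableT (gauss6 * s ^+ 6) _
    (@integrable_normal_pdf R 0 (Num.sqrt 2 * s)).
  by apply: eq_integrable => // x _; rewrite /= EFinM.
have := integrableD measurableT intp i2.
by apply: eq_integrable => // x _; rewrite /majorant/= EFinD.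
Qed.

Let int_dominated (q : R -> R) : continuous q -> (forall x, `|q x| <= 1 + x ^+ 6) ->
  mu.-integrable setT (EFin \o (fun x => q x * p x)).
Proof.
move=> cq q1; apply: (le_integrable measurableT _ _ int_majorant).
  apply/measurable_EFinP; apply: measurable_funM => //.
  exact: continuous_measurable_fun.
move=> x _ /=; rewrite lee_fin normrM (ger0_norm (p0 x)).
apply: (le_trans (ler_wpM2r (p0 x) (q1 x))).
apply: le_trans (ler_norm _).
by rewrite mulrDl mul1r lerD2l pow6_normal_pdf.
Qed.

Let int_x2p : mu.-integrable setT (EFin \o (fun x => x ^+ 2 * p x)).
Proof.
apply: int_dominated; first exact: exprn_continuous.
by move=> x; rewrite ger0_norm ?sqr_ge0// sqr_le_pow6.
Qed.

Let int_xp : mu.-integrable setT (EFin \o (fun x => x * p x)).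
Proof.
apply: int_dominated; first by move=> x; exact: cvg_id.
move=> x; rewrite (_ : x ^+ 6 = `|x| ^+ 6); last by rewrite -normrX ger0_norm// pow6_ge0.
have := normr_ge0 x; move: `|x| => y y0; have [y1|/ltW y1] := leP y 1.
  by apply: (le_trans y1); rewrite lerDl exprn_ge0.
by apply: (@le_trans _ _ (y ^+ 6)); [rewrite ler_eXnr|rewrite lerDr].
Qed.

Lemma integral_x_pdf : (\int[mu]_x (x * p x)%:E = 0)%E.
Proof.
apply: (@integral_derivative_eq0 _ (fun x => - s ^+ 2 * p x)).
- by move=> x; apply: cvgM; [exact: cvg_id|exact: cp].
- move=> x; have d := is_derive_normal_pdf x.
  apply: is_derive_eq; rewrite ?scaler0 ?addr0 /GRing.scale/=; field.
  by rewrite sN0.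
- exact: int_xp.
- rewrite (_ : (fun n => _) = cst 0); first exact: cvg_cst.
  by apply/funext => n; rewrite pE /= sqrrN subrr.
Qed.

(** The function [p - x ^ 2 p / s ^ 2] is the derivative of [x p], which vanishes at
    infinity. *)
Lemma integral_x2_pdf : (\int[mu]_x (x ^+ 2 * p x)%:E = (s ^+ 2)%:E)%E.
Proof.
have H : (\int[mu]_x (p x - (s ^+ 2)^-1 * (x ^+ 2 * p x))%:E = 0)%E.
  apply: (@integral_derivative_eq0 _ (fun x => x * p x)) => //.
  - move=> x; apply: cvgB; first exact: cp.
    apply: cvgM; first exact: cvg_cst.
    by apply: cvgM; [exact: exprn_continuous|exact: cp].
  - move=> x; have d := is_derive_normal_pdf x.
    apply: is_derive_eq; rewrite /GRing.scale/= mulr1; field.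
    by rewrite sN0.
  - have := @integrableB _ _ _ mu setT measurableT _ _ intp
      (integrableZl measurableT (s ^+ 2)^-1 int_x2p).
    by apply: eq_integrable => // x _; rewrite /= EFinB EFinM.
  - pose B := normal_peak s + gauss6 * s ^+ 6 * normal_peak (Num.sqrt 2 * s).
    have bound n : `|n%:R * p n%:R - (- n%:R) * p (- n%:R)| <= 4 * B * n.+1%:R^-1.
      have pN : p (- n%:R) = p n%:R by rewrite pE /= sqrrN.
      rewrite pN mulNr opprK (_ : _ + _ = 2 * (n%:R * p n%:R)); last by ring.
      rewrite ger0_norm ?mulr_ge0// ler_pdivlMr//.
      apply: (@le_trans _ _ (4 * ((1 + n%:R ^+ 6) * p n%:R))).
        rewrite (_ : 2 * (n%:R * p n%:R) * n.+1%:R = 2 * (n%:R * n.+1%:R) * p n%:R); last by ring.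
        rewrite [leRHS]mulrA ler_wpM2r//.
        rewrite -natrX -[1]/(1%:R) -natrD -!natrM ler_nat.
        case: n {pN} => // n; rewrite -[4%N]/(2 * 2)%N -mulnA leq_mul2l/=.
        by rewrite !expnS expn0; nia.
      rewrite ler_wpM2l// mulrDl mul1r; apply: lerD; first exact: normal_pdf_ub.
      apply: (le_trans (pow6_normal_pdf _)).
      apply: ler_wpM2l; first by rewrite mulr_ge0 ?gauss6_ge0// exprn_ge0// ltW.
      by apply: normal_pdf_ub; rewrite mulf_neq0// sqrtr_eq0 -ltNge.
    apply: (@squeeze_cvgr _ _ _ _ (fun n => - (4 * B * n.+1%:R^-1)) (fun n => 4 * B * n.+1%:R^-1)).
    + by apply: nearW => n; rewrite -ler_norml.
    + by rewrite -oppr0; apply: cvgN; rewrite -(mulr0 (4 * B)); apply: cvgM; [exact: cvg_cst|exact: cvg_harmonic].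
    + by rewrite -(mulr0 (4 * B)); apply: cvgM; [exact: cvg_cst|exact: cvg_harmonic].
have : (\int[mu]_x ((p x)%:E - ((s ^+ 2)^-1)%:E * (x ^+ 2 * p x)%:E) = 0)%E.
  by rewrite -[RHS]H; apply: eq_integral => x _; rewrite EFinB EFinM.
rewrite integralB//; last exact: integrableZl.
rewrite integral_normal_pdf integralZl//.
move=> /eqP; rewrite sube_eq// ?fin_num_adde_defl// add0e => /eqP E.
have fin := integrable_fin_num measurableT int_x2p.
move: E; rewrite -(fineK fin) -EFinM => -[E]; congr EFin.
have s2 : s ^+ 2 != 0 by rewrite expf_neq0.
by apply: (mulfI (invr_neq0 s2)); rewrite -E mulVf.
Qed.

(** Change of variables along the Radon-Nikodym derivative, which is the Gaussian density
    almost everywhere. *)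
Lemma ge0_integral_normal (q : R -> R) : measurable_fun setT q -> (forall x, 0 <= q x) ->
  (\int[normal_prob 0 s]_x (q x)%:E = \int[mu]_x (q x * p x)%:E)%E.
Proof.
move=> mq q0.
have dom := @normal_prob_dominates R 0 s.
rewrite -(@Radon_Nikodym_SigmaFinite.change_of_variables _ _ _ (normal_prob 0 s) mu dom
  (EFin \o q) setT)//; last exact/measurable_EFinP.
have fint := Radon_Nikodym_SigmaFinite.f_integrable dom.
apply: ae_eq_integral => //.
- by apply: emeasurable_funM; [exact/measurable_EFinP|exact: (measurable_int _ fint)].
- by apply/measurable_EFinP; exact: measurable_funM.
- under [X in ae_eq _ _ _ X]eq_fun do rewrite EFinM.
  apply: ae_eqe_mul2l; apply: integral_ae_eq => //.
  + exact/measurable_EFinP.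
  + by move=> E _ mE; rewrite -Radon_Nikodym_SigmaFinite.f_integral.
Qed.

Lemma normal_moment6 : (\int[normal_prob 0 s]_x (x ^+ 6)%:E <= (gauss6 * s ^+ 6)%:E)%E.
Proof.
have x6 (x : R) : 0 <= x ^+ 6 by exact: pow6_ge0.
rewrite ge0_integral_normal//.
have s20 : Num.sqrt 2 * s != 0 by rewrite mulf_neq0// sqrtr_eq0 -ltNge.
have c0 : 0 <= gauss6 * s ^+ 6 by rewrite mulr_ge0 ?gauss6_ge0// exprn_ge0// ltW.
apply: (@le_trans _ _ (\int[mu]_x (gauss6 * s ^+ 6 * normal_pdf 0 (Num.sqrt 2 * s) x)%:E)%E).
  apply: ge0_le_integral => //.
  - by move=> x _; rewrite lee_fin mulr_ge0.
  - by apply/measurable_EFinP; exact: measurable_funM.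
  - apply/measurable_EFinP; apply: measurable_funM => //; exact: measurable_normal_pdf.
  - by move=> x _; rewrite lee_fin pow6_normal_pdf.
under eq_integral do rewrite EFinM.
rewrite ge0_integralZl//.
- by rewrite integral_normal_pdf// mule1.
- by apply/measurable_EFinP; exact: measurable_normal_pdf.
- by move=> x _; rewrite lee_fin normal_pdf_ge0.
Qed.

Lemma normal_moment2 : (\int[normal_prob 0 s]_x (x ^+ 2)%:E = (s ^+ 2)%:E)%E.
Proof.
by rewrite ge0_integral_normal ?integral_x2_pdf// => x; exact: sqr_ge0.
Qed.

(** The polynomial [1 + x + x^2] is nonnegative, so that the mean can be computed
    with integrals of nonnegative functions only. *)
Lemma normal_moment12 :
  (\int[normal_prob 0 s]_x (1 + x + x ^+ 2)%:E = (1 + s ^+ 2)%:E)%E.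
Proof.
rewrite ge0_integral_normal; first last.
- by move=> x; nra.
- apply: measurable_funD; first by apply: measurable_funD.
  by apply: continuous_measurable_fun; exact: exprn_continuous.
transitivity (\int[mu]_x (((p x)%:E + (x * p x)%:E) + (x ^+ 2 * p x)%:E))%E.
  by apply: eq_integral => x _; rewrite -!EFinD; congr EFin; ring.
rewrite integralD//; last by apply: integrableD.
rewrite integralD// integral_normal_pdf// integral_x_pdf integral_x2_pdf.
by rewrite adde0 -EFinD.
Qed.

End NormalMoments.

Section ProductOfIndependent.
Context {R : realType} {disp : measure_display} {Om : measurableType disp}.
Variable P : probability Om R.
Local Open Scope ereal_scope.

(** The joint law is the product of the marginal laws, so that Fubini's theorem
    factorizes the expectation of the product. *)
Lemma integral_indep_prod (X Y : Om -> R) :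
  measurable_fun setT X -> measurable_fun setT Y ->
  (forall A B : set R, measurable A -> measurable B ->
     P (X @^-1` A `&` Y @^-1` B) = P (X @^-1` A) * P (Y @^-1` B)) ->
  P.-integrable setT (EFin \o X) -> P.-integrable setT (EFin \o Y) ->
  P.-integrable setT (EFin \o (fun w => X w * Y w)%R) /\
  \int[P]_w (X w * Y w)%:E = \int[P]_w (X w)%:E * \int[P]_w (Y w)%:E.
Proof.
move=> mX mY indep iX iY.
have mXY : measurable_fun setT (fun w => (X w, Y w)) by exact: measurable_fun_pair.
pose X' : {mfun Om >-> R} := mfun_Sub (mem_set mX).
pose Y' : {mfun Om >-> R} := mfun_Sub (mem_set mY).
pose Z' : {mfun Om >-> (R * R)%type} := mfun_Sub (mem_set mXY).
pose PX := distribution P X'; pose PY := distribution P Y'.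
have prodE : forall A, measurable A -> (PX \x PY) A = distribution P Z' A.
  apply: product_measure_unique => A B mA mB.
  rewrite -[RHS]/(P (X @^-1` A) * P (Y @^-1` B)) -indep//.
have intE (f : R * R -> \bar R) : \int[distribution P Z']_z f z = \int[PX \x PY]_z f z.
  by apply: eq_measure_integral => A mA _; exact: (esym (prodE A mA)).
have mprod : measurable_fun setT (fun z : R * R => (z.1 * z.2)%:E).
  by apply/measurable_EFinP; exact: measurable_funM.
have mabs : measurable_fun setT (fun x : R => `|x|%:E).
  by apply/measurable_EFinP; exact: normr_measurable.
have absX : \int[PX]_x `|x|%:E = \int[P]_w `|X w|%:E.
  exact: (ge0_integral_distribution X' mabs).
have absY : \int[PY]_x `|x|%:E = \int[P]_w `|Y w|%:E.
  exact: (ge0_integral_distribution Y' mabs).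
have iX' : \int[P]_w `|X w|%:E < +oo by have /integrableP[_] := iX.
have iY' : \int[P]_w `|Y w|%:E < +oo by have /integrableP[_] := iY.
have intPY : PY.-integrable setT (EFin \o id).
  apply/integrableP; split; first by apply/measurable_EFinP.
  by rewrite [X in X < _]absY.
have intPX : PX.-integrable setT (EFin \o id).
  apply/integrableP; split; first by apply/measurable_EFinP.
  by rewrite [X in X < _]absX.
have iprod : (PX \x PY).-integrable setT (fun z : R * R => (z.1 * z.2)%:E).
  apply/integrable12ltyP => //=.
  under eq_integral => x _.
    under eq_integral do rewrite normrM EFinM.
    rewrite ge0_integralZl//; over.
  rewrite /= ge0_integralZr//; last by apply: integral_ge0.
  rewrite absX absY.
  by rewrite lte_mul_pinfty// ?integral_ge0// ge0_fin_numE// integral_ge0.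
have iXY : P.-integrable setT (EFin \o (fun w => X w * Y w)%R).
  apply/integrableP; split; first by apply/measurable_EFinP; exact: measurable_funM.
  have mA : measurable_fun setT (fun z : R * R => `|(z.1 * z.2)%:E|).
    exact: measurableT_comp.
  have := @ge0_integral_distribution _ _ _ _ _ P Z' _ mA (fun=> abse_ge0 _).
  rewrite intE => <-; by have /integrableP[_] := iprod.
split=> //.
have := @integral_distribution _ _ _ _ _ P Z' (fun z => (z.1 * z.2)%:E) mprod iXY.
rewrite intE => <-.
rewrite -integral12_prod_meas1//=; rewrite /fubini_F.
under eq_integral => x _.
  under eq_integral do rewrite EFinM.
  rewrite integralZl//; over.
under eq_integral do rewrite -(fineK (integrable_fin_num measurableT intPY)).
rewrite integralZr//= fineK ?(integrable_fin_num measurableT intPY)//.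
  have -> : \int[PX]_x x%:E = \int[P]_w (X w)%:E.
    exact: (@integral_distribution _ _ _ _ _ P X' EFin).
  have -> // : \int[PY]_x x%:E = \int[P]_w (Y w)%:E.
  exact: (@integral_distribution _ _ _ _ _ P Y' EFin).
Qed.

End ProductOfIndependent.

Section GaussianVector.
Context {R : realType} {d : nat} {disp : measure_display} {Om : measurableType disp}.
Variables (P : probability Om R) (X : Om -> 'rV[R]_d) (v : R).
Hypothesis iso : isotropic_gaussian P X v.
Implicit Types (i j : 'I_d) (A B : set R).
Local Open Scope ereal_scope.

Lemma isotropic_measurable i : measurable_fun setT (fun w => X w 0%R i).
Proof.
by move=> _ B mB; rewrite setTI; apply: iso.1; exists i, B.
Qed.

Let gauss_setT : gauss_var v setT = 1.
Proof.
rewrite /gauss_var; case: ifPn => _; first by rewrite diracT.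
exact: probability_setT.
Qed.

Lemma isotropic_coord i A : measurable A ->
  P ((fun w => X w 0%R i) @^-1` A) = gauss_var v A.
Proof.
move=> mA.
have := iso.2 (fun k => if k == i then A else setT).
rewrite (bigD1 i)//= eqxx big1 ?mule1; last first.
  by move=> k /negbTE ->.
move=> <-; last by move=> k; case: ifP.
congr (P _); apply/seteqP; split => w /=.
  by move=> Aw k; case: eqP => // ->.
by move=> /(_ i); rewrite eqxx.
Qed.

Lemma isotropic_pair i j A B : i != j -> measurable A -> measurable B ->
  P ((fun w => X w 0%R i) @^-1` A `&` (fun w => X w 0%R j) @^-1` B)
  = P ((fun w => X w 0%R i) @^-1` A) * P ((fun w => X w 0%R j) @^-1` B).
Proof.
move=> ij mA mB; rewrite !isotropic_coord//.
have := iso.2 (fun k => if k == i then A else if k == j then B else setT).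
have ji : (j == i) = false by rewrite eq_sym (negbTE ij).
rewrite (bigD1 i)//= eqxx (bigD1 j)/= ?ji ?eqxx//.
rewrite big1 ?mule1; last by move=> k /andP[/negbTE -> /negbTE ->].
move=> <-; last by move=> k; case: ifP => // _; case: ifP.
congr (P _); apply/seteqP; split => w /=.
  by move=> [Aw Bw] k; case: eqP => [->//|_]; case: eqP => [->|].
by move=> H; split; [have := H i; rewrite eqxx|have := H j; rewrite ji eqxx].
Qed.

(** The law of a coordinate is a Dirac mass or a normal law according to the variance,
    whence the measure [m] as a parameter. *)
Let law_integral i (f : R -> \bar R) (m : {measure set (measurableTypeR R) -> \bar R}) :
  measurable_fun setT f -> (forall x, 0 <= f x) ->
  (forall A, measurable A -> gauss_var v A = m A) ->
  \int[P]_w f (X w 0%R i) = \int[m]_x f x.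
Proof.
move=> mf f0 E.
have mXi := isotropic_measurable i.
have {}mXi : @measurable_fun _ _ Om (measurableTypeR R) setT (fun w => X w 0%R i) := mXi.
pose X' : {mfun Om >-> measurableTypeR R} :=
  @mfun_Sub _ _ Om (measurableTypeR R) _ (mem_set mXi).
rewrite -[LHS](@ge0_integral_distribution _ _ _ _ _ P X' f)//.
apply: (@eq_measure_integral _ _ _ setT m (distribution P X')) => A mA _.
exact: etrans (isotropic_coord i mA) (E A mA).
Qed.

Let normal_law A : (0 < v)%R -> gauss_var v A = normal_prob 0%R (Num.sqrt v) A.
Proof. by move=> v0; rewrite /gauss_var gt_eqF. Qed.

Let s6 : (0 <= v)%R -> (Num.sqrt v ^+ 6 = v ^+ 3)%R.
Proof. by move=> v0; rewrite -[6%N]/(2 * 3)%N exprM sqr_sqrtr. Qed.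

Lemma gaussian_moment6 i : (0 <= v)%R ->
  \int[P]_w (X w 0%R i ^+ 6)%:E <= (gauss6 * v ^+ 3)%:E.
Proof.
move=> v0.
have m6 : measurable_fun setT (fun x : R => (x ^+ 6)%:E).
  by apply/measurable_EFinP; exact: exprn_measurable.
have p6 (x : R) : 0 <= (x ^+ 6)%:E.
  by rewrite lee_fin pow6_ge0.
move: v0; rewrite le_eqVlt => /predU1P[v0|v0].
  rewrite (@law_integral i _ (@dirac _ (measurableTypeR R) 0%R R) m6 p6); last first.
    by move=> A _; rewrite /gauss_var -v0 eqxx.
  rewrite integral_dirac// diracT mul1e expr0n/= -v0 expr0n/= mulr0//.
rewrite (@law_integral i _ (normal_prob 0%R (Num.sqrt v)) m6 p6); last first.
  by move=> A _; exact: normal_law.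
rewrite -(s6 (ltW v0)); apply: normal_moment6.
by rewrite sqrtr_gt0.
Qed.

Lemma gaussian_moment2 i : (0 < v)%R -> \int[P]_w (X w 0%R i ^+ 2)%:E = v%:E.
Proof.
move=> v0.
rewrite (@law_integral i (fun x => (x ^+ 2)%:E) (normal_prob 0%R (Num.sqrt v))).
- by rewrite normal_moment2 ?sqrtr_gt0// sqr_sqrtr// ltW.
- by apply/measurable_EFinP; exact: exprn_measurable.
- by move=> x; rewrite lee_fin sqr_ge0.
- by move=> A _; exact: normal_law.
Qed.

Lemma gaussian_integrable2 i : (0 < v)%R ->
  P.-integrable setT (EFin \o (fun w => X w 0 i ^+ 2)%R).
Proof.
move=> v0; have mXi := isotropic_measurable i.
apply/integrableP; split.
  by apply/measurable_EFinP; exact: measurable_funX.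
rewrite (eq_integral (fun w => (X w 0%R i ^+ 2)%:E)) ?gaussian_moment2 ?ltry//.
by move=> w _ /=; rewrite ger0_norm// sqr_ge0.
Qed.

Lemma gaussian_integrable i : (0 < v)%R ->
  P.-integrable setT (EFin \o (fun w => X w 0%R i)).
Proof.
move=> v0; have mXi := isotropic_measurable i.
have c1 : P.-integrable setT (EFin \o cst 1%R) by exact: finite_measure_integrable_cst.
have := integrableD measurableT c1 (gaussian_integrable2 i v0).
apply: le_integrable => //; first exact/measurable_EFinP.
move=> w _ /=; rewrite lee_fin; apply: le_trans (ler_norm _).
by rewrite ler_norml; apply/andP; split; nra.
Qed.

(** Read off from the integral of [1 + x + x ^ 2]. *)
Lemma gaussian_mean i : (0 < v)%R -> \int[P]_w (X w 0%R i)%:E = 0.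
Proof.
move=> v0.
have c1 : P.-integrable setT (EFin \o cst 1%R) by exact: finite_measure_integrable_cst.
have i1 := gaussian_integrable i v0; have i2 := gaussian_integrable2 i v0.
have : \int[P]_w (1 + X w 0 i + X w 0 i ^+ 2)%:E = (1 + v)%:E.
  rewrite (@law_integral i (fun x => (1 + x + x ^+ 2)%:E) (normal_prob 0%R (Num.sqrt v))).
  - by rewrite normal_moment12 ?sqrtr_gt0// sqr_sqrtr// ltW.
  - apply/measurable_EFinP; apply: measurable_funD; last exact: exprn_measurable.
    exact: measurable_funD.
  - by move=> x; rewrite lee_fin; nra.
  - by move=> A _; exact: normal_law.
under eq_integral do rewrite !EFinD.
rewrite integralD//; last by apply: integrableD.
have p1 : \int[P]_w (1%R)%:E = 1.
  by rewrite integral_cst// mul1e; exact: probability_setT.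
rewrite integralD// gaussian_moment2// p1.
have fin := integrable_fin_num measurableT i1.
rewrite -(fineK fin) -!EFinD => -[E]; congr EFin.
by apply: (@addrI _ 1%R); apply: (@addIr _ v); rewrite addr0; exact: E.
Qed.

Lemma gaussian_cross i j : (0 < v)%R -> i != j ->
  \int[P]_w (X w 0 i * X w 0 j)%:E = 0.
Proof.
move=> v0 ij.
have [_ ->] := @integral_indep_prod _ _ _ P _ _ (isotropic_measurable i) (isotropic_measurable j)
  (fun A B => isotropic_pair ij) (gaussian_integrable i v0) (gaussian_integrable j v0).
by rewrite gaussian_mean// mul0e.
Qed.

End GaussianVector.
(** * The filtration generated by the initial value and the increments *)

Section IntegralNoMeasurability.
Context {R : realType} {disp : measure_display} {Om : measurableType disp}.
Variable m : {measure set Om -> \bar R}.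
Local Open Scope ereal_scope.
Import HBNNSimple.

(** The supremum over simple functions that defines the integral is monotone; this
    covers the integrands that are not known to be measurable. *)
Lemma ge0_le_integral_nomeas (D : set Om) (f g : Om -> \bar R) :
  (forall w, D w -> 0 <= f w) -> (forall w, D w -> f w <= g w) ->
  \int[m]_(w in D) f w <= \int[m]_(w in D) g w.
Proof.
move=> f0 fg; rewrite integral_mkcond [leRHS]integral_mkcond.
have f0' w : 0 <= (f \_ D) w by rewrite /patch; case: ifPn => //; rewrite inE => /f0.
have fg' w : (f \_ D) w <= (g \_ D) w by rewrite /patch; case: ifPn => //; rewrite inE => /fg.
rewrite ge0_integralTE// [leRHS]ge0_integralTE//; last first.
  by move=> w; exact: le_trans (f0' w) (fg' w).
apply: le_ereal_sup => _ [k kf <-]; exists k => // w.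
exact: le_trans (kf w) (fg' w).
Qed.

End IntegralNoMeasurability.

Section NullModification.
Context {R : realType} {disp : measure_display} {Om : measurableType disp}.
Variable P : probability Om R.
Local Open Scope ereal_scope.

Import HBNNSimple.

(** A simple function below [f], cut off on [N], has the same integral and lies
    below [g]. *)
Let ge0_integral_null_le (f g : Om -> \bar R) (N : set Om) :
  measurable N -> P N = 0 -> (forall w, 0 <= f w) -> (forall w, 0 <= g w) ->
  (forall w, ~ N w -> f w = g w) -> \int[P]_w f w <= \int[P]_w g w.
Proof.
move=> mN PN f0 g0 fg.
rewrite [leLHS]ge0_integralTE//; apply: ub_ereal_sup => _ [h hf <-].
pose h' := mul_nnsfun h (indic_nnsfun R (measurableC mN)).
have h'E w : h' w = (h w * \1_(~` N) w)%R by [].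
rewrite -integralT_nnsfun.
have -> : \int[P]_w (h w)%:E = \int[P]_w (h' w)%:E.
  apply: ae_eq_integral => //; [exact/measurable_EFinP|exact/measurable_EFinP|].
  exists N; split => //= w; apply: contra_notP => Nw _.
  transitivity ((h w * \1_(~` N) w)%:E)%R => //.
  by rewrite indicE mem_set// mulr1.
rewrite integralT_nnsfun [leRHS]ge0_integralTE//; apply: ereal_sup_ubound.
exists h' => // w; rewrite h'E indicE.
have [Nw|Nw] := pselect (N w).
  by rewrite memNset ?mulr0//; apply.
by rewrite mem_set// mulr1 -fg.
Qed.

(** The integral of a function does not see its values on a null set, even when
    the modified function is no longer measurable. *)
Lemma integral_null_modification (f g : Om -> \bar R) (N : set Om) :
  measurable N -> P N = 0 -> (forall w, ~ N w -> f w = g w) ->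
  \int[P]_w f w = \int[P]_w g w.
Proof.
move=> mN PN fg; rewrite integralE [RHS]integralE; congr (_ - _); apply/eqP;
  rewrite eq_le; apply/andP; split; apply: (ge0_integral_null_le mN PN) => //.
- by move=> w Nw; rewrite !funeposE fg.
- by move=> w Nw; rewrite !funeposE fg.
- by move=> w Nw; rewrite !funenegE fg.
- by move=> w Nw; rewrite !funenegE fg.
Qed.

End NullModification.

Section GeneratedMeasurability.
Context {R : realType} {disp : measure_display} {Om : measurableType disp}.
Implicit Types (G : set_system Om) (Y Z : Om -> R).

Lemma real_measurableP G Y : real_measurable <<s G>> Y <->
  @measurable_fun _ _ (g_sigma_algebraType G) R setT Y.
Proof.
split=> [mY _ B mB|mY B mB]; first by rewrite setTI; exact: mY.
by have := mY measurableT B mB; rewrite setTI.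
Qed.

Lemma real_measurableT Y : real_measurable measurable Y <-> measurable_fun setT Y.
Proof.
split=> [mY _ B mB|mY B mB]; first by rewrite setTI; exact: mY.
by have := mY measurableT B mB; rewrite setTI.
Qed.

Lemma real_measurable_cst G (c : R) : real_measurable <<s G>> (fun=> c).
Proof. by apply/real_measurableP; exact: measurable_cst. Qed.

Lemma real_measurableM G Y Z : real_measurable <<s G>> Y -> real_measurable <<s G>> Z ->
  real_measurable <<s G>> (fun w => Y w * Z w).
Proof. by move=> mY mZ; apply/real_measurableP/measurable_funM; exact/real_measurableP. Qed.

Lemma real_measurableD G Y Z : real_measurable <<s G>> Y -> real_measurable <<s G>> Z ->
  real_measurable <<s G>> (fun w => Y w + Z w).
Proof. by move=> mY mZ; apply/real_measurableP/measurable_funD; exact/real_measurableP. Qed.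

Lemma real_measurableB G Y Z : real_measurable <<s G>> Y -> real_measurable <<s G>> Z ->
  real_measurable <<s G>> (fun w => Y w - Z w).
Proof. by move=> mY mZ; apply/real_measurableP/measurable_funB; exact/real_measurableP. Qed.

Lemma real_measurable_sum G n (Y : 'I_n -> Om -> R) :
  (forall i, real_measurable <<s G>> (Y i)) ->
  real_measurable <<s G>> (fun w => \sum_(i < n) Y i w).
Proof.
by move=> mY; apply/real_measurableP/measurable_sum => i; exact/real_measurableP.
Qed.

End GeneratedMeasurability.

Section Increments.
Context {R : realType} {d : nat} {disp : measure_display} {Om : measurableType disp}.
Variables (P : probability Om R) (sigma2 : R).
Variables (x0 : Om -> 'rV[R]_d) (W : R -> Om -> 'rV[R]_d).
Hypothesis iso0 : isotropic_gaussian P x0 sigma2.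
Hypothesis wW : wiener P (filtration_of x0 W) W.
Implicit Types (s t u : R) (i j l : 'I_d) (xi : Om -> R).

Definition incr s t : Om -> 'rV[R]_d := fun w => W t w - W s w.

(** The initial value of [W] vanishes almost surely but need not be measurable;
    the filtration of [x0] and of [W - W 0] contains measurable sets only, and
    it has the same sets up to a null set. *)
Definition incr_filtration : R -> set_system Om := filtration_of x0 (incr 0).

Lemma incr_isotropic s t : 0 <= s -> s < t -> isotropic_gaussian P (incr s t) (t - s).
Proof. by move=> s0 st; have [_ _ _ /(_ s t s0 st)[]] := wW. Qed.

Lemma incr_coordE s t i w : incr s t w 0 i = W t w 0 i - W s w 0 i.
Proof. by rewrite !mxE. Qed.

Lemma incr0 s i : (fun w => incr s s w 0 i) = cst 0.
Proof. by apply/funext => w; rewrite incr_coordE subrr. Qed.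

Lemma measurable_incr s t i : 0 <= s -> s <= t ->
  measurable_fun setT (fun w => incr s t w 0 i).
Proof.
move=> s0; rewrite le_eqVlt => /predU1P[<-|st].
  by rewrite incr0; exact: measurable_cst.
exact: (isotropic_measurable (incr_isotropic s0 st)).
Qed.

Lemma incr_filtration_measurable t : incr_filtration t `<=` measurable.
Proof.
apply: smallest_sub; first exact: sigma_algebra_measurable.
move=> A [|[s /=]].
  by move=> [i [B [mB ->]]]; apply: iso0.1; exists i, B.
rewrite in_itv/= => /andP[s0 st] [i [B [mB ->]]].
by have := @measurable_incr 0 s i (lexx _) s0 measurableT B mB; rewrite setTI.
Qed.

Lemma incr_filtration_mono s t : s <= t -> incr_filtration s `<=` incr_filtration t.
Proof.
move=> st; apply: sub_sigma_algebra2; apply: setUS.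
move=> A [u /=]; rewrite in_itv/= => /andP[u0 us] Au; exists u => //=.
by rewrite in_itv/= u0 (le_trans us).
Qed.

Let W_measurable t u i : 0 <= u -> u <= t ->
  real_measurable (filtration_of x0 W t) (fun w => W u w 0 i).
Proof.
move=> u0 ut B mB; apply: sub_sigma_algebra; right.
by exists u; [rewrite /= in_itv/= u0|exists i, B].
Qed.

Lemma incr_filtration_sub t : incr_filtration t `<=` filtration_of x0 W t.
Proof.
apply: smallest_sub; first exact: smallest_sigma_algebra.
move=> A [|[s /=]].
  by move=> X0A; apply: sub_sigma_algebra; left.
rewrite in_itv/= => /andP[s0 st] [i [B [mB ->]]].
apply: (_ : real_measurable (filtration_of x0 W t) (fun w => incr 0 s w 0 i)) => //.
rewrite (_ : (fun w => _) = (fun w => W s w 0 i - W 0 w 0 i)); last first.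
  by apply/funext => w; rewrite incr_coordE.
apply: real_measurableB; first exact: W_measurable.
by apply: W_measurable => //; exact: le_trans st.
Qed.

Lemma incr_filtration_incr s u t i : 0 <= s -> s <= u -> u <= t ->
  real_measurable (incr_filtration t) (fun w => incr s u w 0 i).
Proof.
move=> s0 su ut.
rewrite (_ : (fun w => _) = (fun w => incr 0 u w 0 i - incr 0 s w 0 i)); last first.
  by apply/funext => w; rewrite !incr_coordE; ring.
have H v : 0 <= v -> v <= t -> real_measurable (incr_filtration t) (fun w => incr 0 v w 0 i).
  move=> v0 vt B mB; apply: sub_sigma_algebra; right.
  by exists v; [rewrite /= in_itv/= v0|exists i, B].
apply: real_measurableB; apply: H => //.
- exact: le_trans su.
- exact: le_trans ut.
Qed.

Lemma incr_filtration_init t i : real_measurable (incr_filtration t) (fun w => x0 w 0 i).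
Proof. by move=> B mB; apply: sub_sigma_algebra; left; exists i, B. Qed.

Lemma incr_filtration_real_measurable t xi : real_measurable (incr_filtration t) xi ->
  measurable_fun setT xi.
Proof.
by move=> mxi; apply/real_measurableT => B mB; apply: incr_filtration_measurable; exact: mxi.
Qed.

(** The sets that agree with a set of the smaller filtration off the null set where
    [W 0] does not vanish form a sigma-algebra that contains the generators. *)
Lemma filtration_modification : exists2 N, measurable N /\ P N = 0%E &
  forall t A, filtration_of x0 W t A ->
  exists2 A', incr_filtration t A' & A `&` ~` N = A' `&` ~` N.
Proof.
have [_ [N [mN PN N0]] _ _] := wW.
exists N => // t; apply: smallest_sub.
  split.
  - by exists set0; [exact: sigma_algebra0|].
  - move=> A [A' FA' AA']; exists (~` A').
      by rewrite -setTD; exact: sigma_algebraCD.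
    rewrite setTD; apply/seteqP; split=> w [Aw Nw]; split=> // A'w.
      by have : (A' `&` ~` N) w by []; rewrite -AA' => -[].
    by have : (A `&` ~` N) w by []; rewrite AA' => -[].
  - move=> A FA.
    have /choice[A' H] : forall n, exists A',
        incr_filtration t A' /\ A n `&` ~` N = A' `&` ~` N.
      by move=> n; have [A' ? ?] := FA n; exists A'.
    exists (\bigcup_n A' n).
      by apply: sigma_algebra_bigcup => n; have [] := H n.
    rewrite !setI_bigcupl; apply: eq_bigcupr => n _; by have [] := H n.
move=> A [|[s /=]].
  by move=> X0A; exists A => //; apply: sub_sigma_algebra; left.
rewrite in_itv/= => /andP[s0 st] [i [B [mB ->]]].
exists ((fun w => incr 0 s w 0 i) @^-1` B); first exact: incr_filtration_incr.
apply/seteqP; split=> w /= [Bw Nw]; split => //.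
  rewrite incr_coordE (_ : W 0 w = 0) ?mxE ?subr0//.
  by apply: contrapT => W0; apply: Nw; exact: N0.
move: Bw; rewrite incr_coordE (_ : W 0 w = 0) ?mxE ?subr0//.
by apply: contrapT => W0; apply: Nw; exact: N0.
Qed.

(** Conditional expectations with respect to the filtration of [W] are tested on
    the measurable filtration only. *)
Lemma is_cond_exp0 t (f : Om -> R) : P.-integrable setT (EFin \o f) ->
  (forall A, incr_filtration t A -> \int[P]_w (\1_A w * f w)%:E = 0)%E ->
  is_cond_exp P (filtration_of x0 W t) f (cst 0).
Proof.
move=> intf f0; split => //.
- exact: integrable0.
- exact: real_measurable_cst.
move=> A FA; rewrite [RHS]integral0.
have [N [mN PN] /(_ t A FA)[A' FA' AA']] := filtration_modification.
rewrite -(f0 A' FA') integral_mkcond.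
apply: (integral_null_modification mN PN) => w Nw.
rewrite /patch indicE; have -> : (w \in A) = (w \in A').
  apply/idP/idP; rewrite !inE => Aw.
    by have : (A `&` ~` N) w by []; rewrite AA' => -[].
  by have : (A' `&` ~` N) w by []; rewrite -AA' => -[].
by case: ifP; rewrite ?mul1r ?mul0r.
Qed.

Lemma incr_indep s t (xi Y : Om -> R) : 0 <= s -> s < t ->
  real_measurable (incr_filtration s) xi -> P.-integrable setT (EFin \o xi) ->
  real_measurable <<s events_of (incr s t)>> Y -> P.-integrable setT (EFin \o Y) ->
  P.-integrable setT (EFin \o (fun w => xi w * Y w)) /\
  (\int[P]_w (xi w * Y w)%:E = \int[P]_w (xi w)%:E * \int[P]_w (Y w)%:E)%E.
Proof.
move=> s0 st mxi ixi mY iY.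
have mY' : measurable_fun setT Y.
  exact/measurable_EFinP/(measurable_int _ iY).
apply: integral_indep_prod => //; first exact: incr_filtration_real_measurable mxi.
move=> A B mA mB; rewrite setIC muleC.
have [_ _ _ /(_ s t s0 st)[_]] := wW; apply; first exact: mY.
by apply: incr_filtration_sub; exact: mxi.
Qed.

End Increments.

(** * Increments of the Wiener process and their time integrals *)

Section ShiftedPowers.
Context {R : realType}.
Local Notation mu := (@lebesgue_measure R).

Lemma continuous_shifted_pow (s : R) n : continuous (fun q : R => (q - s) ^+ n).
Proof.
move=> x; apply: (cvg_comp (fun q => q - s) (fun y => y ^+ n)); last exact: exprn_continuous.
by apply: cvgB; [exact: cvg_id|exact: cvg_cst].
Qed.

Lemma integral_shifted_pow (s t : R) n : s < t ->
  (\int[mu]_(q in `[s, t]) ((q - s) ^+ n)%:E = ((t - s) ^+ n.+1 / n.+1%:R)%:E)%E.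
Proof.
move=> st; pose F (q : R) := (q - s) ^+ n.+1 / n.+1%:R.
have dF (x : R) : is_derive x 1 F ((x - s) ^+ n).
  have d1 : is_derive x 1 (fun q : R => q - s) 1 by apply: is_derive_eq; rewrite subr0.
  have d2 := @is_deriveX _ _ (fun q : R => q - s) n.+1 x 1 1 d1.
  have d3 := @is_deriveZ _ _ _ ((fun q : R => q - s) ^+ n.+1) n.+1%:R^-1 x 1 _ d2.
  have -> : F = n.+1%:R^-1 \*: ((fun q : R => q - s) ^+ n.+1).
    by apply/funext => q; rewrite /F mulrC/= fctE.
  apply: is_derive_eq d3 _.
  by rewrite /GRing.scale/= mulr1 mulrA mulVf ?mul1r.
have cF x : {for x, continuous F}.
  by apply/differentiable_continuous/derivable1_diffP; have [] := dF x.
rewrite (@continuous_FTC2 _ (fun q => (q - s) ^+ n) F s t st).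
- by rewrite /F subrr expr0n/= mul0r sube0.
- by apply: continuous_subspaceT => x; exact: continuous_shifted_pow.
- split.
  + by move=> x _; have [] := dF x.
  + by apply: cvg_at_right_filter; exact: cF.
  + by apply: cvg_at_left_filter; exact: cF.
- by move=> x _; rewrite derive1E; have [_] := dF x.
Qed.

End ShiftedPowers.

Section WienerIntegrals.
Context {R : realType} {d : nat} {disp : measure_display} {Om : measurableType disp}.
Variables (P : probability Om R) (sigma2 : R).
Variables (x0 : Om -> 'rV[R]_d) (W : R -> Om -> 'rV[R]_d).
Hypothesis iso0 : isotropic_gaussian P x0 sigma2.
Hypothesis wW : wiener P (filtration_of x0 W) W.
Local Notation mu := (@lebesgue_measure R).
Local Notation F0 := (incr_filtration x0 W).
Implicit Types (q u v : R) (i j l : 'I_d) (xi : Om -> R).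

Definition wpath (s : R) j : R -> Om -> R := fun q w => W q w 0 j - W s w 0 j.

(** The coordinates of [DeltaZ] are such integrals. *)
Definition area (s t : R) j : Om -> R :=
  fun w => \int[mu]_(q in `[s, t]) wpath s j q w.

Lemma wpathE s j q : wpath s j q = (fun w => incr W s q w 0 j).
Proof. by apply/funext => w; rewrite incr_coordE. Qed.

Lemma wpath0 s j w : wpath s j s w = 0.
Proof. by rewrite /wpath subrr. Qed.

Lemma wpath_continuous s t j w : 0 <= s ->
  {within `[s, t], continuous (fun q => wpath s j q w)}.
Proof.
move=> s0; have [_ _ cW _] := wW.
apply: within_continuousB; last exact: within_continuous_cst.
have /subspace_continuousP c := cW w.
have : {within `[0, +oo[, continuous (fun q => W q w 0 j)}.
  apply/subspace_continuousP => x xA.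
  exact: (cvg_comp _ _ (c x xA) (@coord_continuous _ _ _ 0 j _)).
apply: continuous_subspaceW => q /=; rewrite !in_itv/= andbT => /andP[sq _].
exact: le_trans sq.
Qed.

Lemma measurable_wpath s j q : 0 <= s -> s <= q -> measurable_fun setT (wpath s j q).
Proof. by move=> s0 sq; rewrite wpathE; exact: (measurable_incr wW). Qed.

Lemma wpath_filtration s j q t : 0 <= s -> s <= q -> q <= t ->
  real_measurable (F0 t) (wpath s j q).
Proof. by move=> s0 sq qt; rewrite wpathE; exact: incr_filtration_incr. Qed.

Lemma wpath_moment6 s j q : 0 <= s -> s <= q ->
  (\int[P]_w (wpath s j q w ^+ 6)%:E <= (gauss6 * (q - s) ^+ 3)%:E)%E.
Proof.
move=> s0; rewrite le_eqVlt => /predU1P[<-|sq].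
  rewrite integral0_eq ?lee_fin; last by move=> w _; rewrite wpath0 expr0n.
  by rewrite subrr expr0n/= mulr0.
rewrite wpathE; apply: (gaussian_moment6 (incr_isotropic wW s0 sq)).
by rewrite subr_ge0 ltW.
Qed.

Variables (s t : R).
Hypotheses (s0 : 0 <= s) (st : s < t).
Local Notation h := (t - s).

Let h0 : 0 < h. Proof. by rewrite subr_gt0. Qed.

Let inP q : q \in `[s, t] -> s <= q /\ q <= t.
Proof. by rewrite in_itv/= => /andP. Qed.

Let mpath j q : q \in `[s, t] -> measurable_fun setT (wpath s j q).
Proof. by move=> /inP[sq _]; exact: measurable_wpath. Qed.

Let cpath j w : {within `[s, t], continuous (fun q => wpath s j q w)}.
Proof. exact: wpath_continuous. Qed.

Lemma wpath_jointly_measurable j : jointly_measurable s t (wpath s j).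
Proof. by apply: path_jointly_measurable => // q; exact: mpath. Qed.

Lemma measurable_area j : measurable_fun setT (area s t j).
Proof. by apply: measurable_path_integral => // q; exact: mpath. Qed.

Lemma area_filtration j : real_measurable (F0 t) (area s t j).
Proof.
apply/real_measurableP.
apply: (@measurable_path_integral _ _ (g_sigma_algebraType _) s t st (wpath s j)) => //.
move=> q /inP[sq qt]; apply/real_measurableP.
exact: wpath_filtration.
Qed.

Lemma area_integralE j w :
  (area s t j w)%:E = (\int[mu]_(q in `[s, t]) (wpath s j q w)%:E)%E.
Proof.
by rewrite integral_path_EFin//; exact: cpath.
Qed.

(** Jensen's inequality in time, then Tonelli's theorem. *)
Lemma area_moment6 j : (\int[P]_w (area s t j w ^+ 6)%:E <= (gauss6 * h ^+ 9)%:E)%E.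
Proof.
have c6 w : {within `[s, t], continuous (fun q => wpath s j q w ^+ 6)}.
  by apply: within_continuousX; exact: cpath.
have jm : jointly_measurable s t (fun q w => wpath s j q w ^+ 6).
  by apply: measurable_funX; exact: wpath_jointly_measurable.
apply: (@le_trans _ _ (\int[P]_w ((h ^+ 5)%:E *
    \int[mu]_(q in `[s, t]) (wpath s j q w ^+ 6)%:E))%E).
  have E w : ((h ^+ 5)%:E * \int[mu]_(q in `[s, t]) (wpath s j q w ^+ 6)%:E)%E
      = (h ^+ 5 * \int[mu]_(q in `[s, t]) (wpath s j q w ^+ 6))%:E.
    by rewrite [RHS]EFinM (integral_path_EFin (@c6 w)).
  apply: ge0_le_integral => //.
  - by move=> w _; rewrite lee_fin pow6_ge0.
  - by apply/measurable_EFinP/measurable_funX; exact: measurable_area.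
  - under eq_fun do rewrite E.
    apply/measurable_EFinP; apply: measurable_funM => //.
    apply: measurable_path_integral => // q qst.
    by apply: measurable_funX; exact: mpath.
  - by move=> w _; rewrite E lee_fin; exact: path_integral_pow6.
have m6 w : (0 <= \int[mu]_(q in `[s, t]) (wpath s j q w ^+ 6)%:E)%E.
  by apply: integral_ge0 => q _; rewrite lee_fin pow6_ge0.
rewrite ge0_integralZl//; last 2 first.
- have -> : (fun w => \int[mu]_(q in `[s, t]) (wpath s j q w ^+ 6)%:E)%E =
      (fun w => (\int[mu]_(q in `[s, t]) (wpath s j q w ^+ 6))%:E).
    by apply/funext => w; exact: integral_path_EFin (@c6 w).
  apply/measurable_EFinP; apply: measurable_path_integral => // q qst.
  by apply: measurable_funX; exact: mpath.
- by rewrite lee_fin exprn_ge0// ltW.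
rewrite (tonelli_path P jm); last by move=> q w _; exact: pow6_ge0.
have le3 : (\int[mu]_(q in `[s, t]) \int[P]_w (wpath s j q w ^+ 6)%:E
    <= \int[mu]_(q in `[s, t]) (gauss6 * h ^+ 3)%:E)%E.
  apply: ge0_le_integral_nomeas => q /= qst.
    by apply: integral_ge0 => w _; rewrite lee_fin pow6_ge0.
  have [sq qt] := inP qst.
  apply: (le_trans (wpath_moment6 j s0 sq)); rewrite lee_fin ler_wpM2l ?gauss6_ge0//.
  by rewrite lerXn2r ?nnegrE ?subr_ge0 ?(ltW st)// lerD2r.
apply: (le_trans (lee_wpmul2l _ le3)); first by rewrite lee_fin exprn_ge0// ltW.
have := @integral_shifted_pow R s t 0 st; under eq_integral do rewrite expr0.
rewrite expr1 divr1 => I1.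
have -> : (\int[mu]_(q in `[s, t]) (gauss6 * h ^+ 3)%:E = (gauss6 * h ^+ 3)%:E * h%:E)%E.
  rewrite -I1 -ge0_integralZl//; first by apply: eq_integral => q _; rewrite mule1.
  by rewrite lee_fin mulr_ge0 ?gauss6_ge0// exprn_ge0// ltW.
by rewrite -!EFinM lee_fin; apply: le_of_eq; ring.
Qed.

Let Rint_pow n : \int[mu]_(q in `[s, t]) (q - s) ^+ n = h ^+ n.+1 / n.+1%:R.
Proof. by rewrite /Rintegral integral_shifted_pow. Qed.

Let cpow n : {within `[s, t], continuous (fun q => (q - s) ^+ n)}.
Proof. by apply: continuous_subspaceT => x; exact: continuous_shifted_pow. Qed.

(** [v - s] exceeds [min q v - s] by [max (v - q) 0], which integrates over
    [[q, t]] only. *)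
Lemma integral_min (q : R) : q \in `[s, t] ->
  (\int[mu]_(v in `[s, t]) (Num.min q v - s)%:E = (h * (q - s) - (q - s) ^+ 2 / 2)%:E)%E.
Proof.
move=> /inP[sq qt].
have cmax : {within `[s, t], continuous (fun v => Num.max (v - q) 0)}.
  apply: continuous_subspaceT => x; apply: (@continuous_max R R (fun v => v - q) (cst 0));
    last exact: cvg_cst.
  by apply: cvgB; [exact: cvg_id|exact: cvg_cst].
have E v : Num.min q v - s = (v - s) ^+ 1 - Num.max (v - q) 0.
  rewrite expr1; case: (leP q v) => qv.
    by rewrite max_l ?subr_ge0//; ring.
  by rewrite max_r ?subr0// subr_le0 ltW.
under eq_integral do rewrite E.
rewrite integral_path_EFin; last by apply: within_continuousB => //; exact: cpow.
rewrite RintegralB//; [|exact: integrable_path (@cpow 1)|exact: integrable_path].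
rewrite Rint_pow -(_ : (t - q) ^+ 2 / 2 = \int[mu]_(v in `[s, t]) Num.max (v - q) 0).
  by congr EFin; field.
rewrite /Rintegral.
have -> : (\int[mu]_(v in `[s, t]) (Num.max (v - q) 0)%:E
    = \int[mu]_(v in `[q, t]) ((v - q) ^+ 1)%:E)%E.
  rewrite integral_mkcond [RHS]integral_mkcond; apply: eq_integral => v _.
  rewrite /patch !mem_setE !in_itv/= expr1.
  case: (leP q v) => qv; last first.
    by rewrite max_r ?if_same// subr_le0 ltW.
  by rewrite (le_trans sq qv) max_l ?subr_ge0.
move: qt; rewrite le_eqVlt => /predU1P[->|qt].
  by rewrite set_itv1 integral_set1/= subrr expr0n/= mul0r.
by rewrite integral_shifted_pow.
Qed.

(** Products of two factors are controlled by sixth moments, because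
    [`|a b| <= a ^ 2 + b ^ 2 <= 2 + a ^ 6 + b ^ 6]. *)
Let bounded_prod (xi a b : Om -> R) (M A B : R) :
  measurable_fun setT xi -> measurable_fun setT a -> measurable_fun setT b ->
  (forall w, `|xi w| <= M) ->
  (\int[P]_w (a w ^+ 6)%:E <= A%:E)%E -> (\int[P]_w (b w ^+ 6)%:E <= B%:E)%E ->
  (\int[P]_w `|xi w * a w * b w|%:E <= (M * (2 + A + B))%:E)%E.
Proof.
move=> mxi ma mb xiM aA bB.
have M0 : 0 <= M by exact: le_trans (xiM point).
have m6 (f : Om -> R) : measurable_fun setT f -> measurable_fun setT (fun w => (f w ^+ 6)%:E).
  by move=> mf; apply/measurable_EFinP; exact: measurable_funX.
have p6 (x : R) : (0 <= (x ^+ 6)%:E)%E by rewrite lee_fin pow6_ge0.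
apply: (@le_trans _ _ (\int[P]_w (M%:E * (2%:E + (a w ^+ 6)%:E + (b w ^+ 6)%:E)))%E).
  apply: ge0_le_integral => //.
  - apply/measurable_EFinP; apply: measurableT_comp => //.
    by apply: measurable_funM => //; exact: measurable_funM.
  - apply: emeasurable_funM => //; apply: emeasurable_funD; last exact: m6.
    by apply: emeasurable_funD => //; exact: m6.
  - move=> w _; rewrite -!EFinD -EFinM lee_fin -mulrA normrM.
    apply: ler_pM => //.
    have := sqr_le_pow6 (a w); have := sqr_le_pow6 (b w).
    have : `|a w * b w| <= a w ^+ 2 + b w ^+ 2.
      by rewrite ler_norml; apply/andP; split; nra.
    move: (a w ^+ 2) (b w ^+ 2) (a w ^+ 6) (b w ^+ 6) => *; lra.
rewrite ge0_integralZl//; first last.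
- by move=> w _; rewrite !adde_ge0.
- apply: emeasurable_funD; last exact: m6.
  by apply: emeasurable_funD => //; exact: m6.
rewrite EFinM lee_wpmul2l ?lee_fin//.
rewrite ge0_integralD//; [|by move=> w _; rewrite adde_ge0|
  by apply: emeasurable_funD => //; exact: m6|exact: m6].
rewrite ge0_integralD//; last exact: m6.
have -> : (\int[P]_w (2%:E : \bar R) = 2%:E)%E.
  by rewrite integral_cst//; rewrite [X in (_ * X)%E]probability_setT mule1.
by rewrite !EFinD; apply: leeD => //; exact: leeD.
Qed.

Lemma bounded_integrable (xi : Om -> R) (M : R) :
  measurable_fun setT xi -> (forall w, `|xi w| <= M) -> P.-integrable setT (EFin \o xi).
Proof.
move=> mxi xiM.
have cM : P.-integrable setT (EFin \o cst M) by exact: finite_measure_integrable_cst.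
apply: le_integrable cM => //; first exact/measurable_EFinP.
by move=> w _ /=; rewrite lee_fin (le_trans (xiM w))// ler_norm.
Qed.

Let integrable_bounded_int (f : Om -> R) (C : R) :
  measurable_fun setT f -> (\int[P]_w `|f w|%:E <= C%:E)%E -> P.-integrable setT (EFin \o f).
Proof.
move=> mf fC; apply/integrableP; split; first exact/measurable_EFinP.
by apply: le_lt_trans fC _; rewrite ltry.
Qed.

Section BoundedFactor.
Variables (xi : Om -> R) (M : R).
Hypothesis mxi : real_measurable (F0 s) xi.
Hypothesis xiM : forall w, `|xi w| <= M.

Let mxiT : measurable_fun setT xi.
Proof. exact: (incr_filtration_real_measurable iso0 wW mxi). Qed.

Let ixi : P.-integrable setT (EFin \o xi) := bounded_integrable mxiT xiM.

Let c := fine (\int[P]_w (xi w)%:E)%E.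

Let cE : (\int[P]_w (xi w)%:E = c%:E)%E.
Proof. by rewrite /c fineK//; exact: (integrable_fin_num measurableT ixi). Qed.

Let wpath6 j q : q \in `[s, t] ->
  (\int[P]_w (wpath s j q w ^+ 6)%:E <= (gauss6 * h ^+ 3)%:E)%E.
Proof.
move=> /inP[sq qt]; apply: (le_trans (wpath_moment6 j s0 sq)).
rewrite lee_fin ler_wpM2l ?gauss6_ge0//.
by rewrite lerXn2r ?nnegrE ?subr_ge0 ?(ltW st)// lerD2r.
Qed.

Let wpath_prod_integrable j l q v : q \in `[s, t] -> v \in `[s, t] ->
  P.-integrable setT (EFin \o (fun w => xi w * wpath s j q w * wpath s l v w)).
Proof.
move=> qst vst.
have mq := @mpath j q qst; have mv := @mpath l v vst.
apply: (@integrable_bounded_int _ (M * (2 + gauss6 * h ^+ 3 + gauss6 * h ^+ 3))).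
  by apply: measurable_funM => //; exact: measurable_funM.
by apply: bounded_prod => //; exact: wpath6.
Qed.

(** Split the later value at time [q]: its last increment is centered and independent
    of the past, and the product up to time [q] is a covariance of one increment. *)
Let wpath_cross_le j l q v : q \in `[s, t] -> v \in `[s, t] -> q <= v ->
  (\int[P]_w (xi w * wpath s j q w * wpath s l v w)%:E
   = ((j == l)%:R * (q - s) * c)%:E)%E.
Proof.
move=> qst vst qv; have [sq qt] := inP qst; have [sv vt] := inP vst.
move: sq; rewrite le_eqVlt => /predU1P[<-|sq].
  rewrite integral0_eq ?subrr ?mulr0 ?mul0r//.
  by move=> w _; rewrite wpath0 mulr0 mul0r.
have mq i := @mpath i q qst.
have i1 := wpath_prod_integrable j l qst qst.
have split w : xi w * wpath s j q w * wpath s l v w =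
    xi w * wpath s j q w * wpath s l q w + xi w * wpath s j q w * wpath q l v w.
  by rewrite /wpath; ring.
have zero : P.-integrable setT (EFin \o (fun w => xi w * wpath s j q w * wpath q l v w)) /\
    (\int[P]_w (xi w * wpath s j q w * wpath q l v w)%:E = 0)%E.
  move: qv; rewrite le_eqVlt => /predU1P[<-|qv].
    rewrite (_ : (fun w => _) = cst 0); last first.
      by apply/funext => w; rewrite wpath0 mulr0.
    split; first exact: integrable0.
    by rewrite integral0_eq// => w _; rewrite wpath0 mulr0.
  have q0 : 0 <= q by exact: le_trans (ltW sq).
  have vq : 0 < v - q by rewrite subr_gt0.
  have iso := incr_isotropic wW q0 qv.
  have iV := gaussian_integrable iso l vq.
  have ixa : P.-integrable setT (EFin \o (fun w => xi w * wpath s j q w)).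
    have := @bounded_prod xi (wpath s j q) (cst 1) M (gauss6 * h ^+ 3) 1 mxiT (mq j)
      (measurable_cst _) xiM (wpath6 j qst).
    rewrite (_ : (\int[P]_w (cst 1 w ^+ 6)%:E)%E = 1%:E); last first.
      rewrite (eq_integral (cst 1%:E)); last by move=> w _; rewrite /= expr1n.
      by rewrite integral_cst//; rewrite [X in (_ * X)%E]probability_setT mule1.
    move=> /(_ (lexx _)) bnd; apply: (integrable_bounded_int _ _ ).
      exact: measurable_funM.
    by apply: le_trans bnd; apply: le_of_eq;
      apply: eq_integral => w _; rewrite /= mulr1.
  have mxa : real_measurable (F0 q) (fun w => xi w * wpath s j q w).
    apply: real_measurableM; last exact: wpath_filtration (ltW sq) _.
    by move=> B mB; apply: (@incr_filtration_mono _ _ _ _ _ _ s q (ltW sq)); exact: mxi.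
  have mV : real_measurable <<s events_of (incr W q v)>> (fun w => incr W q v w 0 l).
    by move=> B mB; apply: sub_sigma_algebra; exists l, B.
  have [ii ie] := incr_indep iso0 wW q0 qv mxa ixa mV iV.
  rewrite (wpathE q l v); split=> //.
  by rewrite ie (gaussian_mean iso)// mule0.
under eq_integral do rewrite split EFinD.
rewrite integralD//; last by case: zero.
rewrite zero.2 adde0.
have vq : 0 < q - s by rewrite subr_gt0.
have iso := incr_isotropic wW s0 sq.
have mV : real_measurable <<s events_of (incr W s q)>>
    (fun w => incr W s q w 0 j * incr W s q w 0 l).
  by apply: real_measurableM => B mB; apply: sub_sigma_algebra; [exists j, B|exists l, B].
have iV : P.-integrable setT (EFin \o (fun w => incr W s q w 0 j * incr W s q w 0 l)).
  have := wpath_prod_integrable.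
  have := @bounded_prod (cst 1) (wpath s j q) (wpath s l q) 1 _ _ (measurable_cst _)
    (mq j) (mq l) _ (wpath6 j qst) (wpath6 l qst).
  move=> bnd _; apply: (@integrable_bounded_int _ (1 * (2 + gauss6 * h ^+ 3 + gauss6 * h ^+ 3))).
    by have mj := mq j; have ml := mq l; rewrite !wpathE in mj ml; exact: measurable_funM.
  apply: le_trans (bnd _); last by move=> w; rewrite normr1.
  by apply: le_of_eq;
    apply: eq_integral => w _; rewrite /= mul1r !wpathE.
have [_ ie] := incr_indep iso0 wW s0 sq mxi ixi mV iV.
rewrite (eq_integral (fun w => (xi w * (incr W s q w 0 j * incr W s q w 0 l))%:E)); last first.
  by move=> w _; rewrite !wpathE mulrA.
rewrite ie cE.
have [<-|jl] := eqVneq j l.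
  under [X in (_ * X)%E]eq_integral do rewrite -expr2.
  by rewrite (gaussian_moment2 iso)// -EFinM mul1r mulrC.
by rewrite (gaussian_cross iso)// mule0 !mul0r.
Qed.

Lemma wpath_cross j l q v : q \in `[s, t] -> v \in `[s, t] ->
  (\int[P]_w (xi w * wpath s j q w * wpath s l v w)%:E
   = ((j == l)%:R * (Num.min q v - s) * c)%:E)%E.
Proof.
move=> qst vst; case: (leP q v) => qv; first exact: wpath_cross_le.
under eq_integral do rewrite mulrAC.
by rewrite wpath_cross_le// ?(ltW qv)// eq_sym.
Qed.

Lemma joint_of_outcome (f : Om -> R) : measurable_fun setT f ->
  measurable_fun (`[s, t] `*` [set: Om]) (fun p : R * Om => f p.2).
Proof. by move=> mf; apply: measurable_funTS; exact: measurableT_comp. Qed.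

(** Integrate the covariances [min q v - s] over [v]. *)
Let wpath_area j l q : q \in `[s, t] ->
  (\int[P]_w (xi w * wpath s j q w * area s t l w)%:E
   = ((j == l)%:R * c * (h * (q - s) - (q - s) ^+ 2 / 2))%:E)%E.
Proof.
move=> qst; have mq := @mpath j q qst.
have mxq : measurable_fun setT (fun w => xi w * wpath s j q w) by exact: measurable_funM.
have E w : ((xi w * wpath s j q w * area s t l w)%:E =
    \int[mu]_(v in `[s, t]) (xi w * wpath s j q w * wpath s l v w)%:E)%E.
  rewrite EFinM area_integralE -integralZl//; last exact: integrable_path (@cpath l w).
under eq_integral do rewrite E.
rewrite (@fubini_path _ _ _ P s t (fun v w => xi w * wpath s j q w * wpath s l v w)
  (M * (2 + gauss6 * h ^+ 3 + gauss6 * h ^+ 3))).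
- transitivity (\int[mu]_(v in `[s, t]) (((j == l)%:R * c)%:E * (Num.min q v - s)%:E))%E.
    apply: eq_integral => v; rewrite inE => vst.
    by rewrite wpath_cross// -EFinM; congr EFin; ring.
  rewrite integralZl ?integral_min// -?EFinM//.
  apply: integrable_path; apply: within_continuousB; last exact: within_continuous_cst.
  by apply: continuous_subspaceT => x; apply: (@continuous_min R R (cst q) id); [exact: cvg_cst|exact: cvg_id].
- apply: measurable_funM; last exact: wpath_jointly_measurable.
  exact: (joint_of_outcome mxq).
- move=> v vst; apply: bounded_prod => //; [exact: mpath|exact: wpath6|exact: wpath6].
Qed.

(** Conditionally on the past, the covariance matrix of the area increments is
    [h ^ 3 / 3] times the identity. *)
Lemma area_cross j l :
  P.-integrable setT (EFin \o (fun w => xi w * area s t j w * area s t l w)) /\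
  (\int[P]_w (xi w * area s t j w * area s t l w)%:E
   = ((j == l)%:R * (h ^+ 3 / 3) * c)%:E)%E.
Proof.
have ma := measurable_area j; have ml := measurable_area l.
split.
  apply: (@integrable_bounded_int _ (M * (2 + gauss6 * h ^+ 9 + gauss6 * h ^+ 9))).
    by apply: measurable_funM => //; exact: measurable_funM.
  by apply: bounded_prod => //; exact: area_moment6.
have E w : ((xi w * area s t j w * area s t l w)%:E =
    \int[mu]_(q in `[s, t]) (xi w * area s t l w * wpath s j q w)%:E)%E.
  rewrite mulrAC EFinM area_integralE -integralZl//; last exact: integrable_path (@cpath j w).
under eq_integral do rewrite E.
have mxl : measurable_fun setT (fun w => xi w * area s t l w) by exact: measurable_funM.
rewrite (@fubini_path _ _ _ P s t (fun q w => xi w * area s t l w * wpath s j q w)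
  (M * (2 + gauss6 * h ^+ 9 + gauss6 * h ^+ 3))); first last.
- move=> q qst; apply: bounded_prod => //; [exact: mpath|exact: area_moment6|exact: wpath6].
- apply: measurable_funM; last exact: wpath_jointly_measurable.
  exact: (joint_of_outcome mxl).
transitivity (\int[mu]_(q in `[s, t])
    (((j == l)%:R * c)%:E * (h * (q - s) ^+ 1 - 2^-1 * (q - s) ^+ 2)%:E))%E.
  apply: eq_integral => q; rewrite inE => qst.
  under eq_integral do rewrite mulrAC.
  by rewrite wpath_area// -EFinM expr1; congr EFin; congr (_ * _); ring.
have c1 : {within `[s, t], continuous (fun q => h * (q - s) ^+ 1)}.
  by apply: (within_continuousM (@within_continuous_cst R _ h)); exact: cpow.
have c2 : {within `[s, t], continuous (fun q => 2^-1 * (q - s) ^+ 2)}.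
  by apply: (within_continuousM (@within_continuous_cst R _ 2^-1)); exact: cpow.
have c12 := within_continuousB c1 c2.
rewrite integralZl//; last exact: (integrable_path c12).
rewrite integral_path_EFin// RintegralB//; [|exact: integrable_path c1|exact: integrable_path c2].
rewrite !RintegralZl//; [|exact: integrable_path (@cpow 2)|exact: integrable_path (@cpow 1)].
by rewrite !Rint_pow -EFinM; congr EFin; field.
Qed.

End BoundedFactor.

End WienerIntegrals.

(** * Explicit iterated integrals *)

Lemma integral_cst_itv {R : realType} (a b k : R) : a < b ->
  (\int[@lebesgue_measure R]_(_ in `[a, b]) k%:E = (k * (b - a))%:E)%E.
Proof.
move=> ab; rewrite -Rintegral_cst_itv ?ltW// integral_path_EFin//.
exact: within_continuous_cst.
Qed.

Section IteratedIntegrals.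
Context {R : realType} {d : nat} {disp : measure_display} {Om : measurableType disp}.
Variables (P : probability Om R) (sigma2 : R).
Variables (x0 : Om -> 'rV[R]_d) (W : R -> Om -> 'rV[R]_d).
Hypothesis iso0 : isotropic_gaussian P x0 sigma2.
Hypothesis wW : wiener P (filtration_of x0 W) W.
Local Notation mu := (@lebesgue_measure R).
Local Notation F0 := (incr_filtration x0 W).
Local Notation F := (filtration_of x0 W).
Variables (s t : R).
Hypotheses (s0 : 0 <= s) (st : s < t).
Implicit Types (q : R) (j : 'I_d).
Local Notation h := (t - s).

Let h0 : 0 < h. Proof. by rewrite subr_gt0. Qed.

Let inP q : q \in `[s, t] -> s <= q /\ q <= t.
Proof. by rewrite in_itv/= => /andP. Qed.

Let cpath j w : {within `[s, t], continuous (fun q => wpath W s j q w)}.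
Proof. exact: (wpath_continuous wW). Qed.

Let mpath j q : q \in `[s, t] -> measurable_fun setT (wpath W s j q).
Proof. by move=> /inP[sq _]; exact: (measurable_wpath wW). Qed.

Lemma cvg_in_prob_eq (X : nat -> Om -> R) (Y : Om -> R) :
  (forall n w, X n w = Y w) -> cvg_in_prob P X Y.
Proof.
move=> XY e e0; rewrite (_ : (fun n => _) = cst 0%E); first exact: cvg_cst.
apply/funext => n; rewrite (_ : [set w | _] = set0) ?measure0//.
by apply/seteqP; split=> w //=; rewrite XY subrr normr0 leNgt e0.
Qed.

Lemma joint_of_time (f : R -> R) : measurable_fun setT f ->
  measurable_fun (`[s, t] `*` [set: Om]) (fun p : R * Om => f p.1).
Proof. by move=> mf; apply: measurable_funTS; exact: measurableT_comp. Qed.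

(** The process equal to [U] on one interval is simple and reproduces the integrand
    at all times but [s]. *)
Lemma ito_integral_cst j (U : Om -> R) (M : R) : real_measurable (F0 s) U ->
  (forall w, `|U w| <= M) ->
  is_ito_integral P F (fun q w => W q w 0 j) s t (fun _ w => U w)
    (fun q w => U w * wpath W s j q w).
Proof.
move=> mU UM; have mUT := incr_filtration_real_measurable iso0 wW mU.
split.
- exact: joint_of_outcome.
- by move=> r rst; apply: measurable_funM => //; exact: mpath.
pose S := @SimpleProcess R _ Om 1 (fun i => if i is 0%N then s else t) (fun _ => U).
exists (fun _ => S); split.
- move=> _; split => //=.
  + by case=> // _; exact: ltW.
  + by case=> // _ B mB; apply: incr_filtration_sub => //; exact: mU.
  + by exists M.
- move=> e e0; rewrite (_ : (fun n => _) = cst 0%E); first exact: cvg_cst.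
  apply/funext => n; rewrite (_ : [set w | _] = set0) ?measure0//.
  apply/seteqP; split=> w //=.
  rewrite -integral_itv_obnd_cbnd; last first.
    apply/measurable_EFinP; apply: measurable_funX; apply: measurable_funB => //.
    by rewrite /sp_val; apply: measurable_sum => i; exact: measurable_funM.
  rewrite integral0_eq; first by rewrite lee_fin leNgt e0.
  move=> r /= rst; rewrite /sp_val/= big_ord1/= indicE mem_set// mulr1 subrr.
  by rewrite expr0n.
- move=> r rst; have [sr rt] := inP rst; apply: cvg_in_prob_eq => _ w.
  by rewrite /sp_int/= big_ord1/= min_r// min_l.
Qed.

Let stopped_continuous j r w : r \in `[s, t] ->
  {within `[s, t], continuous (fun q => wpath W s j (Num.min q r) w)}.
Proof.
move=> /inP[sr rt]; apply/subspace_continuousP => x /inP[sx xt].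
have /subspace_continuousP/(_ (Num.min x r)) := @cpath j w.
have xr : `[s, t]%classic (Num.min x r).
  by rewrite /= in_itv/= le_min sx sr ge_min xt.
move=> /(_ xr) => + U => /[apply] nU.
have cmin : {for x, continuous (fun q => Num.min q r)}.
  by apply: (@continuous_min R R id (cst r)); [exact: cvg_id|exact: cvg_cst].
have {}nU : \forall y \near nbhs (Num.min x r), `[s, t]%classic y -> U (wpath W s j y w) := nU.
change (\forall q \near nbhs x, `[s, t]%classic q -> U (wpath W s j (Num.min q r) w)).
have : nbhs x ((fun q => Num.min q r) @^-1` [set y | `[s, t]%classic y -> U (wpath W s j y w)]).
  exact: (cmin _ nU).
apply: filterS => q /= H qst; apply: H.
by have [sq qt] := inP qst; rewrite in_itv/= le_min sq sr ge_min qt.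
Qed.

(** Stochastic integration by parts for a linear integrand: the integral of
    [c (q - s)] over [[s, r]], with the correction term written as an integral
    over the whole of [[s, t]] of the path stopped at [r]. *)
Definition linear_ito c j : R -> Om -> R := fun r w =>
  c * (h * wpath W s j r w - \int[mu]_(q in `[s, t]) wpath W s j (Num.min q r) w).

Lemma linear_itoE c j w : linear_ito c j t w =
  c * (h * wpath W s j t w - area W s t j w).
Proof.
rewrite /linear_ito; congr (_ * (_ - _)); apply: eq_Rintegral => q.
by rewrite inE => /inP[_ qt]; rewrite min_l.
Qed.

Let abel n (p b : nat -> R) : b 0%N = 0 ->
  \sum_(i < n) p i * (b i.+1 - b i) = p n * b n - \sum_(i < n) b i.+1 * (p i.+1 - p i).
Proof.
move=> b0; elim: n => [|n IHn]; first by rewrite !big_ord0 b0 mulr0 subr0.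
by rewrite !big_ord_recr/= IHn; ring.
Qed.

(** Left-endpoint values approximate the integrand uniformly. Summation by parts turns
    their simple integrals into Riemann sums of the path stopped at [r], which converge
    for every outcome. *)
Lemma ito_integral_linear j c :
  is_ito_integral P F (fun q w => W q w 0 j) s t (fun q _ => c * (q - s)) (linear_ito c j).
Proof.
have mlin : measurable_fun setT (fun q : R => c * (q - s)).
  apply: measurable_funM => //; exact: measurable_funB.
have mstop r q : r \in `[s, t] -> q \in `[s, t] ->
    measurable_fun setT (wpath W s j (Num.min q r)).
  move=> /inP[sr rt] /inP[sq qt]; apply: mpath.
  by rewrite in_itv/= le_min sq sr ge_min qt.
have mY r : r \in `[s, t] -> measurable_fun setT (linear_ito c j r).
  move=> rst; apply: measurable_funM => //; apply: measurable_funB.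
    by apply: measurable_funM => //; exact: mpath.
  apply: (@measurable_path_integral _ _ _ s t st (fun q w => wpath W s j (Num.min q r) w)).
    by move=> q qst; exact: mstop.
  by move=> w; exact: stopped_continuous.
(* The index is truncated, because the values of a simple process are bounded over
   all the indices. *)
pose S n := @SimpleProcess R _ Om n.+1 (pt s t n)
  (fun i _ => c * (pt s t n (minn i n.+1) - s)).
have spE n r w : sp_val (S n) r w = stepfun s t n (fun i => c * (pt s t n i - s)) r.
  apply: eq_bigr => i _; congr (_ * (_ - _) * _).
  by rewrite /= (minn_idPl _)// ltnW.
split => //.
  exact: (joint_of_time mlin).
exists S; split.
- move=> n; split => /=.
  + exact: pt0.
  + exact: pt_last.
  + by move=> i _; exact: pt_le.
  + by move=> i _; exact: real_measurable_cst.
  + exists (`|c| * h) => i _; rewrite normrM ler_wpM2l//.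
    have /inP[si it] := @pt_in R s t st n (minn i n.+1) (geq_minr _ _).
    by rewrite ger0_norm ?subr_ge0// lerD2r.
- move=> e e0.
  have m0 : (fun n => (c * ((t - s) / n.+1%:R)) ^+ 2 * h) @ \oo --> (0 : R).
    have -> : (0 : R) = (c * 0) ^+ 2 * h by rewrite mulr0 expr0n/= mul0r.
    apply: cvgM; last exact: cvg_cst.
    apply: (cvg_comp (fun n => c * ((t - s) / n.+1%:R)) (fun y => y ^+ 2));
      last exact: exprn_continuous.
    by apply: cvgM; [exact: cvg_cst|exact: mesh_cvg0].
  have /cvgrPdist_lt/(_ _ e0) := m0.
  move=> H; apply: (cvg_trans _ (@cvg_cst _ (0%E : \bar R) _ \oo _)).
  apply: near_eq_cvg; apply: filterS H => n; rewrite sub0r normrN => He.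
  rewrite (_ : [set w | _] = set0) ?measure0//.
  apply/seteqP; split=> w //=; apply/negP; rewrite -ltNge.
  apply: (@le_lt_trans _ _ (\int[mu]_(r in `[s, t]) ((c * ((t - s) / n.+1%:R)) ^+ 2)%:E)%E).
    apply: ge0_le_integral_nomeas => r /= rst; first by rewrite lee_fin sqr_ge0.
    rewrite lee_fin spE; have [sr rt] := inP rst.
    have mesh0 : 0 < (t - s) / n.+1%:R by rewrite divr_gt0// subr_gt0.
    move: sr; rewrite le_eqVlt => /predU1P[<-|sr].
      by rewrite stepfun0// subrr mulr0 subr0 expr0n sqr_ge0.
    have srt : s < r <= t by rewrite sr.
    have [i [_ /andP[ir ri] ->]] := stepfun_eval st n srt.
    rewrite -mulrBr [leLHS]exprMn [leRHS]exprMn ler_wpM2l ?sqr_ge0//.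
    rewrite -[leLHS]real_normK ?num_real// lerXn2r ?nnegrE ?(ltW mesh0)//.
    rewrite ler_norml; move: ri; rewrite ptS.
    by move: ir mesh0; move: ((t - s) / n.+1%:R) (pt s t n i) => y z *; apply/andP; split; lra.
  by rewrite integral_cst_itv// lte_fin (le_lt_trans (ler_norm _)).
- move=> r rst; apply: cvg_cvg_in_prob.
  + move=> n; apply: measurable_sum => i; apply: measurable_funM; first exact: measurable_cst.
    have mB k : (k <= n.+1)%N -> measurable_fun setT (fun w : Om => wpath W s j (Num.min (pt s t n k) r) w).
      by move=> kn; rewrite (_ : (fun w => _) = wpath W s j (Num.min (pt s t n k) r))//;
        apply: mstop => //; exact: pt_in.
    rewrite (_ : (fun w => _) = (fun w => wpath W s j (Num.min (pt s t n i.+1) r) w -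
        wpath W s j (Num.min (pt s t n i) r) w)).
      by apply: measurable_funB; apply: mB => //; exact: ltnW.
    by apply/funext => w; rewrite /wpath/=; ring.
  + exact: mY.
  move=> w; have [sr rt] := inP rst.
  pose b n i := wpath W s j (Num.min (pt s t n i) r) w.
  have E n : sp_int (S n) (fun q w => W q w 0 j) r w =
      c * (h * wpath W s j r w - \sum_(i < n.+1) b n i.+1 * ((t - s) / n.+1%:R)).
    transitivity (c * \sum_(i < n.+1) (pt s t n i - s) * (b n i.+1 - b n i)).
      rewrite mulr_sumr; apply: eq_bigr => i _.
      by rewrite /= (minn_idPl _) 1?ltnW// /b /wpath; ring.
    rewrite (abel _ (fun i => pt s t n i - s)); last by rewrite /b pt0 min_l// wpath0.
    rewrite pt_last /b pt_last min_r//; congr (_ * (_ - _)).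
    by apply: eq_bigr => i _; rewrite ptS; congr (_ * _); ring.
  rewrite (_ : (fun n => _) = (fun n =>
      c * (h * wpath W s j r w - \sum_(i < n.+1) b n i.+1 * ((t - s) / n.+1%:R)))).
    apply: cvgM; first exact: cvg_cst.
    apply: cvgB; first exact: cvg_cst.
    exact: (@riemann_sum _ s t st (fun q => wpath W s j (Num.min q r) w)
      (@stopped_continuous j r w rst)).
  by apply/funext.
Qed.

Lemma time_integral_path (H : R -> Om -> R) :
  (forall q, q \in `[s, t] -> measurable_fun setT (H q)) ->
  (forall w, {within `[s, t], continuous (fun q => H q w)}) ->
  is_time_integral P s t H (fun r w => \int[mu]_(q in `[s, r]) H q w).
Proof.
move=> mH cH; split; first exact: path_jointly_measurable.
move=> r /inP[sr rt]; apply: aeW => w; split => //.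
have := @integrable_path_sub R s t (fun q => H q w) r _ (@cH w).
rewrite sr; exact.
Qed.

Lemma time_integral_cst (U : Om -> R) : measurable_fun setT U ->
  is_time_integral P s t (fun _ w => U w) (fun q w => U w * (q - s)).
Proof.
move=> mU; have [jm H] := @time_integral_path (fun _ w => U w) (fun _ _ => mU)
  (fun w => @within_continuous_cst R _ (U w)).
split=> // r rst; have [sr _] := inP rst; have [N [mN PN N0]] := H r rst.
exists N; split=> // w /= Hw; apply: N0 => /= -[? E]; apply: Hw; split => //.
by rewrite Rintegral_cst_itv.
Qed.

Local Notation it_int a U J :=
  (exists2 Y, is_iterated P F W s t (fun _ => U) a Y & J = Y t).

(** This serves the words whose coefficient vanishes. *)
Lemma iterated_zero (a : multi_index d) : it_int a (cst 0) (cst 0).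
Proof.
exists (fun _ => cst 0) => //; elim/last_ind: a => [|a [r|] IHa].
- exact: IteratedNil.
- apply: IteratedWiener IHa _.
  have := @ito_integral_cst r (cst 0) 0.
  rewrite (_ : (fun q w => cst 0 w * _) = (fun _ => cst 0)); last first.
    by apply/funext => q; apply/funext => w; rewrite mul0r.
  apply; last by move=> w; rewrite normr0.
  exact: real_measurable_cst.
- apply: IteratedTime IHa _.
  have := @time_integral_cst (cst 0).
  rewrite (_ : (fun q w => cst 0 w * _) = (fun _ => cst 0)); last first.
    by apply/funext => q; apply/funext => w; rewrite mul0r.
  by apply.
Qed.

Lemma iterated_time (U : Om -> R) : measurable_fun setT U ->
  it_int [:: None] U (fun w => U w * h).
Proof.
move=> mU; exists (fun q w => U w * (q - s)) => //.
by rewrite -[[:: None]]/(rcons [::] None); apply: IteratedTime (time_integral_cst mU);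
  exact: IteratedNil.
Qed.

Lemma iterated_wiener j (U : Om -> R) (M : R) : real_measurable (F0 s) U ->
  (forall w, `|U w| <= M) ->
  it_int [:: Some j] U (fun w => U w * wpath W s j t w).
Proof.
move=> mU UM; exists (fun q w => U w * wpath W s j q w) => //.
by rewrite -[[:: Some j]]/(rcons [::] (Some j));
  apply: IteratedWiener (ito_integral_cst j mU UM); exact: IteratedNil.
Qed.

Lemma iterated_time_time (U : Om -> R) : measurable_fun setT U ->
  it_int [:: None; None] U (fun w => U w * (h ^+ 2 / 2)).
Proof.
move=> mU; pose H q w := U w * (q - s).
have cH w : {within `[s, t], continuous (fun q => H q w)}.
  apply: (within_continuousM (@within_continuous_cst R _ (U w))).
  by apply: within_continuousB; [exact: within_continuous_id|exact: within_continuous_cst].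
exists (fun r w => \int[mu]_(q in `[s, r]) H q w).
  rewrite -[[:: None; None]]/(rcons [:: None] None).
  apply: (@IteratedTime _ _ _ _ _ _ _ _ _ _ _ H).
    rewrite -[[:: None]]/(rcons [::] None); apply: IteratedTime (time_integral_cst mU).
    exact: IteratedNil.
  by apply: time_integral_path => // q _; exact: measurable_funM.
apply/funext => w; rewrite RintegralZl//.
  congr (_ * _); have := @integral_shifted_pow R s t 1 st.
  by move=> /(congr1 fine)/esym.
apply: (@integrable_path R s t (fun q => (q - s) ^+ 1)).
by apply: continuous_subspaceT => x; exact: continuous_shifted_pow.
Qed.

Lemma iterated_wiener_time j (U : Om -> R) (M : R) : real_measurable (F0 s) U ->
  (forall w, `|U w| <= M) ->
  it_int [:: Some j; None] U (fun w => U w * area W s t j w).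
Proof.
move=> mU UM; have mUT := incr_filtration_real_measurable iso0 wW mU.
pose H q w := U w * wpath W s j q w.
have cH w : {within `[s, t], continuous (fun q => H q w)}.
  exact: (within_continuousM (@within_continuous_cst R _ (U w)) (@cpath j w)).
exists (fun r w => \int[mu]_(q in `[s, r]) H q w).
  rewrite -[[:: Some j; None]]/(rcons [:: Some j] None).
  apply: (@IteratedTime _ _ _ _ _ _ _ _ _ _ _ H).
    rewrite -[[:: Some j]]/(rcons [::] (Some j)); apply: IteratedWiener (ito_integral_cst j mU UM).
    exact: IteratedNil.
  by apply: time_integral_path => // q qst; apply: measurable_funM => //; exact: mpath.
by apply/funext => w; rewrite RintegralZl//; exact: integrable_path (@cpath j w).
Qed.

Lemma iterated_time_wiener j (c : R) :
  it_int [:: None; Some j] (cst c) (fun w => c * (h * wpath W s j t w - area W s t j w)).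
Proof.
exists (linear_ito c j); last by apply/funext => w; rewrite linear_itoE.
rewrite -[[:: None; Some j]]/(rcons [:: None] (Some j)).
apply: IteratedWiener (ito_integral_linear j c).
rewrite -[[:: None]]/(rcons [::] None).
by apply: IteratedTime (time_integral_cst (measurable_cst c)); exact: IteratedNil.
Qed.

End IteratedIntegrals.

(** * Inequalities between sixth moments *)

Section SixthMoments.
Context {R : realType} {d : nat} {disp : measure_display} {Om : measurableType disp}.
Variable P : probability Om R.
Implicit Types (A B Z : Om -> R) (X : Om -> 'rV[R]_d).

(** Jensen's inequality for the uniform weights. *)
Lemma sum_pow6 (n : nat) (y : 'I_n -> R) :
  (\sum_(i < n) y i) ^+ 6 <= n%:R ^+ 5 * \sum_(i < n) y i ^+ 6.
Proof.
case: n y => [|n] y; first by rewrite !big_ord0 expr0n/= mulr0.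
set s := \sum_(i < n.+1) y i; have n0 : (n.+1%:R : R) != 0 by rewrite pnatr_eq0.
pose m := s / n.+1%:R.
have : \sum_(i < n.+1) (6 * m ^+ 5 * y i - 5 * m ^+ 6) <= \sum_(i < n.+1) y i ^+ 6.
  by apply: ler_sum => i _; exact: pow6_tangent.
rewrite sumrB -mulr_sumr -/s sumr_const card_ord -mulr_natl.
rewrite (_ : s = m * n.+1%:R); last by rewrite /m divfK.
move: (\sum_(i < n.+1) y i ^+ 6) => S6 le6.
rewrite (_ : _ ^+ 6 = n.+1%:R ^+ 5 * (n.+1%:R * m ^+ 6)); last by ring.
rewrite ler_wpM2l ?exprn_ge0//; apply: le_trans le6.
by apply: le_of_eq; ring.
Qed.

Lemma convex_pow6 (p q a b : R) : 0 <= p -> 0 <= q ->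
  (p * a + q * b) ^+ 6 <= (p + q) ^+ 5 * (p * a ^+ 6 + q * b ^+ 6).
Proof.
move=> p0 q0; have [pq0|pq0] := eqVneq (p + q) 0.
  have [-> ->] : p = 0 /\ q = 0 by split; lra.
  by rewrite !mul0r addr0 expr0n/= mulr0.
pose m := (p * a + q * b) / (p + q).
have ta := ler_wpM2l p0 (pow6_tangent m a).
have tb := ler_wpM2l q0 (pow6_tangent m b).
have E : p * a + q * b = m * (p + q) by rewrite /m divfK.
clearbody m.
rewrite E exprMn [leLHS](_ : _ = (p + q) ^+ 5 * ((p + q) * m ^+ 6)); last by ring.
rewrite ler_wpM2l ?exprn_ge0 ?addr_ge0//; apply: le_trans (lerD ta tb).
rewrite [leRHS](_ : _ = 6 * m ^+ 5 * (p * a + q * b) - 5 * (p + q) * m ^+ 6); last by ring.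
by rewrite E; apply: le_of_eq; ring.
Qed.

Let m6 (A : Om -> R) : measurable_fun setT A -> measurable_fun setT (fun w => (A w ^+ 6)%:E).
Proof. by move=> mA; apply/measurable_EFinP; exact: measurable_funX. Qed.

(** Convexity keeps the bound linear in [a] and [b]; when [p] is [1 + O(h)] and [q] is
    [O(h)], it can be iterated over all the steps. *)
Lemma moment6_comb A B Z (p q a b : R) : 0 <= p -> 0 <= q ->
  measurable_fun setT A -> measurable_fun setT B ->
  (forall w, `|Z w| <= p * A w + q * B w) ->
  (\int[P]_w (A w ^+ 6)%:E <= a%:E)%E -> (\int[P]_w (B w ^+ 6)%:E <= b%:E)%E ->
  (\int[P]_w (Z w ^+ 6)%:E <= ((p + q) ^+ 5 * (p * a + q * b))%:E)%E.
Proof.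
move=> p0 q0 mA mB Zle Aa Bb.
have pq0 : 0 <= (p + q) ^+ 5 by rewrite exprn_ge0// addr_ge0.
have A6 w : (0 <= (A w ^+ 6)%:E)%E by rewrite lee_fin pow6_ge0.
have B6 w : (0 <= (B w ^+ 6)%:E)%E by rewrite lee_fin pow6_ge0.
apply: (@le_trans _ _ (\int[P]_w (((p + q) ^+ 5)%:E *
    (p%:E * (A w ^+ 6)%:E + q%:E * (B w ^+ 6)%:E)))%E).
  apply: ge0_le_integral_nomeas => w _; first by rewrite lee_fin pow6_ge0.
  rewrite -[(p%:E * _)%E]EFinM -[(q%:E * _)%E]EFinM -EFinD -EFinM lee_fin; apply: le_trans (convex_pow6 _ _ p0 q0).
  have Z6 : Z w ^+ 6 = `|Z w| ^+ 6 by rewrite -normrX ger0_norm// pow6_ge0.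
  by rewrite Z6 lerXn2r ?nnegrE// (le_trans _ (Zle w)).
have mpA : measurable_fun setT (fun w => p%:E * (A w ^+ 6)%:E)%E.
  by apply: emeasurable_funM => //; exact: m6.
have mqB : measurable_fun setT (fun w => q%:E * (B w ^+ 6)%:E)%E.
  by apply: emeasurable_funM => //; exact: m6.
have pA0 w : (0 <= p%:E * (A w ^+ 6)%:E)%E by rewrite mule_ge0// lee_fin.
have qB0 w : (0 <= q%:E * (B w ^+ 6)%:E)%E by rewrite mule_ge0// lee_fin.
rewrite ge0_integralZl//; first last.
- by move=> w _; rewrite adde_ge0.
- exact: emeasurable_funD.
rewrite [leRHS]EFinM lee_wpmul2l ?lee_fin// ge0_integralD//.
rewrite ge0_integralZl//; last exact: m6.
rewrite ge0_integralZl//; last exact: m6.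
by rewrite EFinD !EFinM leeD// lee_wpmul2l ?lee_fin.
Qed.

Lemma moment6_scale A (c a : R) : measurable_fun setT A ->
  (\int[P]_w (A w ^+ 6)%:E <= a%:E)%E ->
  (\int[P]_w ((c * A w) ^+ 6)%:E <= (c ^+ 6 * a)%:E)%E.
Proof.
move=> mA Aa; have c6 : 0 <= c ^+ 6 by exact: pow6_ge0.
under eq_integral do rewrite exprMn EFinM.
rewrite ge0_integralZl//; last 2 first.
- exact: m6.
- by move=> w _; rewrite lee_fin pow6_ge0.
by rewrite [leRHS]EFinM lee_wpmul2l ?lee_fin.
Qed.

Lemma moment6_cst (c : R) : (\int[P]_w (c ^+ 6)%:E <= (c ^+ 6)%:E)%E.
Proof. by rewrite integral_cst//; rewrite [X in (_ * X)%E]probability_setT mule1. Qed.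

Lemma measurable_n1 X : (forall i, measurable_fun setT (fun w => X w 0 i)) ->
  measurable_fun setT (fun w => n1 (X w)).
Proof. by move=> mX; apply: measurable_sum => i; exact: measurableT_comp. Qed.

Lemma moment6_n1 X (a : R) : (forall i, measurable_fun setT (fun w => X w 0 i)) ->
  (forall i, (\int[P]_w (X w 0%R i ^+ 6)%:E <= a%:E)%E) ->
  (\int[P]_w (n1 (X w) ^+ 6)%:E <= (d%:R ^+ 6 * a)%:E)%E.
Proof.
move=> mX Xa.
apply: (@le_trans _ _ (\int[P]_w ((d%:R ^+ 5)%:E * \sum_(i < d) (X w 0%R i ^+ 6)%:E))%E).
  apply: ge0_le_integral_nomeas => w _; first by rewrite lee_fin pow6_ge0.
  rewrite sumEFin -EFinM lee_fin; apply: (le_trans (sum_pow6 _)).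
  rewrite ler_wpM2l ?exprn_ge0//; apply: ler_sum => i _.
  by rewrite -normrX ger0_norm// pow6_ge0.
have X6 i w : (0 <= (X w 0%R i ^+ 6)%:E)%E by rewrite lee_fin pow6_ge0.
rewrite ge0_integralZl//; first last.
- by move=> w _; apply: sume_ge0.
- by apply: emeasurable_sum => i; exact: m6.
rewrite ge0_integral_sum//; last by move=> i; exact: m6.
rewrite (_ : d%:R ^+ 6 * a = d%:R ^+ 5 * \sum_(i < d) a).
  by rewrite [leRHS]EFinM lee_wpmul2l ?lee_fin ?exprn_ge0// -sumEFin lee_sum.
by rewrite sumr_const card_ord -[a *+ d]mulr_natl mulrA -exprSr.
Qed.

End SixthMoments.

(** * Measurability and moments of the scheme *)

(** The real inequality behind [centered_step]: [U], [b], [z] and [X] are the sizes of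
    the centered scheme, of the Wiener process, of [DeltaZ / h] and of the scheme, and
    [A1], [A2], [q1], [q2] those of the two drift values and of their arguments. *)
Lemma growth_step {R : realFieldType} (D M h T U b z X A1 A2 q1 q2 : R) :
  0 <= D -> 0 <= M -> 0 < h -> h <= T ->
  0 <= U -> 0 <= b -> 0 <= z -> 0 <= X -> X <= U + M * b ->
  q1 <= X + 2^-1 * h * (D * (1 + X)) ->
  q2 <= X + 2^-1 * h * (D * (1 + X)) + 3 / 2 * (M * z) ->
  A1 <= D * (1 + q1) -> A2 <= D * (1 + q2) ->
  U + 3^-1 * h * A1 + 2 / 3 * h * A2 + M * h * b + M * h * z
  <= (1 + (D * (2 + T * D) * (1 + M) + 2 * D * M + M) * h) * U
     + (D * (2 + T * D) * (1 + M) + 2 * D * M + M) * h * (1 + (b + z)).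
Proof.
move=> D0 M0 h0 hT U0 b0 z0 X0 XU q1le q2le A1le A2le.
have T0 : 0 < T by exact: lt_le_trans hT.
have hDX : 2^-1 * h * (D * (1 + X)) <= T * D * (1 + X).
  rewrite mulrA ler_wpM2r ?addr_ge0// ler_wpM2r//; lra.
pose V := D * ((1 + T * D) * (1 + X) + 2 * (M * z)).
have Mz : 0 <= M * z by exact: mulr_ge0.
have A1V : A1 <= V by apply: (le_trans A1le); rewrite /V ler_wpM2l//; lra.
have A2V : A2 <= V by apply: (le_trans A2le); rewrite /V ler_wpM2l//; lra.
have TD : 0 <= T * D by rewrite mulr_ge0// ltW.
have X1 : 1 + X <= (1 + M) * (1 + U + b).
  have : 0 <= M * (1 + U) by rewrite mulr_ge0 ?addr_ge0.
  rewrite mulrDl mul1r [M * (_ + b)]mulrDr; lra.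
have V1 : V <= D * ((1 + T * D) * ((1 + M) * (1 + U + b)) + 2 * (M * z)).
  by rewrite ler_wpM2l// lerD2r ler_wpM2l// addr_ge0.
apply: (@le_trans _ _ (U + h * (V + M * b + M * z))).
  have := ler_wpM2l (ltW h0) A1V; have := ler_wpM2l (ltW h0) A2V; lra.
apply: (@le_trans _ _ (U + h * ((D * (2 + T * D) * (1 + M) + 2 * D * M + M) * (1 + U + b + z)))).
  rewrite lerD2l ler_wpM2l ?(ltW h0)//.
  apply: (@le_trans _ _ (D * ((1 + T * D) * ((1 + M) * (1 + U + b)) + 2 * (M * z)) + M * b + M * z)).
    lra.
  rewrite -subr_ge0.
  rewrite (_ : _ - _ = D * (1 + M) * (1 + U + b) + D * (2 + T * D) * (1 + M) * z
    + 2 * D * M * (1 + U + b) + M * (1 + U)); last by ring.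
  by rewrite !addr_ge0// ?mulr_ge0// ?addr_ge0// ?mulr_ge0.
by apply: le_of_eq; ring.
Qed.

(** One step of the discrete Gronwall inequality, [e] being the growth factor of the
    previous steps. *)
Lemma gronwall_step {R : realFieldType} (c N E e : R) :
  0 <= c -> 0 <= N -> 0 <= E -> 1 <= e ->
  (1 + c + c) ^+ 5 * ((1 + c) * (e * E) + c * N)
  <= (1 + 2 * c) ^+ 6 * e * (E + c * N).
Proof.
move=> c0 N0 E0 e1; have r1 : 1 <= 1 + 2 * c by rewrite lerDl mulr_ge0.
have r0 : 0 <= 1 + 2 * c by exact: le_trans r1.
rewrite (_ : 1 + c + c = 1 + 2 * c); last by ring.
rewrite [leRHS](_ : _ = (1 + 2 * c) ^+ 5 * ((1 + 2 * c) * (e * E)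
  + (1 + 2 * c) * e * (c * N))); last by ring.
apply: ler_wpM2l; first exact: exprn_ge0.
have eE : 0 <= e * E by rewrite mulr_ge0// (le_trans _ e1).
apply: lerD; first by rewrite ler_wpM2r//; lra.
have cN : 0 <= c * N by exact: mulr_ge0.
apply: ler_peMl => //.
by apply: (le_trans e1); rewrite ler_peMl// (le_trans _ e1).
Qed.

Section SchemeSteps.
Context {R : realType} {d : nat} {disp : measure_display} {Om : measurableType disp}.
Variables (P : probability Om R) (T sigma2 Mg CA : R).
Variables (mu : R -> 'rV[R]_d -> 'rV[R]_d) (g : R -> R).
Variables (x0 : Om -> 'rV[R]_d) (W : R -> Om -> 'rV[R]_d).
Hypotheses (T0 : 0 < T) (iso0 : isotropic_gaussian P x0 sigma2).
Hypothesis wW : wiener P (filtration_of x0 W) W.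
Hypothesis sa : standing_assumptions T mu g Mg CA.
Variable K : nat.
Hypothesis K0 : (0 < K)%N.
Local Notation h := (step T K).
Local Notation t := (grid T K).
Local Notation F0 := (incr_filtration x0 W).
Local Notation x := (scheme W mu g T K x0).
Local Notation DZ := (DeltaZ W T K).
Local Notation DW := (DeltaW W T K).
Local Notation B k := (incr W 0 (t k)).
Implicit Types (i j l : 'I_d) (k : nat).

Lemma step_gt0 : 0 < h.
Proof. by rewrite divr_gt0// ltr0n. Qed.

Lemma step_le : h <= T.
Proof. by rewrite ler_pdivrMr ?ltr0n// ler_peMr ?ler1n// ltW. Qed.

Lemma grid_ge0 k : 0 <= t k.
Proof. by rewrite mulr_ge0// ltW// step_gt0. Qed.

Lemma gridS k : t k.+1 = t k + h.
Proof. by rewrite /grid -[k.+1]addn1 natrD mulrDl mul1r. Qed.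

Lemma grid_lt k : t k < t k.+1.
Proof. by rewrite gridS ltrDl step_gt0. Qed.

Lemma grid_le k : (k <= K)%N -> t k <= T.
Proof.
move=> kK; rewrite /grid /step mulrCA ler_piMr ?(ltW T0)//.
by rewrite ler_pdivrMr ?ltr0n// mul1r ler_nat.
Qed.

Lemma grid_in k : (k <= K)%N -> t k \in `[0, T].
Proof. by move=> kK; rewrite in_itv/= grid_ge0 grid_le. Qed.

Lemma half_step_le k : (k < K)%N -> t k + 2^-1 * h <= T.
Proof.
move=> kK; apply: (le_trans _ (grid_le kK)); rewrite gridS lerD2l.
have := step_gt0; lra.
Qed.

Lemma half_step_in k : (k < K)%N -> t k + 2^-1 * h \in `[0, T].
Proof.
move=> kK; rewrite in_itv/= half_step_le// andbT.
by rewrite addr_ge0 ?grid_ge0// mulr_ge0// ltW// step_gt0.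
Qed.

Lemma DeltaZE k i : (fun w => DZ k w 0 i) = area W (t k) (t k.+1) i.
Proof. by apply/funext => w; rewrite mxE. Qed.

Lemma DeltaWE k i : (fun w => DW k w 0 i) = wpath W (t k) i (t k.+1).
Proof. by apply/funext => w; rewrite !mxE. Qed.

Lemma gridB k : t k.+1 - t k = h.
Proof. by rewrite gridS addrC addKr. Qed.

Lemma measurable_DeltaZ k i : measurable_fun setT (fun w => DZ k w 0 i).
Proof. by rewrite DeltaZE; apply: (measurable_area wW) => //; [exact: grid_ge0|exact: grid_lt]. Qed.

Lemma measurable_DeltaW k i : measurable_fun setT (fun w => DW k w 0 i).
Proof.
by rewrite DeltaWE; apply: (measurable_wpath wW); [exact: grid_ge0|exact/ltW/grid_lt].
Qed.

Lemma DeltaZ_filtration k i : real_measurable (F0 (t k.+1)) (fun w => DZ k w 0 i).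
Proof. by rewrite DeltaZE; apply: (area_filtration wW); [exact: grid_ge0|exact: grid_lt]. Qed.

Lemma DeltaW_filtration k i : real_measurable (F0 (t k.+1)) (fun w => DW k w 0 i).
Proof.
rewrite DeltaWE; apply: wpath_filtration => //; first exact: grid_ge0.
exact/ltW/grid_lt.
Qed.

Lemma drift_continuous i s w : s \in `[0, T] -> (size w <= 3)%N ->
  continuous (pder T w (drift mu i) s).
Proof.
by have [_ _ _ _ /(_ i)[[_ H] _]] := sa => sT w3; apply: joint_space_continuous sT (H w w3).
Qed.

Lemma filtration_comp u s (f : 'rV[R]_d -> R) (X : Om -> 'rV[R]_d) : continuous f -> s <= u ->
  (forall i, real_measurable (F0 s) (fun w => X w 0 i)) ->
  real_measurable (F0 u) (f \o X).
Proof.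
move=> cf su mX; apply/real_measurableP.
apply: (@continuous_vector_measurable _ _ _ (g_sigma_algebraType _) _ _ cf) => i.
by apply/real_measurableP => C mC; apply: (incr_filtration_mono su); exact: mX.
Qed.

Lemma scheme_filtration k : (k <= K)%N ->
  forall i, real_measurable (F0 (t k)) (fun w => x k w 0 i).
Proof.
elim: k => [_ i|k IHk kK i]; first exact: incr_filtration_init.
have {}IHk := IHk (ltnW kK).
have le := ltW (grid_lt k).
have mx j : real_measurable (F0 (t k.+1)) (fun w => x k w 0 j).
  by move=> C mC; apply: (incr_filtration_mono le); exact: IHk.
have mmu j : real_measurable (F0 (t k.+1)) (fun w => mu (t k) (x k w) 0 j).
  apply: (@filtration_comp _ _ (fun z => mu (t k) z 0 j) _ _ le IHk).
  exact: (@drift_continuous j _ [::] (grid_in (ltnW kK))).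
have mZ j := @DeltaZ_filtration k j; have mW j := @DeltaW_filtration k j.
have mQ j : real_measurable (F0 (t k.+1)) (fun w => Q mu T K k (x k w) 0 j).
  rewrite (_ : (fun w => _) = (fun w => x k w 0 j + 2^-1 * h * mu (t k) (x k w) 0 j)); last first.
    by apply/funext => w; rewrite !mxE.
  by apply: real_measurableD => //; apply: real_measurableM => //; exact: real_measurable_cst.
have mQs j : real_measurable (F0 (t k.+1)) (fun w => Qstar W mu g T K k w (x k w) 0 j).
  rewrite (_ : (fun w => _) = (fun w => Q mu T K k (x k w) 0 j
      + 3 / 2 * (g (t k) / h) * DZ k w 0 j)); last first.
    by apply/funext => w; rewrite !mxE.
  by apply: real_measurableD => //; apply: real_measurableM => //; exact: real_measurable_cst.
have mdr (X : Om -> 'rV[R]_d) : (forall j, real_measurable (F0 (t k.+1)) (fun w => X w 0 j)) ->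
    real_measurable (F0 (t k.+1)) (fun w => mu (t k + 2^-1 * h) (X w) 0 i).
  move=> mX; apply: (@filtration_comp _ _ (fun z => mu (t k + 2^-1 * h) z 0 i) _ _ (lexx _) mX).
  exact: (@drift_continuous i _ [::] (half_step_in kK)).
rewrite (_ : (fun w => _) = (fun w => x k w 0 i
   + 3^-1 * h * (mu (t k + 2^-1 * h) (Q mu T K k (x k w)) 0 i
     + 2 * mu (t k + 2^-1 * h) (Qstar W mu g T K k w (x k w)) 0 i)
   + (g (t k) * DW k w 0 i
     + (g (t k.+1) - g (t k)) / h * (h * DW k w 0 i - DZ k w 0 i)))); last first.
  by apply/funext => w; rewrite /= !mxE.
have mdQ := mdr _ mQ; have mdQs := mdr _ mQs.
have mc (c : R) (f : Om -> R) : real_measurable (F0 (t k.+1)) f ->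
    real_measurable (F0 (t k.+1)) (fun w => c * f w).
  by move=> mf; apply: real_measurableM => //; exact: real_measurable_cst.
apply: real_measurableD; last first.
  apply: real_measurableD; first exact: (mc _ _).
  by apply: (mc _ _); apply: real_measurableB => //; exact: (mc _ _).
apply: real_measurableD => //; apply: (mc _ _); apply: real_measurableD => //.
exact: (mc _ _).
Qed.

Variable M : R.
Hypothesis bM : regular_bounds T mu g M.

(** Subtracting the Gaussian part [g W] from the scheme leaves a recursion
    without stochastic integral, because the noise increments telescope up to
    multiples of the increments of [g]. *)
Definition centered k w : 'rV[R]_d := x k w - g (t k) *: B k w.

Local Notation D := (d%:R * M).

Definition growth_rate := D * (2 + T * D) * (1 + M) + 2 * D * M + M.

Let M0 : 0 <= M := bound_ge0 bM.
Let D0 : 0 <= D. Proof. exact: mulr_ge0. Qed.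

Lemma growth_rate_ge0 : 0 <= growth_rate.
Proof. by rewrite /growth_rate !addr_ge0// ?mulr_ge0// ?addr_ge0// mulr_ge0// ltW. Qed.

Definition noise_size k w : R := 1 + (n1 (B k w) + h^-1 * n1 (DZ k w)).

Lemma centered_step k w : (k < K)%N ->
  n1 (centered k.+1 w) <= (1 + growth_rate * h) * n1 (centered k w)
    + growth_rate * h * noise_size k w.
Proof.
move=> kK; have h0 := step_gt0; have hT := step_le.
have hn0 := lt0r_neq0 h0.
set dg := g (t k.+1) - g (t k).
have dgM : `|dg| <= M * h.
  rewrite -(gridB k); apply: (diffusion_lip bM) => //; first exact: grid_ge0.
    exact/ltW/grid_lt.
  exact: grid_le.
set a1 := mu (t k + 2^-1 * h) (Q mu T K k (x k w)).
set a2 := mu (t k + 2^-1 * h) (Qstar W mu g T K k w (x k w)).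
(* The increment of [W] cancels: [P_k] contains it with the factor [g (t k.+1)]. *)
have E : centered k.+1 w = centered k w + (3^-1 * h) *: a1 + (2 / 3 * h) *: a2
    + (- dg) *: B k w + (- (dg / h)) *: DZ k w.
  by apply/rowP => i; rewrite /centered /= !mxE /a1 /a2 /dg; field.
have gM : `|g (t k)| <= M by apply: (diffusion_bound bM); exact: grid_in (ltnW kK).
have nx : n1 (x k w) <= n1 (centered k w) + M * n1 (B k w).
  rewrite -[x k w](subrK (g (t k) *: B k w)) -/(centered k w).
  by apply: (le_trans (n1D _ _)); rewrite lerD2l n1Z ler_wpM2r// n1_ge0.
have sT := half_step_in kK; have tT := grid_in (ltnW kK).
have nQ : n1 (Q mu T K k (x k w)) <= n1 (x k w) + 2^-1 * h * (D * (1 + n1 (x k w))).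
  apply: (le_trans (n1D _ _)); rewrite lerD2l n1Z ger0_norm; last by rewrite mulr_ge0// ltW.
  apply: ler_wpM2l; first by rewrite mulr_ge0// ltW.
  exact: (n1_drift bM).
have nQs : n1 (Qstar W mu g T K k w (x k w)) <= n1 (x k w)
    + 2^-1 * h * (D * (1 + n1 (x k w))) + 3 / 2 * (M * (h^-1 * n1 (DZ k w))).
  apply: (le_trans (n1D _ _)); apply: lerD; first exact: nQ.
  rewrite n1Z normrM (ger0_norm (_ : 0 <= 3 / 2))//.
  rewrite -[leLHS]mulrA ler_wpM2l// normrM normfV (gtr0_norm h0) -mulrA ler_wpM2r//.
  by rewrite mulr_ge0 ?n1_ge0// invr_ge0 ltW.
have n_1 : n1 a1 <= D * (1 + n1 (Q mu T K k (x k w))) by exact: (n1_drift bM).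
have n_2 : n1 a2 <= D * (1 + n1 (Qstar W mu g T K k w (x k w))) by exact: (n1_drift bM).
have b0 := n1_ge0 (B k w); have z0 : 0 <= h^-1 * n1 (DZ k w).
  by rewrite mulr_ge0 ?n1_ge0// invr_ge0 ltW.
have U0 := n1_ge0 (centered k w); have X0 := n1_ge0 (x k w).
have triangle : n1 (centered k.+1 w) <= n1 (centered k w) + 3^-1 * h * n1 a1
    + 2 / 3 * h * n1 a2 + M * h * n1 (B k w) + M * h * (h^-1 * n1 (DZ k w)).
  rewrite E; apply: (le_trans (n1D _ _)); apply: lerD; last first.
    by rewrite n1Z normrN normrM normfV (gtr0_norm h0) -[leLHS]mulrA; apply: ler_wpM2r.
  apply: (le_trans (n1D _ _)); apply: lerD; last first.
    by rewrite n1Z normrN ler_wpM2r.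
  apply: (le_trans (n1D _ _)); apply: lerD; last first.
    by rewrite n1Z ger0_norm// mulr_ge0// ltW.
  apply: (le_trans (n1D _ _)); rewrite lerD2l n1Z ger0_norm//.
  by rewrite mulr_ge0// ltW.
apply: (le_trans triangle); rewrite /noise_size.
exact: (growth_step D0 M0 h0 hT U0 b0 z0 X0 nx nQ nQs n_1 n_2).
Qed.

Local Notation m0 := (d%:R ^+ 6 * (gauss6 * T ^+ 3)).

Lemma measurable_B k i : measurable_fun setT (fun w => B k w 0 i).
Proof. by apply: (measurable_incr wW) => //; exact: grid_ge0. Qed.

Lemma measurable_x k i : (k <= K)%N -> measurable_fun setT (fun w => x k w 0 i).
Proof.
by move=> kK; apply: (incr_filtration_real_measurable iso0 wW); exact: scheme_filtration.
Qed.

Lemma B_moment6 k : (k <= K)%N -> (\int[P]_w (n1 (B k w) ^+ 6)%:E <= m0%:E)%E.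
Proof.
move=> kK; apply: moment6_n1 => i; first exact: measurable_B.
have := wpath_moment6 wW i (lexx _) (grid_ge0 k); rewrite wpathE => B6.
apply: (le_trans B6).
rewrite lee_fin ler_wpM2l ?gauss6_ge0// subr0.
by rewrite lerXn2r ?nnegrE ?grid_ge0 ?grid_le// ltW.
Qed.

Lemma DeltaZ_moment6 k (c : R) : (\int[P]_w (n1 (c *: DZ k w) ^+ 6)%:E
  <= (d%:R ^+ 6 * (c ^+ 6 * (gauss6 * h ^+ 9)))%:E)%E.
Proof.
have mZ i := @measurable_DeltaZ k i.
have E i : (fun w => (c *: DZ k w) 0 i) = (fun w => c * DZ k w 0 i).
  by apply/funext => w; rewrite mxE.
apply: moment6_n1 => i.
  by rewrite E; exact: measurable_funM.
rewrite (_ : (fun w => _) = (fun w => ((c * DZ k w 0 i) ^+ 6)%:E)); last first.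
  by apply/funext => w; rewrite mxE.
apply: moment6_scale => //.
have := area_moment6 wW (grid_ge0 k) (grid_lt k) i.
by rewrite gridB -DeltaZE.
Qed.

Lemma DeltaW_moment6 k (c : R) : (\int[P]_w (n1 (c *: DW k w) ^+ 6)%:E
  <= (d%:R ^+ 6 * (c ^+ 6 * (gauss6 * h ^+ 3)))%:E)%E.
Proof.
have mW i := @measurable_DeltaW k i.
have E i : (fun w => (c *: DW k w) 0 i) = (fun w => c * DW k w 0 i).
  by apply/funext => w; rewrite mxE.
apply: moment6_n1 => i.
  by rewrite E; exact: measurable_funM.
rewrite (_ : (fun w => _) = (fun w => ((c * DW k w 0 i) ^+ 6)%:E)); last first.
  by apply/funext => w; rewrite mxE.
apply: moment6_scale => //.
have := wpath_moment6 wW i (grid_ge0 k) (ltW (grid_lt k)).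
by rewrite gridB -DeltaWE.
Qed.

Lemma noise_moment6 k : (k < K)%N ->
  (\int[P]_w (noise_size k w ^+ 6)%:E <= (2 ^+ 5 * (1 + 2 ^+ 5 * (m0 + m0)))%:E)%E.
Proof.
move=> kK; have h0 := step_gt0.
have mB := measurable_n1 (measurable_B k); have mZ := measurable_n1 (measurable_DeltaZ k).
have mhZ : measurable_fun setT (fun w => h^-1 * n1 (DZ k w)) by exact: measurable_funM.
have B0 w := n1_ge0 (B k w).
have Z0 w : 0 <= h^-1 * n1 (DZ k w) by rewrite mulr_ge0 ?n1_ge0// invr_ge0 ltW.
have Z6 : (\int[P]_w ((h^-1 * n1 (DZ k w)) ^+ 6)%:E <= m0%:E)%E.
  have := DeltaZ_moment6 k h^-1.
  rewrite (_ : (fun w => _) = (fun w => ((h^-1 * n1 (DZ k w)) ^+ 6)%:E)); last first.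
    by apply/funext => w; rewrite n1Z ger0_norm// invr_ge0 ltW.
  move=> H; apply: (le_trans H); rewrite lee_fin ler_wpM2l ?exprn_ge0//.
  rewrite (_ : _ * _ = gauss6 * h ^+ 3); last by field; rewrite lt0r_neq0.
  by rewrite ler_wpM2l ?gauss6_ge0// lerXn2r ?nnegrE ?step_le ?(ltW h0)// ltW.
have C1 := @moment6_cst _ _ _ P (1 : R).
have := @moment6_comb _ _ _ P _ _ (fun w => n1 (B k w) + h^-1 * n1 (DZ k w)) 1 1 _ _
  ler01 ler01 mB mhZ _ (B_moment6 (ltnW kK)) Z6.
move=> /(_ _)/wrap[w|]; first by rewrite !mul1r ger0_norm ?addr_ge0.
move=> BZ6.
have := @moment6_comb _ _ _ P (cst 1) _ (noise_size k) 1 1 _ _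
  ler01 ler01 (measurable_cst _) (measurable_funD mB mhZ) _ C1 BZ6.
move=> /(_ _)/wrap[w|]; first by rewrite !mul1r ger0_norm// ?addr_ge0// ?addr_ge0.
by rewrite !mul1r expr1n.
Qed.

Hypothesis sigma2_ge0 : 0 <= sigma2.

Local Notation C := growth_rate.
Local Notation N6 := (2 ^+ 5 * (1 + 2 ^+ 5 * (m0 + m0))).
Local Notation init6 := (d%:R ^+ 6 * (gauss6 * sigma2 ^+ 3)).

Lemma centeredE k i w : centered k w 0 i = x k w 0 i - g (t k) * B k w 0 i.
Proof. by rewrite !mxE. Qed.

Lemma measurable_centered k i : (k <= K)%N -> measurable_fun setT (fun w => centered k w 0 i).
Proof.
move=> kK; under eq_fun do rewrite centeredE.
apply: measurable_funB; first exact: measurable_x.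
by apply: measurable_funM => //; exact: measurable_B.
Qed.

Let m0_ge0 : 0 <= m0.
Proof. 
apply: mulr_ge0; first exact: exprn_ge0.
by apply: mulr_ge0; [exact: gauss6_ge0|rewrite exprn_ge0// ltW]. Qed.

Let N6_ge0 : 0 <= N6.
Proof. 
apply: mulr_ge0; first exact: exprn_ge0.
apply: addr_ge0 => //; apply: mulr_ge0; first exact: exprn_ge0.
exact: addr_ge0. Qed.

Let init6_ge0 : 0 <= init6.
Proof. 
apply: mulr_ge0; first exact: exprn_ge0.
by apply: mulr_ge0; [exact: gauss6_ge0|exact: exprn_ge0]. Qed.

(** The convexity bound of [moment6_comb] multiplies the moment by at most
    [(1 + 2 C h) ^ 6] at each step and adds a term of order [h]. *)
Lemma centered_recursion k : (k <= K)%N -> (\int[P]_w (n1 (centered k w) ^+ 6)%:E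
  <= ((1 + 2 * (C * h)) ^+ (6 * k) * (init6 + k%:R * (C * h * N6)))%:E)%E.
Proof.
have h0 := step_gt0; have Ch : 0 <= C * h by rewrite mulr_ge0 ?growth_rate_ge0// ltW.
elim: k => [_|k IHk kK].
  rewrite muln0 expr0 mul1r mul0r addr0.
  have mx0 i := @measurable_x 0 i (leq0n K).
  rewrite (eq_integral (fun w => (n1 (x0 w) ^+ 6)%:E)); last first.
    move=> w _; congr ((n1 _ ^+ 6)%:E); apply/rowP => i.
    by rewrite centeredE incr_coordE /grid mul0r subrr mulr0 subr0.
  by apply: moment6_n1 => // i; exact: (gaussian_moment6 iso0).
have {}IHk := IHk (ltnW kK).
have mc := measurable_n1 (fun i => @measurable_centered k i (ltnW kK)).
have mn : measurable_fun setT (noise_size k).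
  apply: measurable_funD => //; apply: measurable_funD.
    exact: (measurable_n1 (measurable_B k)).
  by apply: measurable_funM => //; exact: (measurable_n1 (measurable_DeltaZ k)).
have a1 : 0 <= 1 + C * h by exact: addr_ge0.
have := @moment6_comb _ _ _ P _ _ (fun w => n1 (centered k.+1 w)) _ _ _ _ a1 Ch mc mn _ IHk
  (noise_moment6 kK).
move=> /(_ _)/wrap[w|H]; first by rewrite ger0_norm ?n1_ge0//; exact: centered_step.
apply: (le_trans H); rewrite lee_fin.
have E0 : 0 <= init6 + k%:R * (C * h * N6).
  by apply: addr_ge0 => //; apply: mulr_ge0 => //; exact: mulr_ge0.
have e1 : 1 <= (1 + 2 * (C * h)) ^+ (6 * k).
  by apply: exprn_ege1; rewrite lerDl mulr_ge0.
apply: (le_trans (gronwall_step Ch N6_ge0 E0 e1)).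
rewrite -exprD -mulnS -addrA -[k.+1]addn1 natrD [(k%:R + _) * _]mulrDl mul1r.
exact: lexx.
Qed.

Definition centered_bound := expR (12 * C * T) * (init6 + C * T * N6).

Lemma centered_moment6 k : (k <= K)%N ->
  (\int[P]_w (n1 (centered k w) ^+ 6)%:E <= centered_bound%:E)%E.
Proof.
move=> kK; apply: (le_trans (centered_recursion kK)); rewrite lee_fin.
have h0 := step_gt0; have Ch : 0 <= C * h by rewrite mulr_ge0 ?growth_rate_ge0// ltW.
have khT : k%:R * h <= T by exact: grid_le.
have C0 := growth_rate_ge0.
apply: ler_pM.
- by apply: exprn_ge0; rewrite addr_ge0// mulr_ge0.
- by apply: addr_ge0 => //; apply: mulr_ge0 => //; exact: mulr_ge0.
- apply: (@le_trans _ _ (expR (2 * (C * h)) ^+ (6 * k))).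
    by rewrite lerXn2r ?nnegrE ?expR_ge0 ?expR_ge1Dx// addr_ge0// mulr_ge0.
  rewrite -expRM_natl ler_expR natrM.
  rewrite (_ : _ * _ = 12 * C * (k%:R * h)); last by ring.
  by rewrite ler_wpM2l// mulr_ge0.
- rewrite lerD2l (_ : _ * _ = C * (k%:R * h) * N6); last by ring.
  by rewrite ler_wpM2r// ler_wpM2l.
Qed.

Definition scheme_bound := (1 + M) ^+ 5 * (centered_bound + M * m0).

Lemma scheme_moment6 k : (k <= K)%N ->
  (\int[P]_w (n1 (x k w) ^+ 6)%:E <= scheme_bound%:E)%E.
Proof.
move=> kK.
have mc := measurable_n1 (fun i => @measurable_centered k i kK).
have mB := measurable_n1 (measurable_B k).
have := @moment6_comb _ _ _ P _ _ (fun w => n1 (x k w)) 1 M _ _ ler01 M0 mc mB _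
  (centered_moment6 kK) (B_moment6 kK).
move=> /(_ _)/wrap[w|]; last by rewrite mul1r.
rewrite ger0_norm ?n1_ge0// mul1r -[x k w](subrK (g (t k) *: B k w)) -/(centered k w).
apply: (le_trans (n1D _ _)); rewrite lerD2l n1Z ler_wpM2r ?n1_ge0//.
exact: (diffusion_bound bM) (grid_in kK).
Qed.

(** [DeltaZ] has size [h ^ (3 / 2)] and [DeltaW] has size [h ^ (1 / 2)]; with these
    normalizations the moments of [step_size] are bounded independently of [K] and [k]. *)
Definition step_size k w : R := 1 + (n1 (x k w)
  + (n1 ((h * Num.sqrt h)^-1 *: DZ k w) + n1 ((Num.sqrt h)^-1 *: DW k w))).

Lemma step_size_ge1 k w : 1 <= step_size k w.
Proof. by rewrite lerDl !addr_ge0 ?n1_ge0. Qed.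

Lemma measurable_step_size k : (k <= K)%N -> measurable_fun setT (step_size k).
Proof.
move=> kK; apply: measurable_funD => //; apply: measurable_funD.
  by apply: measurable_n1 => i; exact: measurable_x.
apply: measurable_funD; apply: measurable_n1 => i; under eq_fun do rewrite mxE;
  apply: measurable_funM => //; [exact: measurable_DeltaZ|exact: measurable_DeltaW].
Qed.

Definition step_bound := let v := d%:R ^+ 6 * gauss6 in
  2 ^+ 5 * (1 + 2 ^+ 5 * (scheme_bound + 2 ^+ 5 * (v + v))).

Lemma step_size_moment6 k : (k < K)%N ->
  (\int[P]_w (step_size k w ^+ 6)%:E <= step_bound%:E)%E.
Proof.
move=> kK; have h0 := step_gt0; have hn0 := lt0r_neq0 h0.
have r0 : 0 < Num.sqrt h by rewrite sqrtr_gt0.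
have rn0 := lt0r_neq0 r0.
have r2 : Num.sqrt h ^+ 2 = h by rewrite sqr_sqrtr// ltW.
have Z6 := DeltaZ_moment6 k (h * Num.sqrt h)^-1.
rewrite (_ : _ * (_ * (gauss6 * _)) = d%:R ^+ 6 * gauss6) in Z6; last first.
  by move: r2 rn0; move: (Num.sqrt h) => r <- rn0; field.
have W6 := DeltaW_moment6 k (Num.sqrt h)^-1.
rewrite (_ : _ * (_ * (gauss6 * _)) = d%:R ^+ 6 * gauss6) in W6; last first.
  by move: r2 rn0; move: (Num.sqrt h) => r <- rn0; field.
have mx := measurable_n1 (fun i => @measurable_x k i (ltnW kK)).
have mZ : measurable_fun setT (fun w => n1 ((h * Num.sqrt h)^-1 *: DZ k w)).
  apply: measurable_n1 => i; under eq_fun do rewrite mxE.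
  by apply: measurable_funM => //; exact: measurable_DeltaZ.
have mW : measurable_fun setT (fun w => n1 ((Num.sqrt h)^-1 *: DW k w)).
  apply: measurable_n1 => i; under eq_fun do rewrite mxE.
  by apply: measurable_funM => //; exact: measurable_DeltaW.
have add2 (f f' : Om -> R) a b : measurable_fun setT f -> measurable_fun setT f' ->
    (forall w, 0 <= f w) -> (forall w, 0 <= f' w) ->
    (\int[P]_w (f w ^+ 6)%:E <= a%:E)%E -> (\int[P]_w (f' w ^+ 6)%:E <= b%:E)%E ->
    (\int[P]_w ((f w + f' w) ^+ 6)%:E <= (2 ^+ 5 * (a + b))%:E)%E.
  move=> mf mf' f0 f'0 fa fb.
  have := @moment6_comb _ _ _ P f f' (fun w => f w + f' w) 1 1 a b ler01 ler01 mf mf' _ fa fb.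
  move=> /(_ _)/wrap[w|]; first by rewrite !mul1r ger0_norm// addr_ge0.
  by rewrite !mul1r.
have C1 := @moment6_cst _ _ _ P (1 : R); rewrite [in leRHS]expr1n in C1.
apply: (add2 (cst 1) _ _ _ (measurable_cst _) _ _ _ C1).
- by apply: measurable_funD => //; exact: measurable_funD.
- by [].
- by move=> w; rewrite !addr_ge0 ?n1_ge0.
apply: (add2 _ _ _ _ mx _ _ _ (scheme_moment6 (ltnW kK))).
- exact: measurable_funD.
- by move=> w; exact: n1_ge0.
- by move=> w; rewrite !addr_ge0 ?n1_ge0.
by apply: add2 => // w; exact: n1_ge0.
Qed.

End SchemeSteps.

(** * The multi-indices of order 3/2 *)

Section Words.
Context {R : realType} {d : nat}.
Implicit Types (a : multi_index d) (r : 'I_d).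

(** The words whose coefficient need not vanish. *)
Definition words : seq (multi_index d) :=
  [:: None] :: [:: None; None] ::
  [seq [:: Some r] | r <- enum 'I_d] ++
  ([seq [:: None; Some r] | r <- enum 'I_d] ++ [seq [:: Some r; None] | r <- enum 'I_d]).

Lemma uniq_words : uniq words.
Proof.
have inj1 : injective (fun r => [:: Some r] : multi_index d) by move=> r s [].
have inj2 : injective (fun r => [:: None; Some r] : multi_index d) by move=> r s [].
have inj3 : injective (fun r => [:: Some r; None] : multi_index d) by move=> r s [].
have e := enum_uniq 'I_d.
have u1 := e; rewrite -(map_inj_uniq inj1) in u1.
have u2 := e; rewrite -(map_inj_uniq inj2) in u2.
have u3 := e; rewrite -(map_inj_uniq inj3) in u3.
have no (u : multi_index d) (f : 'I_d -> multi_index d) : (forall r, u != f r) -> u \notin [seq f r | r <- enum 'I_d].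
  by move=> uf; apply/mapP => -[r _] E; move: (uf r); rewrite E eqxx.
rewrite /words 2!cons_uniq !cat_uniq u1 u2 u3 !inE !mem_cat !negb_or !no//= andbT.
apply/andP; split; apply/hasPn => b.
  by rewrite mem_cat => /orP[] /mapP[r _ ->]; apply: no => s; apply/eqP.
by move=> /mapP[r _ ->]; apply: no.
Qed.

Inductive word_shape : multi_index d -> Prop :=
| ShapeNil : word_shape [::]
| ShapeT : word_shape [:: None]
| ShapeTT : word_shape [:: None; None]
| ShapeW r : word_shape [:: Some r]
| ShapeTW r : word_shape [:: None; Some r]
| ShapeWT r : word_shape [:: Some r; None]
| ShapeWW r s : word_shape [:: Some r; Some s]
| ShapeWWW r s q : word_shape [:: Some r; Some s; Some q].

Let A_set_nat a : A_set (3 / 2 : R) a -> (size a + zeros a <= 3)%N \/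
  (size a = 2 /\ zeros a = 2)%N.
Proof.
case=> [|[s2 sz]].
  by rewrite (_ : 2 * (3 / 2) = 3%:R); [rewrite ler_nat; left|field].
right; suff : size a = 2%N by rewrite -sz.
have : (size a)%:R = 2%:R :> R by rewrite s2; field.
by move=> /eqP; rewrite eqr_nat => /eqP.
Qed.

Lemma A_set_shape a : A_set (3 / 2 : R) a -> word_shape a.
Proof.
move=> /A_set_nat.
case: a => [_|[r|] a]; first exact: ShapeNil.
  case: a => [_|[s|] a]; first exact: ShapeW.
    case: a => [_|[q|] a]; first exact: ShapeWW.
      case: a => [_|b a]; first exact: ShapeWWW.
      by case=> [|[]]; rewrite /zeros/=; lia.
    by case=> [|[]]; rewrite /zeros/=; lia.
  case: a => [_|b a]; first exact: ShapeWT.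
  by case=> [|[]]; rewrite /zeros/=; lia.
case: a => [_|[s|] a]; first exact: ShapeT.
  case: a => [_|b a]; first exact: ShapeTW.
  by case=> [|[]]; rewrite /zeros/=; lia.
case: a => [_|b a]; first exact: ShapeTT.
by case=> [|[]]; rewrite /zeros/=; lia.
Qed.

Lemma words_A_set a : a \in words -> A_set (3 / 2 : R) a /\ a <> [::].
Proof.
have le3 b : (size b + zeros b <= 3)%N -> A_set (3 / 2 : R) b.
  by move=> b3; left; rewrite (_ : 2 * (3 / 2) = 3%:R); [rewrite ler_nat|field].
rewrite !inE !mem_cat => /or4P[/eqP->|/eqP->|/mapP[r _ ->]|/orP[]/mapP[r _ ->]];
  split => //; try exact: le3.
by right; split => //=; field.
Qed.

(** In the application [f a] is the iterated integral of the coefficient of [a]. *)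
Lemma sum_words (V : nmodType) (f : multi_index d -> V) :
  (forall a, a \notin words -> f a = 0) ->
  \sum_(a \in A_set (3 / 2 : R) `\ ([::] : multi_index d)) f a =
  f [:: None] + (f [:: None; None] + (\sum_(r < d) f [:: Some r]
    + (\sum_(r < d) f [:: None; Some r] + \sum_(r < d) f [:: Some r; None]))).
Proof.
move=> f0.
rewrite -(@fsbig_widen _ _ _ _ [set` words]); first last.
- by move=> a /= [_ /negP aw]; apply: f0.
- by move=> a /= /words_A_set.
rewrite -fsbig_seq ?uniq_words// /words !big_cons !big_cat/= !big_map.
by rewrite -!(big_enum _ _ xpredT)/= !big_enum.
Qed.

End Words.

(** * The local expansion of the scheme *)

(** Here [r] is the square root of [h], [B] is the size of the noise shift, and [Y] and
    [S] have size one: every term has order [h ^ (5 / 2)]. *)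
Lemma remainder_size {R : realFieldType} (h r T b S Y B : R) :
  0 < r -> r ^+ 2 = h -> h <= T -> 0 <= b -> 1 <= S -> 0 <= Y -> Y <= S ->
  0 <= B -> B <= b * (r * S) ->
  h * (h ^+ 2 * Y ^+ 2 + h * Y * B + h * Y * B ^+ 2 + B ^+ 3)
  <= (1 + T + b + (1 + T) * b ^+ 2 + b ^+ 3) * (h ^+ 2 * r * S ^+ 3).
Proof.
move=> r0 r2 hT b0 S1 Y0 YS B0 BrS.
have h0 : 0 <= h by rewrite -r2 sqr_ge0.
have S0 : 0 <= S by exact: le_trans S1.
have rT : r <= 1 + T.
  have [r1|/ltW r1] := leP r 1; first by apply: (le_trans r1); rewrite lerDl (le_trans h0).
  by apply: (@le_trans _ _ h); [rewrite -r2 expr2 ler_peMl// ltW|rewrite ler_wpDl].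
have T1 : 0 <= 1 + T by apply: le_trans rT; exact: ltW.
have rS : 0 <= r * S by rewrite mulr_ge0// ltW.
have S23 : S ^+ 2 <= S ^+ 3 by rewrite ler_weXn2l.
have hr : 0 <= h * r by rewrite mulr_ge0// ltW.
have p1 : h ^+ 2 * Y ^+ 2 <= (1 + T) * (h * r * S ^+ 3).
  rewrite [h ^+ 2]expr2 -[in leLHS]r2 (_ : _ * _ = r * (r ^+ 2 * r * Y ^+ 2)); last by ring.
  rewrite r2; apply: ler_pM => //; [exact: ltW|by rewrite mulr_ge0 ?sqr_ge0|].
  by rewrite ler_wpM2l// (le_trans _ S23)// lerXn2r ?nnegrE.
have p2 : h * Y * B <= b * (h * r * S ^+ 3).
  apply: (@le_trans _ _ (h * S * (b * (r * S)))).
    by apply: ler_pM => //; [exact: mulr_ge0|rewrite ler_wpM2l].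
  rewrite (_ : _ * _ = b * (h * r * S ^+ 2)); last by ring.
  by rewrite ler_wpM2l// ler_wpM2l.
have p3 : h * Y * B ^+ 2 <= (1 + T) * b ^+ 2 * (h * r * S ^+ 3).
  apply: (@le_trans _ _ (h * S * (b * (r * S)) ^+ 2)).
    apply: ler_pM; [exact: mulr_ge0|exact: sqr_ge0|by rewrite ler_wpM2l|].
    by rewrite lerXn2r ?nnegrE// mulr_ge0.
  rewrite (_ : _ * _ = r * (b ^+ 2 * (h * r * S ^+ 3))); last by ring.
  rewrite -[leRHS]mulrA ler_wpM2r// mulr_ge0 ?sqr_ge0// mulr_ge0// exprn_ge0//.
have p4 : B ^+ 3 <= b ^+ 3 * (h * r * S ^+ 3).
  apply: (@le_trans _ _ ((b * (r * S)) ^+ 3)).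
    by rewrite lerXn2r ?nnegrE// mulr_ge0.
  by apply: le_of_eq; rewrite -r2; ring.
apply: (@le_trans _ _ (h * ((1 + T) * (h * r * S ^+ 3) + b * (h * r * S ^+ 3)
    + (1 + T) * b ^+ 2 * (h * r * S ^+ 3) + b ^+ 3 * (h * r * S ^+ 3)))).
  by rewrite ler_wpM2l// !lerD.
by apply: le_of_eq; ring.
Qed.

(** One step minus the iterated integrals minus the fluctuation of the quadratic noise
    term leaves the remainder of the drift expansion and the error of the difference
    quotient of [g]. The second order part of [L0] in space, with the factor [L], is the
    conditional mean of the quadratic noise term. *)
Lemma expansion_identity {F : realFieldType} (h g dg dtg A1 A2 m dm Sm L SZ q u v : F) :
  h != 0 ->
  3^-1 * h * (A1 + 2 * A2) + (g * u + dg / h * (h * u - v))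
  - (h * m + h ^+ 2 / 2 * (dm + Sm + 2^-1 * g ^+ 2 * L) + g * u + (h * u - v) * dtg + g * SZ)
  - 3 / 2 * (g ^+ 2 / h) * (q - h ^+ 3 / 6 * L)
  = 3^-1 * h * (A1 + 2 * A2) - (h * m + 2^-1 * h ^+ 2 * (dm + Sm)
      + 2 / 3 * h * (3 / 2 * (g / h) * SZ) + 2 / 3 * h * ((3 / 2 * (g / h)) ^+ 2 * q))
    + (dg / h - dtg) * (h * u - v).
Proof. by move=> h0; field. Qed.

Section Means.
Context {R : realType} {disp : measure_display} {Om : measurableType disp}.
Variable P : probability Om R.
Implicit Types (f : Om -> R) (c : R).

Definition has_mean f c :=
  P.-integrable setT (EFin \o f) /\ (\int[P]_w (f w)%:E = c%:E)%E.

Lemma has_mean_scale f c (a : R) : has_mean f c -> has_mean (fun w => a * f w) (a * c).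
Proof.
move=> [fi fc]; split.
  rewrite (_ : EFin \o _ = (fun w => a%:E * (EFin \o f) w)%E); first exact: integrableZl.
  by apply/funext => w; rewrite /= EFinM.
under eq_integral do rewrite EFinM.
by rewrite integralZl// fc -EFinM.
Qed.

Lemma has_mean_sub f f' c c' : has_mean f c -> has_mean f' c' ->
  has_mean (fun w => f w - f' w) (c - c').
Proof.
move=> [fi fc] [fi' fc']; split.
  rewrite (_ : EFin \o _ = (fun w => (EFin \o f) w - (EFin \o f') w)%E).
    exact: integrableB.
  by apply/funext => w; rewrite /= EFinB.
under eq_integral do rewrite EFinB.
by rewrite integralB// fc fc' -EFinB.
Qed.

Lemma has_mean_sum n (f : 'I_n -> Om -> R) (c : 'I_n -> R) :
  (forall j, has_mean (f j) (c j)) ->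
  has_mean (fun w => \sum_(j < n) f j w) (\sum_(j < n) c j).
Proof.
move=> fc; split.
  rewrite (_ : EFin \o _ = (fun w => \sum_(j < n) (EFin \o f j) w)%E).
    by apply: integrable_sum => // j _; have [] := fc j.
  by apply/funext => w; rewrite /= sumEFin.
under eq_integral do rewrite -sumEFin.
rewrite (integral_sum measurableT) => [|j]; last by have [] := fc j.
by rewrite -sumEFin; apply: eq_bigr => j _; have [_ ->] := fc j.
Qed.

End Means.

Section LocalExpansion.
Context {R : realType} {d : nat} {disp : measure_display} {Om : measurableType disp}.
Variables (P : probability Om R) (T sigma2 Mg CA : R).
Variables (mu : R -> 'rV[R]_d -> 'rV[R]_d) (g : R -> R).
Variables (x0 : Om -> 'rV[R]_d) (W : R -> Om -> 'rV[R]_d).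
Hypotheses (T0 : 0 < T) (iso0 : isotropic_gaussian P x0 sigma2).
Hypothesis wW : wiener P (filtration_of x0 W) W.
Hypothesis sa : standing_assumptions T mu g Mg CA.
Variable K : nat.
Hypothesis K0 : (0 < K)%N.
Variable M : R.
Hypothesis bM : regular_bounds T mu g M.
Hypothesis sigma2_ge0 : 0 <= sigma2.
Local Notation h := (step T K).
Local Notation t := (grid T K).
Local Notation F0 := (incr_filtration x0 W).
Local Notation F := (filtration_of x0 W).
Local Notation x := (scheme W mu g T K x0).
Local Notation DZ := (DeltaZ W T K).
Local Notation DW := (DeltaW W T K).
Local Notation S := (step_size T mu g x0 W K).
Local Notation H i k w := (hess mu i (t k) (x k w)).
Implicit Types (i j l r : 'I_d) (k : nat) (a : multi_index d).

Let M0 : 0 <= M := bound_ge0 bM.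
Let h0 : 0 < h := step_gt0 T0 K0.

(** The iterated integral of the constant 1; for the word of time followed by noise it
    comes from integration by parts. *)
Definition word_weight a k w : R :=
  match a with
  | [:: None] => h
  | [:: None; None] => h ^+ 2 / 2
  | [:: Some r] => DW k w 0 r
  | [:: None; Some r] => h * DW k w 0 r - DZ k w 0 r
  | [:: Some r; None] => DZ k w 0 r
  | _ => 0
  end.

Definition coef_value a k w : 'rV[R]_d := coef T mu g a (t k) (x k w).

Definition iterated_value a k w : 'rV[R]_d := word_weight a k w *: coef_value a k w.

Lemma iterated_valueE a k w i :
  iterated_value a k w 0 i = word_weight a k w * coef_comp T mu g a i (t k) (x k w).
Proof. by rewrite !mxE. Qed.

Section Measurability.
Variable k : nat.
Hypothesis kK : (k < K)%N.
Implicit Types (f : Om -> R).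

Let tT : t k \in `[0, T]. Proof. exact: (grid_in T0 K0 (ltnW kK)). Qed.

Lemma pder_filtration i v : (size v <= 3)%N ->
  real_measurable (F0 (t k)) (fun w => pder T v (drift mu i) (t k) (x k w)).
Proof.
move=> v3; apply: (@filtration_comp _ _ _ _ _ _ _ _ (pder T v (drift mu i) (t k)) (x k) _ (lexx _)).
  exact: (drift_continuous sa tT v3).
exact: (scheme_filtration T0 wW sa K0 (ltnW kK)).
Qed.

Lemma coef_filtration a i : A_set (3 / 2 : R) a ->
  real_measurable (F0 (t k)) (fun w => coef_value a k w 0 i).
Proof.
have E b : (fun w => coef_value b k w 0 i) = (fun w => coef_comp T mu g b i (t k) (x k w)).
  by apply/funext => w; rewrite mxE.
rewrite E => /A_set_shape[|||r|r|r|r s|r s q].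
- exact: (scheme_filtration T0 wW sa K0 (ltnW kK)).
- under eq_fun do rewrite coef_comp_time//.
  exact: (@pder_filtration i [::]).
- under eq_fun do rewrite coef_comp_time2//.
  rewrite /L0; apply: real_measurableD.
    apply: real_measurableD; first exact: (@pder_filtration i [:: None]).
    apply: real_measurable_sum => j; apply: real_measurableM.
      exact: (@pder_filtration j [::]).
    exact: (@pder_filtration i [:: Some j]).
  apply: real_measurableM; first exact: real_measurable_cst.
  by apply: real_measurable_sum => j; exact: (@pder_filtration i [:: Some j; Some j]).
- under eq_fun do rewrite coef_comp_space.
  exact: real_measurable_cst.
- under eq_fun do rewrite coef_comp_time_space//.
  pose c := (i == r)%:R * dt T (fun s (_ : 'rV[R]_d) => g s) (t k) 0.
  have mc : real_measurable (F0 (t k)) (fun=> c) by exact: real_measurable_cst.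
  exact: mc.
- under eq_fun do rewrite coef_comp_space_time//.
  apply: real_measurableM; first exact: real_measurable_cst.
  exact: (@pder_filtration i [:: Some r]).
- under eq_fun do rewrite coef_comp_space2.
  exact: real_measurable_cst.
- under eq_fun do rewrite coef_comp_space3.
  exact: real_measurable_cst.
Qed.

Lemma hess_filtration i l j : real_measurable (F0 (t k)) (fun w => H i k w l j).
Proof. exact: (@pder_filtration i [:: Some l; Some j]). Qed.

Lemma coef_vec_measurable a : A_set (3 / 2 : R) a -> vec_measurable (F (t k)) (coef_value a k).
Proof.
move=> Aa _ [i [C [mC ->]]]; apply: incr_filtration_sub => //.
exact: coef_filtration mC.
Qed.

(** The coefficients that are integrated against the noise are bounded, by [M] or by
    [M * M], as the values of simple processes have to be. *)
Lemma word_iterated a : (A_set (3 / 2 : R) `\ ([::] : multi_index d)) a ->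
  is_iterated_vec P F W (t k) (t k.+1) a (coef_value a k) (iterated_value a k).
Proof.
move=> [Aa /= a0] i.
have mU := coef_filtration i Aa.
have mUT := incr_filtration_real_measurable iso0 wW mU.
have E : (fun w => iterated_value a k w 0 i) =
    (fun w => coef_value a k w 0 i * word_weight a k w).
  by apply/funext => w; rewrite mxE mulrC.
rewrite {}E.
have t0 := grid_ge0 T0 K0 k; have tlt := grid_lt T0 K0 k.
have hE : t k.+1 - t k = h by exact: gridB.
have DWE r w : DW k w 0 r = wpath W (t k) r (t k.+1) w by rewrite -DeltaWE.
have DZE r w : DZ k w 0 r = area W (t k) (t k.+1) r w by rewrite -DeltaZE.
have gM : `|g (t k)| <= M by exact: (diffusion_bound bM).
have zero : (forall w, coef_value a k w 0 i = 0) ->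
    exists2 Y, is_iterated P F W (t k) (t k.+1) (fun _ w => coef_value a k w 0 i) a Y &
      (fun w => coef_value a k w 0 i * word_weight a k w) = Y (t k.+1).
  move=> c0; have [Y iY Y0] := iterated_zero iso0 wW t0 tlt a.
  exists Y; last by rewrite -Y0; apply/funext => w; rewrite c0 mul0r.
  by rewrite (_ : (fun _ w => _) = (fun=> cst 0))//; apply/funext => _; apply/funext.
case: (A_set_shape Aa) a0 mU mUT zero => // [_ mU mUT _|_ mU mUT _|r _ mU mUT _|r _ mU mUT _
    |r _ mU mUT _|r s _ _ _ zero|r s q _ _ _ zero].
- have := iterated_time P x0 W tlt mUT.
  by rewrite hE.
- have := iterated_time_time P x0 W tlt mUT.
  by rewrite hE.
- under [X in exists2 Y, _ & X = _]eq_fun do rewrite /= DWE.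
  apply: (iterated_wiener iso0 wW t0 tlt r mU (M := M)) => w.
  rewrite mxE coef_comp_space normrM; apply: (le_trans _ gM).
  by rewrite ler_piMr//; case: (i == r); rewrite ?normr1 ?normr0.
- under [X in exists2 Y, _ & X = _]eq_fun do rewrite /= DWE DZE.
  pose c := (i == r)%:R * dt T (fun s (_ : 'rV[R]_d) => g s) (t k) 0.
  have cE w : coef_value [:: None; Some r] k w 0 i = c.
    by rewrite mxE coef_comp_time_space.
  have [Y iY Y1] := iterated_time_wiener wW t0 tlt r c.
  exists Y.
    by rewrite (_ : (fun _ w => _) = (fun=> cst c))//; apply/funext => _; apply/funext.
  by rewrite -Y1; apply/funext => w; rewrite cE hE.
- under [X in exists2 Y, _ & X = _]eq_fun do rewrite /= DZE.
  apply: (iterated_wiener_time iso0 wW t0 tlt r mU (M := M * M)) => w.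
  rewrite mxE coef_comp_space_time// normrM; apply: ler_pM => //.
  exact: (drift_jac_bound bM).
- by apply: zero => w; rewrite mxE coef_comp_space2.
- by apply: zero => w; rewrite mxE coef_comp_space3.
Qed.

End Measurability.

Local Notation I := (A_set (3 / 2 : R) `\ ([::] : multi_index d)).

(** The term of second order in [DeltaZ] of the drift evaluated at [Qstar] has size
    [h ^ 2], and only its fluctuation around its conditional mean is admissible at this
    order; the mean is accounted for by the second order part of [L0 mu]. *)
Definition martingale_part k w : 'rV[R]_d := \row_i (3 / 2 * (g (t k) ^+ 2 / h) *
  (quad (H i k w) (DZ k w) - h ^+ 3 / 6 * \sum_(j < d) H i k w j j)).

(** What is left of one step, and is of order [h ^ (5 / 2)]. *)
Definition drift_part k w : 'rV[R]_d :=
  x k.+1 w - x k w - \sum_(a \in I) iterated_value a k w - martingale_part k w.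

Lemma word_weight_words a k w : a \notin words -> word_weight a k w = 0.
Proof.
have m (f : 'I_d -> multi_index d) r : f r \in [seq f r | r <- enum 'I_d].
  by apply: map_f; rewrite mem_enum.
case: a => [|[r|] [|[s|] [|q a]]] //; rewrite !inE !mem_cat ?(m (fun r => [:: Some r]))
  ?(m (fun r => [:: None; Some r])) ?(m (fun r => [:: Some r; None])) ?orbT ?eqxx//.
Qed.

Lemma sum_iterated k w i : (k < K)%N -> (\sum_(a \in I) iterated_value a k w) 0 i =
  h * drift mu i (t k) (x k w) + h ^+ 2 / 2 * L0 T mu g (drift mu i) (t k) (x k w)
  + g (t k) * DW k w 0 i
  + (h * DW k w 0 i - DZ k w 0 i) * dt T (fun s (_ : 'rV[R]_d) => g s) (t k) (x k w)
  + g (t k) * \sum_(j < d) DZ k w 0 j * dx j (drift mu i) (t k) (x k w).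
Proof.
move=> kK; have tT := grid_in T0 K0 (ltnW kK).
rewrite sum_words; last first.
  by move=> a /word_weight_words E; rewrite /iterated_value E scale0r.
have one (f : 'I_d -> R) : \sum_(r < d) (i == r)%:R * f r = f i.
  rewrite (bigD1 i)//= eqxx mul1r big1 ?addr0// => r ri.
  by rewrite eq_sym (negbTE ri) mul0r.
have v1 : iterated_value [:: None] k w 0 i = h * drift mu i (t k) (x k w).
  by rewrite iterated_valueE coef_comp_time.
have v2 : iterated_value [:: None; None] k w 0 i =
    h ^+ 2 / 2 * L0 T mu g (drift mu i) (t k) (x k w).
  by rewrite iterated_valueE coef_comp_time2.
have v3 : (\sum_(r < d) iterated_value [:: Some r] k w) 0 i = g (t k) * DW k w 0 i.
  rewrite summxE -(one (fun r => g (t k) * DW k w 0 r)); apply: eq_bigr => r _.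
  by rewrite iterated_valueE coef_comp_space/=; ring.
have v4 : (\sum_(r < d) iterated_value [:: None; Some r] k w) 0 i =
    (h * DW k w 0 i - DZ k w 0 i) * dt T (fun s (_ : 'rV[R]_d) => g s) (t k) (x k w).
  rewrite summxE -(one (fun r => (h * DW k w 0 r - DZ k w 0 r) *
    dt T (fun s (_ : 'rV[R]_d) => g s) (t k) (x k w))); apply: eq_bigr => r _.
  by rewrite iterated_valueE coef_comp_time_space//= mulrCA.
have v5 : (\sum_(r < d) iterated_value [:: Some r; None] k w) 0 i =
    g (t k) * \sum_(j < d) DZ k w 0 j * dx j (drift mu i) (t k) (x k w).
  rewrite summxE mulr_sumr; apply: eq_bigr => r _.
  by rewrite iterated_valueE coef_comp_space_time//= mulrCA.
have add5 (A B C D E : 'rV[R]_d) (u1 u2 u3 u4 u5 : R) : A 0 i = u1 -> B 0 i = u2 ->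
    C 0 i = u3 -> D 0 i = u4 -> E 0 i = u5 ->
    (A + (B + (C + (D + E)))) 0 i = u1 + u2 + u3 + u4 + u5.
  by move=> <- <- <- <- <-; rewrite !mxE !addrA.
exact: add5 v1 v2 v3 v4 v5.
Qed.

Let r0 : 0 < Num.sqrt h. Proof. by rewrite sqrtr_gt0. Qed.

Let r2 : Num.sqrt h ^+ 2 = h. Proof. by rewrite sqr_sqrtr// ltW. Qed.

Lemma DeltaZ_size k w : n1 (DZ k w) <= h * Num.sqrt h * S k w.
Proof.
have hr : 0 < h * Num.sqrt h by exact: mulr_gt0.
have {1}-> : DZ k w = (h * Num.sqrt h) *: ((h * Num.sqrt h)^-1 *: DZ k w).
  by rewrite scalerA divff ?scale1r// lt0r_neq0.
rewrite n1Z (gtr0_norm hr) ler_wpM2l ?(ltW hr)// /step_size.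
have := n1_ge0 (x k w); have := n1_ge0 ((Num.sqrt h)^-1 *: DW k w); lra.
Qed.

Lemma DeltaW_size k w : n1 (DW k w) <= Num.sqrt h * S k w.
Proof.
have {1}-> : DW k w = Num.sqrt h *: ((Num.sqrt h)^-1 *: DW k w).
  by rewrite scalerA divff ?scale1r// lt0r_neq0.
rewrite n1Z (gtr0_norm r0) ler_wpM2l ?(ltW r0)// /step_size.
have := n1_ge0 (x k w); have := n1_ge0 ((h * Num.sqrt h)^-1 *: DZ k w); lra.
Qed.

Lemma n1_x_size k w : 1 + n1 (x k w) <= S k w.
Proof. by rewrite lerD2l lerDl addr_ge0 ?n1_ge0. Qed.

Lemma scheme_step k w i : x k.+1 w 0 i - x k w 0 i =
  3^-1 * h * (drift mu i (t k + 2^-1 * h) (x k w + (2^-1 * h) *: mu (t k) (x k w))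
    + 2 * drift mu i (t k + 2^-1 * h) (x k w + (2^-1 * h) *: mu (t k) (x k w)
       + (3 / 2 * (g (t k) / h)) *: DZ k w))
  + (g (t k) * DW k w 0 i + (g (t k.+1) - g (t k)) / h * (h * DW k w 0 i - DZ k w 0 i)).
Proof.
have add (y a b p q : 'rV[R]_d) (c1 c2 c3 c4 : R) :
    (y + c1 *: (a + 2 *: b) + (c2 *: p + c3 *: (c4 *: p - q))) 0 i - y 0 i =
    c1 * (a 0 i + 2 * b 0 i) + (c2 * p 0 i + c3 * (c4 * p 0 i - q 0 i)).
  by rewrite !mxE; ring.
exact: add.
Qed.

Lemma drift_partE k w i (b := (3 / 2 * (g (t k) / h)) *: DZ k w)
    (a := (2^-1 * h) *: mu (t k) (x k w)) : (k < K)%N ->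
  drift_part k w 0 i =
  3^-1 * h * (drift mu i (t k + 2^-1 * h) (x k w + a) + 2 * drift mu i (t k + 2^-1 * h) (x k w + a + b))
    - (h * drift mu i (t k) (x k w)
       + 2^-1 * h ^+ 2 * (dt T (drift mu i) (t k) (x k w)
           + \sum_(j < d) mu (t k) (x k w) 0 j * dx j (drift mu i) (t k) (x k w))
       + 2 / 3 * h * \sum_(j < d) b 0 j * dx j (drift mu i) (t k) (x k w)
       + 2 / 3 * h * quad (H i k w) b)
  + ((g (t k.+1) - g (t k)) / h - dt T (fun s (_ : 'rV[R]_d) => g s) (t k) (x k w))
    * (h * DW k w 0 i - DZ k w 0 i).
Proof.
move=> kK.
have sub4 (A B C D : 'rV[R]_d) (u v s : R) : A 0 i - B 0 i = u -> C 0 i = v -> D 0 i = s ->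
    (A - B - C - D) 0 i = u - v - s by move=> <- <- <-; rewrite !mxE.
have mE : martingale_part k w 0 i = 3 / 2 * (g (t k) ^+ 2 / h) *
  (quad (H i k w) (DZ k w) - h ^+ 3 / 6 * \sum_(j < d) H i k w j j) by rewrite mxE.
rewrite /drift_part (sub4 _ _ _ _ _ _ _ (scheme_step k w i) (sum_iterated w i kK) mE).
rewrite /L0 expansion_identity ?lt0r_neq0// -/a -/b.
have -> : \sum_(j < d) b 0 j * dx j (drift mu i) (t k) (x k w) =
    3 / 2 * (g (t k) / h) * \sum_(j < d) DZ k w 0 j * dx j (drift mu i) (t k) (x k w).
  have bE j : b 0 j = 3 / 2 * (g (t k) / h) * DZ k w 0 j by rewrite !mxE.
  by rewrite mulr_sumr; apply: eq_bigr => j _; rewrite bE -!mulrA.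
by rewrite quadZ.
Qed.

Definition drift_part_const := let b := 3 / 2 * M in
  2 * M * (1 + d%:R * M) ^+ 2 * (1 + T + b + (1 + T) * b ^+ 2 + b ^+ 3) + 2 * M.

Lemma drift_part_le k w i : (k < K)%N ->
  `|drift_part k w 0 i| <= drift_part_const * (h ^+ 2 * Num.sqrt h * S k w ^+ 3).
Proof.
move=> kK; have tT := grid_in T0 K0 (ltnW kK).
have hT := step_le T0 K0; have S1 : 1 <= S k w := step_size_ge1 _ _ _ _ _ _ _ _.
have S0 : 0 <= S k w by exact: le_trans S1.
have gM : `|g (t k)| <= M by exact: (diffusion_bound bM).
have hr : 0 <= h * Num.sqrt h by rewrite mulr_ge0// ltW.
rewrite (drift_partE w i kK).
set b := (3 / 2 * (g (t k) / h)) *: DZ k w.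
have nb : n1 b <= 3 / 2 * M * (Num.sqrt h * S k w).
  rewrite n1Z normrM ger0_norm// normrM normfV (gtr0_norm h0).
  rewrite -[leLHS]mulrA -[leRHS]mulrA ler_wpM2l// -mulrA.
  apply: ler_pM => //; first by rewrite mulr_ge0 ?n1_ge0// invr_ge0 ltW.
  rewrite [leLHS]mulrC ler_pdivrMr//; apply: (le_trans (DeltaZ_size k w)).
  by apply: le_of_eq; ring.
have := drift_expansion bM (x k w) (grid_ge0 T0 K0 k) (ltW h0) (half_step_le T0 K0 kK) i b.
set E1 := (X in `|X| <= _) => E1le.
have rem := remainder_size r0 r2 hT (_ : 0 <= 3 / 2 * M) S1 (_ : 0 <= 1 + n1 (x k w))
  (n1_x_size k w) (n1_ge0 b) nb.
have e1 : `|E1| <= 2 * M * (1 + d%:R * M) ^+ 2 * ((1 + T + 3 / 2 * M + (1 + T) * (3 / 2 * M) ^+ 2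
    + (3 / 2 * M) ^+ 3) * (h ^+ 2 * Num.sqrt h * S k w ^+ 3)).
  apply: (le_trans E1le); apply: ler_wpM2l.
    by rewrite mulr_ge0 ?sqr_ge0// mulr_ge0.
  by apply: rem; [rewrite mulr_ge0|rewrite addr_ge0 ?n1_ge0].
apply: (le_trans (ler_normD _ _)).
set u := h ^+ 2 * Num.sqrt h * S k w ^+ 3 in e1 *.
have -> : drift_part_const * u = 2 * M * (1 + d%:R * M) ^+ 2 * ((1 + T + 3 / 2 * M
    + (1 + T) * (3 / 2 * M) ^+ 2 + (3 / 2 * M) ^+ 3) * u) + 2 * M * u.
  by rewrite /drift_part_const/=; ring.
apply: lerD; first exact: e1.
rewrite normrM.
have slope : `|(g (t k.+1) - g (t k)) / h - dt T (fun s (_ : 'rV[R]_d) => g s) (t k) (x k w)|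
    <= M * h.
  have := diffusion_time bM (x k w) (grid_ge0 T0 K0 k) (ltW (grid_lt T0 K0 k)) (grid_le T0 K0 kK).
  rewrite gridB; set dg := g _ - g _; set dtg := dt _ _ _ _ => le2.
  have -> : dg / h - dtg = (dg - h * dtg) / h by field; rewrite lt0r_neq0.
  rewrite normrM normfV (gtr0_norm h0) ler_pdivrMr//; apply: (le_trans le2).
  by apply: le_of_eq; ring.
have noise : `|h * DW k w 0 i - DZ k w 0 i| <= 2 * (h * Num.sqrt h * S k w).
  apply: (le_trans (ler_normB _ _)).
  rewrite (_ : 2 * _ = h * (Num.sqrt h * S k w) + h * Num.sqrt h * S k w); last by ring.
  apply: lerD.
    rewrite normrM (gtr0_norm h0) ler_wpM2l ?(ltW h0)//.
    exact: le_trans (coord_le_n1 _ _) (DeltaW_size k w).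
  exact: le_trans (coord_le_n1 _ _) (DeltaZ_size k w).
apply: (le_trans (ler_pM _ _ slope noise)) => //.
rewrite [leLHS](_ : _ = 2 * M * (h ^+ 2 * Num.sqrt h * S k w)); last by ring.
rewrite ler_wpM2l ?mulr_ge0// /u ler_wpM2l//.
  by rewrite mulr_ge0 ?sqr_ge0// ltW.
by rewrite -[leLHS]expr1 ler_weXn2l.
Qed.

Definition martingale_part_const := 3 / 2 * M ^+ 2 * (2 * M + d%:R * M).

Lemma martingale_part_le k w i : (k < K)%N ->
  `|martingale_part k w 0 i| <= martingale_part_const * (h ^+ 2 * S k w ^+ 2).
Proof.
move=> kK; have tT := grid_in T0 K0 (ltnW kK).
have S1 : 1 <= S k w := step_size_ge1 _ _ _ _ _ _ _ _.
have S0 : 0 <= S k w by exact: le_trans S1.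
have gM : `|g (t k)| <= M by exact: (diffusion_bound bM).
have hr : 0 <= h * Num.sqrt h by rewrite mulr_ge0// ltW.
have qle : `|quad (H i k w) (DZ k w)| <= 2 * M * (h ^+ 3 * S k w ^+ 2).
  apply: (le_trans (quad_bound _ (fun l j => drift_hess_bound bM i l j (x k w) tT))).
  rewrite ler_wpM2l ?mulr_ge0//.
  apply: (@le_trans _ _ ((h * Num.sqrt h * S k w) ^+ 2)).
    by rewrite [leLHS]expr2 [leRHS]expr2; apply: ler_pM; rewrite ?n1_ge0 ?DeltaZ_size.
  rewrite (_ : (h * Num.sqrt h * S k w) ^+ 2 = h ^+ 2 * Num.sqrt h ^+ 2 * S k w ^+ 2); last by ring.
  by rewrite r2; apply: le_of_eq; ring.
have sle : `|h ^+ 3 / 6 * \sum_(j < d) H i k w j j| <= d%:R * M * (h ^+ 3 * S k w ^+ 2).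
  rewrite normrM ger0_norm ?divr_ge0 ?exprn_ge0 ?(ltW h0)//.
  have s1 : `|\sum_(j < d) H i k w j j| <= d%:R * M.
    apply: (le_trans (ler_norm_sum _ _ _)).
    have -> : d%:R * M = \sum_(j < d) M by rewrite sumr_const card_ord mulr_natl.
    by apply: ler_sum => j _; exact: (drift_hess_bound bM).
  rewrite mulrC; apply: ler_pM => //; first by rewrite divr_ge0// exprn_ge0// ltW.
  have S2 : 1 <= S k w ^+ 2 by exact: exprn_ege1.
  rewrite ler_wpM2l ?exprn_ge0 ?(ltW h0)//; apply: le_trans S2; lra.
rewrite mxE normrM.
have coef : `|3 / 2 * (g (t k) ^+ 2 / h)| <= 3 / 2 * M ^+ 2 / h.
  rewrite normrM ger0_norm// -mulrA ler_wpM2l// normrM normfV (gtr0_norm h0).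
  by rewrite ler_wpM2r ?invr_ge0 ?(ltW h0)// normrX lerXn2r ?nnegrE.
apply: (le_trans (ler_pM _ _ coef (le_trans (ler_normB _ _) (lerD qle sle)))) => //.
by apply: le_of_eq; rewrite /martingale_part_const; field;
  rewrite lt0r_neq0.
Qed.

Section ConditionalMean.
Variables (k : nat) (A : set Om).
Hypotheses (kK : (k < K)%N) (FA : F0 (t k) A).

Let xi i l j w : R := \1_A w * H i k w l j.

Let xi_filtration i l j : real_measurable (F0 (t k)) (xi i l j).
Proof.
apply: real_measurableM; last exact: hess_filtration.
by apply/real_measurableP; exact: (@measurable_indic _ (g_sigma_algebraType _)).
Qed.

Let xi_bound i l j w : `|xi i l j w| <= M.
Proof.
have hM := drift_hess_bound bM i l j (x k w) (grid_in T0 K0 (ltnW kK)).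
rewrite normrM; apply: le_trans hM; rewrite ler_piMl//.
by rewrite indicE; case: (_ \in _); rewrite ?normr1 ?normr0.
Qed.

Let mean i j := fine (\int[P]_w (xi i j j w)%:E)%E.

Let xi_mean i j : has_mean P (xi i j j) (mean i j).
Proof.
have mxi := incr_filtration_real_measurable iso0 wW (@xi_filtration i j j).
have ixi : P.-integrable setT (EFin \o xi i j j).
  exact: bounded_integrable mxi (@xi_bound i j j).
by split => //; rewrite /mean fineK//; exact: (integrable_fin_num measurableT ixi).
Qed.

Let xi_area_mean i l j :
  has_mean P (fun w => xi i l j w * DZ k w 0 j * DZ k w 0 l)
    ((j == l)%:R * (h ^+ 3 / 3) * mean i j).
Proof.
have [ii ie] := area_cross iso0 wW (grid_ge0 T0 K0 k) (grid_lt T0 K0 k)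
  (@xi_filtration i l j) (@xi_bound i l j) j l.
have E : (fun w => xi i l j w * DZ k w 0 j * DZ k w 0 l) =
  (fun w => xi i l j w * area W (t k) (t k.+1) j w * area W (t k) (t k.+1) l w).
  by apply/funext => w; rewrite -!DeltaZE.
rewrite E; split; first exact: ii.
have e0 : (j == l)%:R * ((t k.+1 - t k) ^+ 3 / 3) * fine (\int[P]_w (xi i l j w)%:E)%E =
    (j == l)%:R * (h ^+ 3 / 3) * mean i j.
  by have [->|_] := eqVneq j l; [rewrite /mean gridB|rewrite !mul0r].
exact: (etrans ie (congr1 EFin e0)).
Qed.

(** Given the past, the components of [DeltaZ] are uncorrelated with variance
    [h ^ 3 / 3], and the correction term removes exactly the mean. *)
Lemma martingale_part_mean i :
  has_mean P (fun w => \1_A w * martingale_part k w 0 i) 0.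
Proof.
pose c := 3 / 2 * (g (t k) ^+ 2 / h).
have E : (fun w => \1_A w * martingale_part k w 0 i) =
    (fun w => c * (\sum_(j < d) \sum_(l < d) quad_weight j l *
       (xi i l j w * DZ k w 0 j * DZ k w 0 l) - h ^+ 3 / 6 * \sum_(j < d) xi i j j w)).
  apply/funext => w; rewrite mxE -/c quad_sum mulrCA; congr (_ * _).
  rewrite mulrBr; congr (_ - _).
    rewrite mulr_sumr; apply: eq_bigr => j _; rewrite mulr_sumr; apply: eq_bigr => l _.
    by rewrite /xi; ring.
  by rewrite mulrCA mulr_sumr.
have zero : \sum_(j < d) \sum_(l < d) quad_weight j l *
    ((j == l)%:R * (h ^+ 3 / 3) * mean i j) - h ^+ 3 / 6 * \sum_(j < d) mean i j = 0.
  apply/eqP; rewrite subr_eq0; apply/eqP; rewrite mulr_sumr; apply: eq_bigr => j _.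
  rewrite (bigD1 j)//= big1 ?addr0; last by move=> l lj; rewrite eq_sym (negbTE lj) !mul0r mulr0.
  by rewrite /quad_weight !eqxx/=; field.
have m1 : has_mean P (fun w => \sum_(j < d) \sum_(l < d) quad_weight j l *
       (xi i l j w * DZ k w 0 j * DZ k w 0 l)) (\sum_(j < d) \sum_(l < d) quad_weight j l *
    ((j == l)%:R * (h ^+ 3 / 3) * mean i j)).
  apply: has_mean_sum => j; apply: has_mean_sum => l.
  by apply: has_mean_scale; exact: xi_area_mean.
have m2 := has_mean_scale (h ^+ 3 / 6) (has_mean_sum (xi_mean i)).
have := has_mean_scale c (has_mean_sub m1 m2).
by rewrite zero mulr0 -E.
Qed.

End ConditionalMean.

Section Remainders.
Variable k : nat.
Hypothesis kK : (k < K)%N.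

Lemma martingale_part_cond i :
  is_cond_exp P (F (t k)) (fun w => martingale_part k w 0 i) (cst 0).
Proof.
apply: (is_cond_exp0 wW); last first.
  by move=> A FA; have [_ ->] := martingale_part_mean kK FA i.
have FT : F0 (t k) setT by rewrite -setC0 -setTD; apply: sigma_algebraCD; exact: sigma_algebra0.
have [+ _] := martingale_part_mean kK FT i.
by rewrite indicT; under eq_fun do rewrite mul1r.
Qed.

Lemma measurable_martingale_part i : measurable_fun setT (fun w => martingale_part k w 0 i).
Proof.
have [/(measurable_int _)/measurable_EFinP + _ _ _] := martingale_part_cond i.
exact.
Qed.

Lemma measurable_word_weight a : measurable_fun setT (word_weight a k).
Proof.
have mZ r := measurable_DeltaZ T0 wW K0 k r.
have mW r := measurable_DeltaW T0 wW K0 k r.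
case: a => [|[r|] [|[s|] [|q a]]] //=; rewrite /word_weight; try exact: measurable_cst.
- exact: mW.
- exact: mZ.
- by apply: measurable_funB => //; apply: measurable_funM => //; exact: mW.
Qed.

Lemma measurable_drift_part i : measurable_fun setT (fun w => drift_part k w 0 i).
Proof.
have sub4 (A B C D : 'rV[R]_d) : (A - B - C - D) 0 i = A 0 i - B 0 i - C 0 i - D 0 i.
  by rewrite !mxE.
under eq_fun do rewrite /drift_part sub4.
apply: measurable_funB; last exact: measurable_martingale_part.
apply: measurable_funB.
  apply: measurable_funB.
    exact: (measurable_x T0 iso0 wW sa K0).
  by apply: (measurable_x T0 iso0 wW sa K0); exact: ltnW.
have mJ a : measurable_fun setT (fun w => iterated_value a k w 0 i).
  have [aw|aw] := boolP (a \in words); last first.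
    rewrite (_ : (fun w => _) = cst 0)//; apply/funext => w.
    by rewrite iterated_valueE word_weight_words// mul0r.
  under eq_fun do rewrite mxE.
  apply: measurable_funM; first exact: measurable_word_weight.
  apply: (incr_filtration_real_measurable iso0 wW); apply: coef_filtration => //.
  by have [] := @words_A_set R d a aw.
under eq_fun do (rewrite sum_words; last by move=> a /word_weight_words E; rewrite /iterated_value E scale0r).
have addE (A B C D E : 'rV[R]_d) : (A + (B + (C + (D + E)))) 0 i =
    A 0 i + (B 0 i + (C 0 i + (D 0 i + E 0 i))) by rewrite !mxE.
under eq_fun do rewrite addE !summxE.
by do 4! (apply: measurable_funD; first by [|apply: measurable_sum]); apply: measurable_sum.
Qed.

(** The exponent 3 is the largest one whose square is controlled by the sixth moment of
    [step_size]. *)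
Lemma second_moment_le (Z : Om -> 'rV[R]_d) (c : R) : 0 <= c ->
  (forall w i, `|Z w 0 i| <= c * S k w ^+ 3) ->
  (\int[P]_w (enorm (Z w) ^+ 2)%:E <= (d%:R * c ^+ 2 * step_bound T sigma2 M (d := d))%:E)%E.
Proof.
move=> c0 Zc; have mS := measurable_step_size T0 iso0 wW sa K0 (ltnW kK).
have S6 w : 0 <= S k w ^+ 6 by exact: pow6_ge0.
apply: (@le_trans _ _ (\int[P]_w ((d%:R * c ^+ 2)%:E * (S k w ^+ 6)%:E))%E).
  apply: ge0_le_integral_nomeas => w _; first by rewrite lee_fin sqr_ge0.
  rewrite -EFinM lee_fin sqr_enorm.
  have -> : d%:R * c ^+ 2 * S k w ^+ 6 = \sum_(i < d) (c * S k w ^+ 3) ^+ 2.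
    by rewrite sumr_const card_ord -[RHS]mulr_natl; ring.
  apply: ler_sum => i _; rewrite -[leLHS]real_normK ?num_real//.
  by rewrite lerXn2r ?nnegrE// (le_trans _ (Zc w i)).
rewrite ge0_integralZl//; first last.
- by rewrite lee_fin mulr_ge0 ?sqr_ge0.
- by move=> w _; rewrite lee_fin.
- by apply/measurable_EFinP; exact: measurable_funX.
rewrite [leRHS]EFinM lee_wpmul2l ?lee_fin ?mulr_ge0 ?sqr_ge0//.
exact: (step_size_moment6 T0 iso0 wW sa K0 bM sigma2_ge0 kK).
Qed.

Lemma martingale_part_moment :
  (\int[P]_w (enorm (martingale_part k w) ^+ 2)%:E
   <= (d%:R * martingale_part_const ^+ 2 * step_bound T sigma2 M (d := d) * h ^+ 4)%:E)%E.
Proof.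
have C0 : 0 <= martingale_part_const.
  by rewrite /martingale_part_const !mulr_ge0 ?sqr_ge0// addr_ge0 ?mulr_ge0.
apply: (le_trans (@second_moment_le _ (martingale_part_const * h ^+ 2) _ _)).
- by rewrite mulr_ge0 ?sqr_ge0.
- move=> w i; apply: (le_trans (martingale_part_le w i kK)).
  rewrite -[leRHS]mulrA ler_wpM2l// ler_wpM2l ?sqr_ge0//.
  by rewrite ler_weXn2l//; exact: step_size_ge1.
by rewrite lee_fin; apply: le_of_eq; ring.
Qed.

Lemma drift_part_moment :
  (\int[P]_w (enorm (drift_part k w) ^+ 2)%:E
   <= (d%:R * drift_part_const ^+ 2 * step_bound T sigma2 M (d := d) * h ^+ 5)%:E)%E.
Proof.
have C0 : 0 <= drift_part_const.
  have b0 : 0 <= 3 / 2 * M by rewrite mulr_ge0.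
  have T1 : 0 <= 1 + T by rewrite addr_ge0// ltW.
  apply: addr_ge0; last by rewrite mulr_ge0.
  apply: mulr_ge0; first by rewrite mulr_ge0 ?sqr_ge0// mulr_ge0.
  apply: addr_ge0; last exact: exprn_ge0.
  apply: addr_ge0; last by rewrite mulr_ge0 ?sqr_ge0.
  exact: addr_ge0.
apply: (le_trans (@second_moment_le _ (drift_part_const * (h ^+ 2 * Num.sqrt h)) _ _)).
- by rewrite !mulr_ge0 ?sqr_ge0// ltW.
- move=> w i; apply: (le_trans (drift_part_le w i kK)).
  by rewrite mulrA.
rewrite lee_fin (_ : (_ * (_ * Num.sqrt h)) ^+ 2 = drift_part_const ^+ 2 * (h ^+ 4 * Num.sqrt h ^+ 2)).
  by rewrite r2; apply: le_of_eq; ring.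
by ring.
Qed.

End Remainders.

End LocalExpansion.

(** * The order of the scheme *)

Theorem lemma3p3 (R : realType) (d : nat) (disp : measure_display)
    (Omega : measurableType disp) (P : probability Omega R)
    (T sigma2 Mg CA : R)
    (mu : R -> 'rV[R]_d -> 'rV[R]_d) (g : R -> R)
    (x0 : Omega -> 'rV[R]_d) (W : R -> Omega -> 'rV[R]_d) :
  (0 < d)%N -> 0 < T -> 0 <= sigma2 ->
  isotropic_gaussian P x0 sigma2 ->
  wiener P (filtration_of x0 W) W ->
  standing_assumptions T mu g Mg CA ->
  general_strong_scheme P (filtration_of x0 W) W mu g T (3 / 2) x0
    (fun K => scheme W mu g T K x0).
Proof.
move=> _ T0 s20 iso0 wW sa.
have [M bM] := standing_regular_bounds T0 sa.
pose B := step_bound T sigma2 M (d := d).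
pose c1 := d%:R * martingale_part_const M (d := d) ^+ 2 * B.
pose c2 := d%:R * drift_part_const T M (d := d) ^+ 2 * B.
(* The coefficients of the scheme are the exact ones, so that their error is zero. *)
exists 0, (`|c1| + `|c2|) => K K0 h t I.
have h0 : 0 < h := step_gt0 T0 K0.
split; first by [].
split.
  move=> k kK _ [i [C [mC ->]]]; apply: incr_filtration_sub => //.
  exact: (scheme_filtration T0 wW sa K0 kK).
exists (coef_value T mu g x0 W K), (iterated_value T mu g x0 W K),
  (martingale_part T mu g x0 W K), (drift_part T mu g x0 W K).
split.
- move=> k kK; split.
  + by move=> a [Aa _]; exact: (coef_vec_measurable T0 wW sa K0 kK).
  + by move=> a Ia; exact: (word_iterated T0 iso0 wW sa K0 bM kK Ia).
  + have cancel (y y' s r : 'rV[R]_d) : y' = y + s + (r + (y' - y - s - r)).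
      by apply/rowP => j; rewrite !mxE; ring.
    by apply: aeW => w; exact: cancel.
- move=> a Ia; rewrite mul0r integral0_eq// => w _.
  congr EFin; apply: (big_ind (fun y => y = 0)) => // [_ _ -> ->|k _]; first exact: maxxx.
  by rewrite subrr sqr_enorm big1// => i _; rewrite mxE expr0n.
- move=> k kK; split.
  + move=> _ [i [C [mC ->]]].
    have := measurable_martingale_part T0 iso0 wW sa K0 bM kK i measurableT mC.
    by rewrite setTI.
  + by move=> i; exact: (martingale_part_cond T0 iso0 wW sa K0 bM kK i).
  + apply: (le_trans (martingale_part_moment T0 iso0 wW sa K0 bM s20 kK)).
    rewrite lee_fin (_ : 2 * (3 / 2) + 1 = 4%:R); last by field.
    rewrite powR_mulrn ?(ltW h0)// ler_wpM2r ?exprn_ge0 ?(ltW h0)//.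
    by apply: (le_trans (ler_norm c1)); rewrite lerDl.
- move=> k kK; split.
  + move=> _ [i [C [mC ->]]].
    have := measurable_drift_part T0 iso0 wW sa K0 bM kK i measurableT mC.
    by rewrite setTI.
  + apply: (le_trans (drift_part_moment T0 iso0 wW sa K0 bM s20 kK)).
    rewrite lee_fin (_ : 2 * (3 / 2) + 2 = 5%:R); last by field.
    rewrite powR_mulrn ?(ltW h0)// ler_wpM2r ?exprn_ge0 ?(ltW h0)//.
    by apply: (le_trans (ler_norm c2)); rewrite lerDr.
Qed.
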